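(* Let $u$ be the solution of the boundary value problem $\mathcal{L}u=f$ in $\Omega$, $u=g$ on $\partial\Omega$, with (symmetric, not necessarily positive definite) Hessian $H(\boldsymbol{x})$, let $\{\mathcal{T}_h\}$ be a family of simplicial meshes of $\Omega\subset\mathbb{R}^d$, let $u_h$ be the linear finite element solution on $\mathcal{T}_h$, let $N$ be the number of elements of $\mathcal{T}_h$, and let $R$ be a recovered Hessian (symmetric, not necessarily positive definite) with element averages $R_K$, $K\in\mathcal{T}_h$. For a given positive parameter $\alpha_h>0$, assume that $R$ satisfies $$C_{R-,K}\,I\le\big(\alpha_h I+|R_K|\big)^{-1}\big(\alpha_h I+|H(\boldsymbol{x})|\big),\qquad\forall\boldsymbol{x}\in K,\ \forall K\in\mathcal{T}_h,$$ $$\big(\alpha_h I+|R_K|\big)^{-1}|H(\boldsymbol{x})|\le C_{R+,K}\,I,\qquad\forall\boldsymbol{x}\in K,\ \forall K\in\mathcal{T}_h,$$ where $C_{R-,K}$ and $C_{R+,K}$ are element-wise constants satisfying $$C_{R-}\le\min_{K\in\mathcal{T}_h}C_{R-,K}\qquad\text{and}\qquad\sqrt{\frac1N\sum_{K\in\mathcal{T}_h}C_{R+,K}^2}\le C_{R+}$$ with some mesh-independent positive constants $C_{R-}$ and $C_{R+}$. Suppose $u\in H^2(\Omega)$. Then for any mesh $\mathcal{T}_h$ that is quasi-$M$-uniform with respect to the metric tensor $$M_K=\det(\alpha_h I+|R_K|)^{-\frac{1}{d+2}}\,\big\|\alpha_h I+|R_K|\big\|_2^{\frac{2}{d+2}}\,\big(\alpha_h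 I+|R_K|\big),\qquad K\in\mathcal{T}_h,$$ i.e. that satisfies, with constants $C_{eq},C_{ali}\ge1$ independent of $K$, $N$ and $\mathcal{T}_h$, $$|K|\det(M_K)^{\frac12}\le C_{eq}\frac1N\sum_{\tilde K\in\mathcal{T}_h}|\tilde K|\det(M_{\tilde K})^{\frac12},\qquad\frac1d\operatorname{tr}\big((F_K')^TM_KF_K'\big)\le C_{ali}\,|K|^{\frac2d}\det(M_K)^{\frac1d},\qquad\forall K\in\mathcal{T}_h,$$ the linear finite element error is bounded by $$|u-u_h|_{H^1(\Omega)}\le C\cdot C_{ali}^{\frac{d+1}{2}}\,C_{eq}^{\frac{d+2}{2d}}\cdot\frac{C_{R+}}{C_{R-}}\cdot N^{-\frac1d}\,\Big\|\det(\alpha_hI+|H|)^{\frac1d}\big(\alpha_hI+|H|\big)\Big\|_{L^{\frac{d}{d+2}}(\Omega)}^{\frac12},$$ where $C$ is a generic constant independent of $u$, $\mathcal{T}_h$, $N$, $R$, $\alpha_h$, $C_{ali}$, $C_{eq}$, $C_{R+}$ and $C_{R-}$.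
   Context: Setting: $\Omega\subset\mathbb{R}^d$ ($d\ge1$) is a polygonal or polyhedral domain, $\mathcal{L}$ is an elliptic second-order differential operator, $f$ and $g$ are given functions. $\mathcal{T}_h$ is a simplicial mesh of $\Omega$; $u_h$ is the conventional linear (continuous piecewise linear) finite element solution on $\mathcal{T}_h$. $\Pi_h$ is the nodal interpolation operator of the linear finite element space on $\mathcal{T}_h$. Standing assumption (Céa's lemma): $|u-u_h|_{H^1(\Omega)}\le C\,|u-\Pi_hu|_{H^1(\Omega)}$ for every mesh, with $C$ independent of $u$ and $\mathcal{T}_h$ (in particular, the nodal interpolant $\Pi_hu$ is presupposed to be defined). The constant in the theorem may depend on this constant, on $d$ and on the reference element. Notation: $\hat K$ is a fixed reference simplex with volume $1$; $F_K:\hat K\to K$ is the affine mapping onto the element $K$ and $F_K'$ its (constant) Jacobian matrix; $|K|$ is the volume of $K$. $\|\cdot\|_2$ is the spectral matrix norm, and $|\cdot|_{H^1(\Omega)}$ is the $H^1$ semi-norm. $H(\boldsymbol{x})$ is the Hessian matrix of $u$ at $\boldsymbol{x}$ (for $u\in H^2(\Omega)$ it is defined almost everywhere). For a symmetric matrix $A$, $|A|=\sqrt{A^2}$ is the positive semidefinite square root of $A^2$. A recovered Hessian $R$ is a symmetric-matrix-valued function on $\Omega$ (an approximation of $H$), and $R_K$ is an average of $R$ over $K$ (e.g. the average of the values of $R$ at the vertices of $K$). No convergence of $R$ to $H$ is assumed. Matrix inequalities: for a product $A^{-1}B$ with $A$ symmetric positive definite and $B$ symmetric, which is similar to the symmetric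 matrix $A^{-1/2}BA^{-1/2}$, the inequality $cI\le A^{-1}B$ (resp. $A^{-1}B\le cI$) means that all eigenvalues of $A^{-1}B$ are $\ge c$ (resp. $\le c$). For a matrix-valued function $A$ and $p=\frac{d}{d+2}$, $\|A\|_{L^p(\Omega)}=\big(\int_\Omega\|A(\boldsymbol{x})\|_2^p\,d\boldsymbol{x}\big)^{1/p}$ (a quasi-norm since $p<1$). *)

(* Defs.v *)
From HB Require Import structures.
From mathcomp Require Import all_boot all_order all_algebra.
From mathcomp Require Import all_classical all_reals all_analysis.
Set Implicit Arguments.
Unset Strict Implicit.
Unset Printing Implicit Defensive.
Import Order.TTheory GRing.Theory Num.Theory.
Import numFieldNormedType.Exports.
Local Open Scope classical_set_scope.
Local Open Scope ring_scope.

(* R^d is 'rV[R]_d with the product Borel sigma-algebra, as the library does for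
   n.-tuple. *)
Section rV_measurable.
Context {R : realType} {d : nat}.

Let coord (i : 'I_d) (x : 'rV[R]_d) : R := x ord0 i.

Definition measurable_rV : set (set 'rV[R]_d) := g_sigma_preimage coord.

Let rV_set0 : measurable_rV set0.
Proof. exact: sigma_algebra0. Qed.

Let rV_setC A : measurable_rV A -> measurable_rV (~` A).
Proof. exact: sigma_algebraC. Qed.

Let rV_bigcup (F : (set 'rV[R]_d)^nat) : (forall i, measurable_rV (F i)) ->
  measurable_rV (\bigcup_i (F i)).
Proof. exact: sigma_algebra_bigcup. Qed.

HB.instance Definition _ := @isMeasurable.Build default_measure_display
  'rV[R]_d measurable_rV rV_set0 rV_setC rV_bigcup.

End rV_measurable.

Lemma measurable_coord {R : realType} d (i : 'I_d) :
  measurable_fun [set: 'rV[R]_d] (fun x : 'rV[R]_d => x ord0 i).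
Proof.
move=> _ Y mY; rewrite setTI; apply: sub_sigma_algebra => /=.
rewrite -bigcup_seq/=; exists i => /=; first by rewrite mem_index_enum.
by exists Y => //; rewrite setTI.
Qed.

Lemma measurable_fun_rVP {R : realType} dT (T : measurableType dT) d
    (f : T -> 'rV[R]_d) :
  measurable_fun setT f <->
  forall i, measurable_fun setT (fun t => f t ord0 i).
Proof.
split=> [mf i|mf].
  exact: (measurableT_comp (measurable_coord i) mf).
suff : @measurable_rV R d `<=` [set A | measurable (f @^-1` A)].
  by move=> H _ A mA; rewrite setTI; exact: H.
apply: smallest_sub; first split => [|A mA|F mF] /=.
- by rewrite preimage_set0.
- by rewrite setTD preimage_setC; exact: measurableC.
- by rewrite preimage_bigcup; exact: bigcupT_measurable.
- rewrite -bigcup_seq => A [i _ [B mB <-]]; rewrite setTI /=.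
  by have := mf i measurableT B mB; rewrite setTI.
Qed.

Section lebesgue_rV.
Context {R : realType}.
Implicit Types n : nat.

Definition cons_rV n (p : R * 'rV[R]_n) : 'rV[R]_n.+1 :=
  row_mx (p.1)%:M p.2.

Definition uncons_rV n (x : 'rV[R]_n.+1) : R * 'rV[R]_n :=
  (x ord0 ord0, \row_i x ord0 (lift ord0 i)).

Lemma uncons_rVK n : cancel (@uncons_rV n) (@cons_rV n).
Proof.
move=> x; apply/rowP => i; rewrite /cons_rV.
case: (@splitP 1 n i) => [j ij|k ik].
  have -> : i = @lshift 1 n j by apply/val_inj.
  rewrite (@row_mxEl _ 1 1 n) !mxE !ord1 eqxx mulr1n.
  by congr (x _ _); apply/val_inj.
have -> : i = @rshift 1 n k by apply/val_inj.
by rewrite (@row_mxEr _ 1 1 n) !mxE; congr (x _ _); apply/val_inj.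
Qed.

Lemma cons_rVK n : cancel (@cons_rV n) (@uncons_rV n).
Proof.
case=> r x; rewrite /uncons_rV /cons_rV; congr (_, _).
  have -> : ord0 = @lshift 1 n ord0 by apply/val_inj.
  by rewrite (@row_mxEl _ 1 1 n) !mxE eqxx mulr1n.
apply/rowP => k; rewrite mxE.
have -> : lift ord0 k = @rshift 1 n k by apply/val_inj.
by rewrite (@row_mxEr _ 1 1 n).
Qed.

Lemma measurable_cons_rV n : measurable_fun setT (@cons_rV n).
Proof.
apply/measurable_fun_rVP => i; rewrite /cons_rV.
case: (@splitP 1 n i) => [j ij|k ik].
  have -> : i = @lshift 1 n j by apply/val_inj.
  apply: (eq_measurable_fun fst); last exact: measurable_fst.
  by move=> p _; rewrite (@row_mxEl _ 1 1 n) !mxE !ord1 eqxx mulr1n.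
have -> : i = @rshift 1 n k by apply/val_inj.
apply: (eq_measurable_fun (fun p : R * 'rV[R]_n => p.2 ord0 k)).
  by move=> p _; rewrite (@row_mxEr _ 1 1 n).
exact: (measurableT_comp (measurable_coord k) measurable_snd).
Qed.

Lemma cons_rV0 n p : @cons_rV n p ord0 ord0 = p.1.
Proof. by have := congr1 fst (cons_rVK p). Qed.

Lemma cons_rVS n p i : @cons_rV n p ord0 (lift ord0 i) = p.2 ord0 i.
Proof. by have := congr1 snd (cons_rVK p) => /rowP/(_ i); rewrite mxE. Qed.

Lemma measurable_uncons_rV n : measurable_fun setT (@uncons_rV n).
Proof.
apply: measurable_fun_pair; first exact: measurable_coord.
apply/measurable_fun_rVP => i.
apply: (eq_measurable_fun (fun x : 'rV[R]_n.+1 => x ord0 (lift ord0 i))).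
  by move=> x _; rewrite mxE.
exact: measurable_coord.
Qed.

Section step.
Context n (m : {sigma_finite_measure set 'rV[R]_n -> \bar R}).

Definition cons_measure : set 'rV[R]_n.+1 -> \bar R :=
  pushforward (@lebesgue_measure R \x m)%E (@cons_rV n).

Let cons_measure0 : cons_measure set0 = 0%E.
Proof. by rewrite /cons_measure /pushforward preimage_set0 measure0. Qed.

Let cons_measure_ge0 A : (0 <= cons_measure A)%E.
Proof. by rewrite /cons_measure /pushforward; exact: measure_ge0. Qed.

Let cons_measure_sigma_additive : semi_sigma_additive cons_measure.
Proof.
move=> F mF tF mUF; rewrite /cons_measure /pushforward preimage_bigcup.
apply: measure_semi_sigma_additive.
- by move=> k; rewrite -[X in measurable X]setTI; exact: measurable_cons_rV.
- apply/trivIsetP => /= i j _ _ ij; rewrite -preimage_setI.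
  by move/trivIsetP : tF => /(_ _ _ _ _ ij) ->//; rewrite preimage_set0.
- rewrite -preimage_bigcup -[X in measurable X]setTI.
  exact: measurable_cons_rV.
Qed.

HB.instance Definition _ := isMeasure.Build _ _ _ cons_measure
  cons_measure0 cons_measure_ge0 cons_measure_sigma_additive.

Let cons_measure_sigma_finite : sigma_finite setT cons_measure.
Proof.
have /sigma_finiteP[F [TF ndF Foo]] := sigma_finiteT (@lebesgue_measure R).
have /sigma_finiteP[G [TG ndG Goo]] := sigma_finiteT m.
exists (fun k => @uncons_rV n @^-1` (F k `*` G k)).
  rewrite -preimage_bigcup [X in _ @^-1` X](_ : _ = setT) ?preimage_setT//.
  apply/seteqP; split=> // -[r x] _.
  have [i _ Fir] : (\bigcup_i F i) r by rewrite -TF.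
  have [j _ Gjx] : (\bigcup_i G i) x by rewrite -TG.
  exists (maxn i j) => //; split => /=.
    by move: Fir; exact/subsetPset/ndF/leq_maxl.
  by move: Gjx; exact/subsetPset/ndG/leq_maxr.
move=> k; have [mF Fk] := Foo k; have [mG Gk] := Goo k; split.
  rewrite -[X in measurable X]setTI.
  by apply: measurable_uncons_rV => //; exact: measurableX.
rewrite /cons_measure /pushforward.
rewrite [X in (_ \x _)%E X](_ : _ = F k `*` G k).
  by rewrite product_measure1E// lte_mul_pinfty// ge0_fin_numE.
by rewrite -comp_preimage (_ : _ \o _ = id) //; apply/funext => p; exact: cons_rVK.
Qed.

HB.instance Definition _ := @Measure_isSigmaFinite.Build _ _ _ cons_measure
  cons_measure_sigma_finite.

End step.

(* d-dimensional Lebesgue measure, as an iterated product; lebesgue_rV_box below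
   gives its (characterizing) values on boxes. *)
Fixpoint lebesgue_rV n : {sigma_finite_measure set 'rV[R]_n -> \bar R} :=
  match n with
  | 0 => dirac (0 : 'rV[R]_0)
  | n'.+1 => cons_measure (lebesgue_rV n')
  end.

Lemma measurable_box n (a b : 'rV[R]_n) :
  measurable [set x : 'rV[R]_n | forall i, a ord0 i <= x ord0 i <= b ord0 i].
Proof.
have -> : [set x : 'rV[R]_n | forall i, a ord0 i <= x ord0 i <= b ord0 i] =
    \bigcap_(i in [set: 'I_n])
      (fun x : 'rV[R]_n => x ord0 i) @^-1` `[a ord0 i, b ord0 i].
  by apply/seteqP; split=> x H i => [_|]; have := H i; rewrite /= in_itv/=; last exact.
apply: fin_bigcap_measurable => // i _.
by rewrite -[X in measurable X]setTI; exact: measurable_coord.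
Qed.

Lemma lebesgue_rV_box n (a b : 'rV[R]_n) :
  (forall i, a ord0 i <= b ord0 i) ->
  lebesgue_rV n [set x | forall i, a ord0 i <= x ord0 i <= b ord0 i]
  = (\prod_i (b ord0 i - a ord0 i))%:E.
Proof.
elim: n a b => [|n IHn] a b ab.
  by rewrite big_ord0 /= diracE mem_set//= => -[].
rewrite big_ord_recl EFinM.
pose a' : 'rV[R]_n := (uncons_rV a).2; pose b' : 'rV[R]_n := (uncons_rV b).2.
rewrite (eq_bigr (fun i => b' ord0 i - a' ord0 i)) => [|i _]; last by rewrite !mxE.
rewrite -IHn => [|i]; last by rewrite !mxE.
have -> : (b ord0 ord0 - a ord0 ord0)%:E =
    @lebesgue_measure R `[a ord0 ord0, b ord0 ord0].
  by rewrite lebesgue_measure_itv /= lte_fin; case: ltgtP (ab ord0) => // ->;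
    rewrite subrr.
rewrite -product_measure1E//; last exact: measurable_box.
rewrite /= /cons_measure /pushforward; congr (_ _).
apply/seteqP; split=> p /=; rewrite in_itv/=.
  move=> H; split; first by have := H ord0; rewrite cons_rV0.
  by move=> i; have := H (lift ord0 i); rewrite cons_rVS !mxE.
move=> [H0 HS] i; have [j ->|->] := unliftP ord0 i; last by rewrite cons_rV0.
by have := HS j; rewrite cons_rVS !mxE.
Qed.

End lebesgue_rV.

Section linear_algebra.
Context {R : realType}.
Implicit Types d : nat.

Definition enorm d (x : 'cV[R]_d) : R := Num.sqrt (\sum_i x i ord0 ^+ 2).

(* the matrix norm induced by the Euclidean norm *)
Definition spectral_norm d (A : 'M[R]_d) : R :=
  sup [set enorm (A *m x) | x in [set x | enorm x <= 1]].

Definition psdmx d (A : 'M[R]_d) : Prop :=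
  A^T = A /\ forall x : 'cV[R]_d, 0 <= (x^T *m A *m x) ord0 ord0.

(* |A| = sqrt(A^2), for symmetric A *)
Definition absmx d (A : 'M[R]_d) : 'M[R]_d :=
  xget 0 [set B | psdmx B /\ B *m B = A *m A].

(* c I <= X and X <= c I, for X similar to a symmetric matrix *)
Definition eig_ge d (c : R) (X : 'M[R]_d) : Prop :=
  forall a, eigenvalue X a -> c <= a.

Definition eig_le d (c : R) (X : 'M[R]_d) : Prop :=
  forall a, eigenvalue X a -> a <= c.

End linear_algebra.

Section sobolev.
Context {R : realType} {d : nat}.
Implicit Types (Omega : set 'rV[R]_d) (f v w phi : 'rV[R]_d -> R) (i : 'I_d).

Definition partial i f : 'rV[R]_d -> R := fun x => 'D_(delta_mx ord0 i) f x.

Definition smooth f : Prop := forall s : seq 'I_d,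
  continuous (foldr partial f s) /\
  forall x i, derivable (foldr partial f s) x (delta_mx ord0 i).

Definition test_function Omega phi : Prop := smooth phi /\
  exists2 K : set 'rV[R]_d, compact K /\ K `<=` Omega &
    forall x, ~ K x -> phi x = 0.

Definition inL2 Omega f : Prop := measurable_fun Omega f /\
  (\int[lebesgue_rV d]_(x in Omega) (f x ^+ 2)%:E < +oo)%E.

Definition is_weak_partial Omega i v w : Prop := inL2 Omega w /\
  forall phi, test_function Omega phi ->
    \int[lebesgue_rV d]_(x in Omega) (v x * partial i phi x) =
    - \int[lebesgue_rV d]_(x in Omega) (w x * phi x).

Fixpoint sobolev k Omega v : Prop :=
  inL2 Omega v /\
  if k is k'.+1 then
    forall i, exists2 w, is_weak_partial Omega i v w & sobolev k' Omega w
  else True.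

(* the weak partial derivative, unique up to a null set; 0 if there is none *)
Definition weak_partial Omega i v : 'rV[R]_d -> R :=
  xget (cst 0) (is_weak_partial Omega i v).

Definition weak_grad Omega v (x : 'rV[R]_d) : 'cV[R]_d :=
  \col_i weak_partial Omega i v x.

Definition weak_hessian Omega v (x : 'rV[R]_d) : 'M[R]_d :=
  \matrix_(i, j) weak_partial Omega i (weak_partial Omega j v) x.

(* the Lp (quasi-)norm on Omega, for any real p > 0 *)
Definition Lp_norm Omega (p : R) f : \bar R :=
  'N[lebesgue_rV d]_(p%:E)[(EFin \o f) \_ Omega].

Definition H1_seminorm Omega v : \bar R :=
  Lp_norm Omega 2 (fun x => enorm (weak_grad Omega v x)).

End sobolev.

Section meshes.
Context {R : realType} {d : nat}.
Implicit Types (Omega : set 'rV[R]_d) (u v : 'rV[R]_d -> R).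

Definition conv_hull (A : set 'rV[R]_d) : set 'rV[R]_d :=
  [set x | exists n (c : 'I_n -> R) (p : 'I_n -> 'rV[R]_d),
    [/\ forall k, 0 <= c k /\ A (p k), \sum_k c k = 1 &
        x = \sum_k c k *: p k]].

(* a simplex is given by its d.+1 vertices *)
Definition simplex (v : 'I_d.+1 -> 'rV[R]_d) : set 'rV[R]_d :=
  conv_hull (range v).

(* the columns are the edge vectors from vertex 0 *)
Definition edge_mx (v : 'I_d.+1 -> 'rV[R]_d) : 'M[R]_d :=
  \matrix_(i, j) (v (lift ord0 j) - v ord0) ord0 i.

Definition nondeg_simplex (v : 'I_d.+1 -> 'rV[R]_d) : Prop :=
  edge_mx v \in unitmx.

(* the linear part of the affine map taking vertex i of vhat to vertex i of v *)
Definition jacobian_mx (vhat v : 'I_d.+1 -> 'rV[R]_d) : 'M[R]_d :=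
  edge_mx v *m invmx (edge_mx vhat).

Definition polyhedral_domain Omega : Prop :=
  [/\ open Omega, connected Omega, Omega !=set0,
      interior (closure Omega) = Omega &
      exists n (v : 'I_n -> 'I_d.+1 -> 'rV[R]_d),
        (forall k, nondeg_simplex (v k)) /\
        closure Omega = \bigcup_k simplex (v k)].

Definition boundary Omega : set 'rV[R]_d := closure Omega `\` Omega.

Record mesh := Mesh {
  nelt : nat;
  vtx : 'I_nelt -> 'I_d.+1 -> 'rV[R]_d }.

Definition elem (T : mesh) (K : 'I_(nelt T)) : set 'rV[R]_d :=
  simplex (vtx K).

Definition vol (T : mesh) (K : 'I_(nelt T)) : R :=
  fine (lebesgue_rV d (elem K)).

(* the last condition is conformity: two elements meet in a common face *)
Definition mesh_of Omega (T : mesh) : Prop :=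
  [/\ forall K : 'I_(nelt T), nondeg_simplex (vtx K),
      \bigcup_(K : 'I_(nelt T)) elem K = closure Omega,
      forall K L : 'I_(nelt T), range (vtx K) = range (vtx L) -> K = L &
      forall K L : 'I_(nelt T),
        elem K `&` elem L = conv_hull (range (vtx K) `&` range (vtx L))].

(* continuous piecewise linear functions *)
Definition P1_space Omega (T : mesh) v : Prop :=
  {within closure Omega, continuous v} /\
  forall K : 'I_(nelt T), exists (a : 'cV[R]_d) (b : R),
    forall x, elem K x -> v x = (x *m a) ord0 ord0 + b.

Definition nodal_interp Omega (T : mesh) u : 'rV[R]_d -> R :=
  xget (cst 0) [set v | P1_space Omega T v /\
    forall (K : 'I_(nelt T)) i, v (vtx K i) = u (vtx K i)].

(* averages of F over K: discrete ones (such as vertex averages) and the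
   integral mean are instances *)
Definition is_average (K : set 'rV[R]_d) (F : 'rV[R]_d -> 'M[R]_d)
    (A : 'M[R]_d) : Prop :=
  exists P : probability 'rV[R]_d R, P K = 1%E /\
    forall i j, P.-integrable K (fun x => (F x i j)%:E) /\
      A i j = \int[P]_(x in K) F x i j.

End meshes.
Arguments mesh : clear implicits.

Section boundary_value_problem.
Context {R : realType} {d : nat}.
Implicit Types (Omega : set 'rV[R]_d) (f g u v w : 'rV[R]_d -> R).

(* L u = - div (A grad u) + b . grad u + c u *)
Record operator := Operator {
  diffusion : 'rV[R]_d -> 'M[R]_d;
  convection : 'rV[R]_d -> 'cV[R]_d;
  reaction : 'rV[R]_d -> R }.

Implicit Types L : operator.

Definition bounded_coeff Omega (a : 'rV[R]_d -> R) : Prop :=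
  measurable_fun Omega a /\ exists B, forall x, Omega x -> `|a x| <= B.

Definition elliptic Omega L : Prop :=
  [/\ forall i j, bounded_coeff Omega (fun x => diffusion L x i j),
      forall i, bounded_coeff Omega (fun x => convection L x i ord0),
      bounded_coeff Omega (reaction L) &
      exists2 lambda, 0 < lambda & forall x, Omega x -> forall xi : 'cV[R]_d,
        lambda * enorm xi ^+ 2 <= (xi^T *m diffusion L x *m xi) ord0 ord0].

Definition bilinear_form Omega L w v : R :=
  \int[lebesgue_rV d]_(x in Omega)
    (((weak_grad Omega v x)^T *m diffusion L x *m weak_grad Omega w x) ord0 ord0
     + ((convection L x)^T *m weak_grad Omega w x) ord0 ord0 * v x
     + reaction L x * w x * v x).

Definition load Omega f v : R :=
  \int[lebesgue_rV d]_(x in Omega) (f x * v x).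

(* weak solution of L u = f in Omega, continuous up to the boundary, where u = g
   holds pointwise *)
Definition is_solution Omega L f g u : Prop :=
  [/\ sobolev 1 Omega u, {within closure Omega, continuous u},
      forall phi, test_function Omega phi ->
        bilinear_form Omega L u phi = load Omega f phi &
      forall x, boundary Omega x -> u x = g x].

(* linear finite elements, with the boundary data interpolated at the boundary
   vertices *)
Definition is_fem_solution Omega L f g (T : mesh R d) uh : Prop :=
  [/\ P1_space Omega T uh,
      forall (K : 'I_(nelt T)) i, boundary Omega (vtx K i) ->
        uh (vtx K i) = g (vtx K i) &
      forall v, P1_space Omega T v -> (forall x, boundary Omega x -> v x = 0) ->
        bilinear_form Omega L uh v = load Omega f v].

Definition cea_estimate Omega L (I : Type) (Th : I -> mesh R d) (Cc : R) : Prop :=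
  forall f g u, inL2 Omega f -> is_solution Omega L f g u ->
  forall h uh, is_fem_solution Omega L f g (Th h) uh ->
    (H1_seminorm Omega (u \- uh)%R <=
     Cc%:E * H1_seminorm Omega (u \- nodal_interp Omega (Th h) u)%R)%E.

End boundary_value_problem.
Arguments operator : clear implicits.

Section metric.
Context {R : realType} {d : nat}.

(* alpha I + |A| *)
Definition reg_abs (alpha : R) (A : 'M[R]_d) : 'M[R]_d := alpha%:M + absmx A.

Definition metric_tensor (alpha : R) (A : 'M[R]_d) : 'M[R]_d :=
  let B := reg_abs alpha A in
  (\det B `^ (- (d.+2%:R)^-1) * spectral_norm B `^ (2 / d.+2%:R)) *: B.

Definition quasi_M_uniform (vhat : 'I_d.+1 -> 'rV[R]_d) (T : mesh R d)
    (M : 'I_(nelt T) -> 'M[R]_d) (Ceq Cali : R) : Prop :=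
  forall K : 'I_(nelt T),
    vol K * \det (M K) `^ 2^-1 <=
      Ceq * ((nelt T)%:R^-1 * \sum_L vol L * \det (M L) `^ 2^-1) /\
    d%:R^-1 * \tr ((jacobian_mx vhat (vtx K))^T *m M K
                   *m jacobian_mx vhat (vtx K)) <=
      Cali * vol K `^ (2 / d%:R) * \det (M K) `^ d%:R^-1.

End metric.

(* Main.v *)
(** The upper bound on (alpha I + |R_K|)^-1 |H| makes H essentially bounded on each
    element, by c_K B with B = alpha I + |R_K| and c_K = C_(R+,K); the error of the
    nodal interpolant can then be estimated uniformly on K.  Mollifying u shows that
    along a segment [x, x + v] of K the function u differs from its chord by at most
    c_K v^T B v / 2 * t (1 - t).  Hence e = u - Pi_h u, which vanishes at the vertices,
    has difference quotients bounded by C c_K tr(S) along the edges of K, where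
    S = E^T B E and E is the matrix of edge vectors; the quotients converge along
    halvings, to the weak derivatives of e.  Inverting E^T gives
    |grad e|^2 <= C ||B|| tr(S)^(d-1) / det(S) * (c_K tr(S))^2 almost everywhere on K.
    Alignment bounds tr(S) by C C_ali |K|^(2/d) det(B)^(1/d), so that the squared error
    on K is at most C C_ali^(d+1) c_K^2 rho_K^((d+2)/d), where
    rho_K = |K| det(M_K)^(1/2) = |K| det(B)^(1/(d+2)) ||B||^(d/(d+2)).
    Equidistribution bounds rho_K by C_eq / N times the sum of all the rho_L, and the
    lower bound C_(R-) bounds this sum by the integral of the p-th power, p = d/(d+2),
    of the norm of det(alpha I + |H|)^(1/d) (alpha I + |H|). *)

Require Import Defs.
From mathcomp Require Import all_boot all_order all_algebra.
From mathcomp Require Import all_classical all_reals all_analysis.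
From mathcomp Require Import measurable_realfun complex ring lra.
Set Implicit Arguments.
Unset Strict Implicit.
Unset Printing Implicit Defensive.
Import Order.TTheory GRing.Theory Num.Theory.
Import numFieldNormedType.Exports.
Local Open Scope classical_set_scope.
Local Open Scope ring_scope.

(** * Symmetric matrices *)

(** The second difference of u along a chord is the working quantity because it is scalar, unchanged
    when an affine function is subtracted, and bounded by the form B with no map to the reference
    element. The geometry of K enters only when slopes along edges are turned into a gradient: this
    costs the inverse of one eigenvalue of S, hence the factor tr(S)^(d-1) / det(S). With the square
    of the slope it makes tr(S)^(d+1), which explains the power of C_ali, and the inequality |K| <=
    C |det E| removes det(S).

    The obstacle is regularity. u is merely continuous with weak derivatives, and the derivatives
    inside [weak_grad] and [weak_hessian] are arbitrary choices, 0 where none exists. So weak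
    derivatives are compared on one open simplex at a time, almost everywhere, the faces being null.
    The tests are products of one-variable bumps: this class is stable under partial derivatives and
    translations, lies among the test functions of the definition, and is still rich enough to
    detect that an integrable function vanishes. *)

Section spectral.
Context {R : realType}.

Lemma row_dot_gt0 n (v : 'rV[R]_n) : v != 0 -> 0 < (v *m v^T) ord0 ord0.
Proof.
move=> v0; rewrite mxE lt_neqAle eq_sym sumr_ge0 ?andbT => [|i _]; last first.
  by rewrite mxE -expr2 sqr_ge0.
apply: contra v0; rewrite psumr_eq0 => [/allP vi|i _]; last first.
  by rewrite mxE -expr2 sqr_ge0.
apply/eqP/rowP => i; rewrite mxE; apply/eqP.
by have := vi i (mem_index_enum i); rewrite mxE mulf_eq0 orbb.
Qed.

(* An eigenvector x + iy over R[i] for p + iq satisfies q (|x|^2 + |y|^2) = 0 by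
   symmetry, so x or y is a real eigenvector. *)
Lemma symmetric_real_eigenvector n (A : 'M[R]_n.+1) : A^T = A ->
  exists (a : R) (v : 'rV[R]_n.+1), v != 0 /\ v *m A = a *: v.
Proof.
move=> symA.
pose f : R -> complex R := real_complex R.
have [z /eigenvalueP[v vA v0]] := @eigenvalue_closed (complex R) _ (map_mx f A) isT.
pose x := map_mx (@complex.Re R) v; pose y := map_mx (@complex.Im R) v.
have ReM i : complex.Re ((v *m map_mx f A) ord0 i) = (x *m A) ord0 i.
  rewrite !mxE raddf_sum; apply: eq_bigr => j _; rewrite !mxE /=.
  by case: (v ord0 j) => p q /=; rewrite mulr0 subr0.
have ImM i : complex.Im ((v *m map_mx f A) ord0 i) = (y *m A) ord0 i.
  rewrite !mxE raddf_sum; apply: eq_bigr => j _; rewrite !mxE /=.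
  by case: (v ord0 j) => p q /=; rewrite mulr0 add0r.
have ReZ (w : complex R) : complex.Re (z * w) =
  complex.Re z * complex.Re w - complex.Im z * complex.Im w by case: (z); case: w.
have ImZ (w : complex R) : complex.Im (z * w) =
  complex.Re z * complex.Im w + complex.Im z * complex.Re w.
  by case: (z); case: w.
have xA : x *m A = complex.Re z *: x - complex.Im z *: y.
  by apply/rowP => i; rewrite -ReM vA !mxE ReZ.
have yA : y *m A = complex.Re z *: y + complex.Im z *: x.
  by apply/rowP => i; rewrite -ImM vA !mxE ImZ.
have xy : x != 0 \/ y != 0.
  apply/orP; rewrite -negb_and; apply: contra v0 => /andP[/eqP x0 /eqP y0].
  apply/eqP/rowP => i; have := congr1 (fun M : 'rV_ _ => M ord0 i) x0.
  have := congr1 (fun M : 'rV_ _ => M ord0 i) y0; rewrite !mxE.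
  by case: (v ord0 i) => p q /= -> ->.
have S : x *m A *m y^T = (y *m A *m x^T)^T.
  by rewrite !trmx_mul trmxK symA mulmxA.
have sc (u w : 'rV[R]_n.+1) : (u *m w^T) ord0 ord0 = (w *m u^T) ord0 ord0.
  by rewrite -[u *m _]trmxK mxE trmx_mul trmxK.
have nn (u : 'rV[R]_n.+1) : 0 <= (u *m u^T) ord0 ord0.
  by rewrite mxE sumr_ge0// => i _; rewrite mxE -expr2 sqr_ge0.
have Im0 : complex.Im z = 0.
  have lin p q (u w t : 'rV[R]_n.+1) : ((p *: u + q *: w) *m t^T) ord0 ord0 =
      p * (u *m t^T) ord0 ord0 + q * (w *m t^T) ord0 ord0.
    by rewrite mulmxDl -!scalemxAl mxE [in LHS]mxE [X in _ + X]mxE.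
  have E : ((x *m A) *m y^T) ord0 ord0 = ((y *m A) *m x^T) ord0 ord0.
    by rewrite S mxE.
  have E1 : complex.Im z * ((x *m x^T) ord0 ord0 + (y *m y^T) ord0 ord0) = 0.
    by move: E; rewrite xA yA -scaleNr !lin (sc y x); lra.
  have P : 0 < (x *m x^T) ord0 ord0 + (y *m y^T) ord0 ord0.
    by case: xy => [/row_dot_gt0 h|/row_dot_gt0 h]; rewrite ?(ltr_wpDr (nn _) h)// ltr_wpDl.
  by move/eqP: E1; rewrite mulf_eq0 (gt_eqF P) orbF => /eqP.
case: xy => h; [exists (complex.Re z), x|exists (complex.Re z), y]; split => //.
  by rewrite xA Im0 scale0r subr0.
by rewrite yA Im0 scale0r addr0.
Qed.

(** The reflection in the hyperplane orthogonal to w = v - e exchanges the unit vectors e and v.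
    Being symmetric and its own inverse, it serves as the change of basis that splits off an
    eigenvector. *)
Lemma householder n (v : 'rV[R]_n.+1) : (v *m v^T) ord0 ord0 = 1 ->
  exists H : 'M[R]_n.+1, [/\ H^T = H, H *m H = 1%:M & row ord0 H = v].
Proof.
move=> v1; pose e : 'rV[R]_n.+1 := delta_mx ord0 ord0.
have e1 : (e *m e^T) ord0 ord0 = 1.
  by rewrite trmx_delta mul_delta_mx !mxE !eqxx.
have [->|ve] := eqVneq v e.
  exists 1%:M; rewrite trmx1 mulmx1 row1; split => //.
have [w wE] : exists w, w = v - e by exists (v - e).
have [s sE] : exists s, s = (w *m w^T) ord0 ord0 by eexists.
have s0 : s != 0 by rewrite sE wE gt_eqF// row_dot_gt0// subr_eq0.
have ww : w *m w^T = s%:M by rewrite [LHS]mx11_scalar sE.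
exists (1%:M - (2 / s) *: (w^T *m w)); split.
- by rewrite linearB /= trmx1 linearZ /= trmx_mul trmxK.
- rewrite mulmxBl mul1mx mulmxBr mulmx1 -!scalemxAl -!scalemxAr mulmxA -(mulmxA w^T) ww.
  rewrite mul_mx_scalar -scalemxAl !scalerA.
  have -> : 2 / s * (2 / s * s) = 2 / s + 2 / s by field.
  by rewrite scalerDl opprB addrK subrK.
rewrite rowE mulmxBr mulmx1 -scalemxAr mulmxA -/e.
(* As v and e are unit vectors, s = |v - e|^2 = 2 - 2 e.v, so e.w = e.v - 1 = - s / 2. *)
have -> : e *m w^T = (- (s / 2))%:M.
  rewrite [LHS]mx11_scalar; congr (_%:M).
  have lin (u t r : 'rV[R]_n.+1) : (u *m (t - r)^T) ord0 ord0 =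
      (u *m t^T) ord0 ord0 - (u *m r^T) ord0 ord0.
    by rewrite linearB mulmxBr mxE [X in _ + X]mxE.
  have C (u t : 'rV[R]_n.+1) : (u *m t^T) ord0 ord0 = (t *m u^T) ord0 ord0.
    by rewrite -[u *m _]trmxK mxE trmx_mul trmxK.
  have -> : s = 2 - 2 * (e *m v^T) ord0 ord0.
    by rewrite sE wE lin (C _ v) (C _ e) !lin v1 e1 (C v e); ring.
  by rewrite wE lin e1; lra.
rewrite mul_scalar_mx scalerA.
have -> : 2 / s * - (s / 2) = -1 by field.
by rewrite scaleN1r opprK wE addrC subrK.
Qed.

(** Deflation: if the first row of the reflection H is a unit eigenvector of A, the first row of H A
    H is a multiple of e, and by symmetry so is the first column. The induction hypothesis
    diagonalizes the remaining block. *)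
Lemma real_spectral n (A : 'M[R]_n) : A^T = A ->
  exists (P : 'M[R]_n) (D : 'rV[R]_n),
    [/\ P *m P^T = 1%:M, P^T *m P = 1%:M & A = P^T *m diag_mx D *m P].
Proof.
elim: n A => [|n IHn] A symA.
  by exists 1%:M, 0; split; apply/matrixP => -[].
have [a [v0 [v0n v0A]]] := symmetric_real_eigenvector symA.
pose k := (v0 *m v0^T) ord0 ord0; have k0 : 0 < k by exact: row_dot_gt0.
pose v := (Num.sqrt k)^-1 *: v0.
have v1 : (v *m v^T) ord0 ord0 = 1.
  rewrite linearZ /= -scalemxAl -scalemxAr scalerA mxE -/k -invfM -expr2.
  by rewrite sqr_sqrtr ?ltW// mulVf// gt_eqF.
have vA : v *m A = a *: v by rewrite -scalemxAl v0A scalerA mulrC -scalerA.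
have [H [Ht HH rH]] := householder v1.
have [B BH] : exists B : 'M[R]_(1 + n), B = H *m A *m H by eexists.
have symB : B^T = B by rewrite BH !trmx_mul Ht symA mulmxA.
have rB : row ord0 B = a *: delta_mx ord0 ord0.
  rewrite BH !row_mul rH vA -scalemxAl; congr (_ *: _).
  by rewrite -rH rowE -mulmxA HH mulmx1.
have B00 : ulsubmx B = a%:M.
  rewrite [LHS]mx11_scalar; congr (_%:M).
  by have /rowP/(_ ord0) := rB; rewrite !mxE !eqxx mulr1 => <-; congr (B _ _); exact/val_inj.
have B0r : ursubmx B = 0.
  apply/rowP => j; rewrite mxE [LHS]mxE mxE.
  have /rowP/(_ (rshift 1 j)) := rB; rewrite !mxE eqxx /= mulr0 => <-.
  by congr (B _ _); exact/val_inj.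
have Br0 : dlsubmx B = 0.
  by rewrite -symB -trmx_ursub B0r trmx0.
have [P [D [PP PP' BE]]] := IHn (drsubmx B) (etrans (trmx_drsub B) (congr1 drsubmx symB)).
pose Q : 'M[R]_(1 + n) := block_mx 1%:M 0 0 P.
have QT : Q^T = block_mx 1%:M 0 0 P^T by rewrite tr_block_mx trmx1 !trmx0.
have QQ : Q *m Q^T = 1%:M.
  rewrite QT mulmx_block !mulmx0 !mul0mx mulmx1 !addr0 add0r PP.
  by rewrite -scalar_mx_block.
have QQ' : Q^T *m Q = 1%:M by apply: mulmx1C.
exists (Q *m H), (row_mx a%:M D); split.
- by rewrite trmx_mul Ht mulmxA -(mulmxA Q) HH mulmx1 QQ.
- by rewrite trmx_mul Ht mulmxA -(mulmxA H) QQ' mulmx1 HH.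
have BQ : B = Q^T *m diag_mx (row_mx a%:M D) *m Q.
  rewrite -[LHS]submxK B00 B0r Br0 diag_mx_row QT !mulmx_block.
  rewrite !mulmx0 !mul0mx !mulmx1 !mul1mx !addr0 !add0r -BE !mul0mx.
  by congr (block_mx _ _ _ _); apply/matrixP => i j; rewrite !mxE !ord1 !eqxx.
rewrite trmx_mul Ht !mulmxA -(mulmxA H Q^T) -(mulmxA H _ Q) -BQ.
by rewrite BH !mulmxA HH mul1mx -mulmxA HH mulmx1.
Qed.

End spectral.

Section quadratic_forms.
Context {R : realType}.

Definition qf n (A : 'M[R]_n) (x : 'cV[R]_n) : R := (x^T *m A *m x) ord0 ord0.

Definition spectral_dec n (A P : 'M[R]_n) (D : 'rV[R]_n) : Prop :=
  [/\ P *m P^T = 1%:M, P^T *m P = 1%:M & A = P^T *m diag_mx D *m P].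

Definition sqn n (x : 'cV[R]_n) : R := \sum_i x i ord0 ^+ 2.

Lemma sqn_ge0 n (x : 'cV[R]_n) : 0 <= sqn x.
Proof. by rewrite sumr_ge0// => i _; exact: sqr_ge0. Qed.

Lemma enorm_sqr n (x : 'cV[R]_n) : enorm x ^+ 2 = sqn x.
Proof. by rewrite sqr_sqrtr ?sqn_ge0. Qed.

Lemma sqnE n (x : 'cV[R]_n) : sqn x = (x^T *m x) ord0 ord0.
Proof. by rewrite mxE; apply: eq_bigr => i _; rewrite mxE -expr2. Qed.

Lemma sqn_eq0 n (x : 'cV[R]_n) : sqn x = 0 -> x = 0.
Proof.
move/eqP; rewrite psumr_eq0 => [/allP xi|i _]; last exact: sqr_ge0.
apply/colP => i; rewrite mxE; apply/eqP.
by have := xi i (mem_index_enum i); rewrite sqrf_eq0.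
Qed.

Lemma sqn_gt0 n (x : 'cV[R]_n) : x != 0 -> 0 < sqn x.
Proof.
by move=> /eqP x0; rewrite lt_neqAle sqn_ge0 andbT eq_sym; apply/eqP => /sqn_eq0.
Qed.

Lemma sqnZ n a (x : 'cV[R]_n) : sqn (a *: x) = a ^+ 2 * sqn x.
Proof. by rewrite mulr_sumr; apply: eq_bigr => i _; rewrite mxE exprMn. Qed.

Lemma qf_conj m n (A : 'M[R]_m) (P : 'M[R]_(m, n)) x :
  qf (P^T *m A *m P) x = qf A (P *m x).
Proof. by rewrite /qf trmx_mul !mulmxA. Qed.

Lemma qf_diag n (D : 'rV[R]_n) x :
  qf (diag_mx D) x = \sum_i D ord0 i * x i ord0 ^+ 2.
Proof.
rewrite /qf mxE; apply: eq_bigr => i _.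
by rewrite mul_mx_diag !mxE; ring.
Qed.

Lemma qfD n (A B : 'M[R]_n) x : qf (A + B) x = qf A x + qf B x.
Proof. by rewrite /qf mulmxDr mulmxDl mxE. Qed.

Lemma qfZ n a (A : 'M[R]_n) x : qf (a *: A) x = a * qf A x.
Proof. by rewrite /qf -scalemxAr -scalemxAl mxE. Qed.

Lemma qfN n (A : 'M[R]_n) x : qf (- A) x = - qf A x.
Proof. by rewrite -scaleN1r qfZ mulN1r. Qed.

Lemma qf_scalar n a (x : 'cV[R]_n) : qf a%:M x = a * sqn x.
Proof. by rewrite /qf mul_mx_scalar -scalemxAl mxE sqnE. Qed.

Lemma qf_scale n (A : 'M[R]_n) a x : qf A (a *: x) = a ^+ 2 * qf A x.
Proof.
by rewrite /qf [(a *: x)^T]linearZ /= -scalemxAl -scalemxAl -scalemxAr scalerA mxE expr2.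
Qed.

Lemma sqn_orth n (P : 'M[R]_n) (x : 'cV[R]_n) : P^T *m P = 1%:M ->
  sqn (P *m x) = sqn x.
Proof.
by move=> PP; rewrite !sqnE trmx_mul mulmxA -(mulmxA _ _ P) PP mulmx1.
Qed.

Section decomposed.
Variables (n : nat) (A P : 'M[R]_n) (D : 'rV[R]_n).
Hypothesis dec : spectral_dec A P D.

Let PP : P *m P^T = 1%:M. Proof. by case: dec. Qed.

Let PP' : P^T *m P = 1%:M. Proof. by case: dec. Qed.

Let AE : A = P^T *m diag_mx D *m P. Proof. by case: dec. Qed.

Lemma orth_dec : P^T *m P = 1%:M. Proof. exact: PP'. Qed.

Lemma qf_spectral x : qf A x = \sum_i D ord0 i * (P *m x) i ord0 ^+ 2.
Proof. by rewrite AE qf_conj qf_diag. Qed.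

Let e i : 'cV[R]_n := P^T *m delta_mx i ord0.

Lemma sqn_eigvec i : sqn (e i) = 1.
Proof.
rewrite sqn_orth ?trmxK// /sqn (bigD1 i)//= big1 ?addr0 => [|j /negPf ji].
  by rewrite mxE !eqxx expr1n.
by rewrite mxE ji expr0n.
Qed.

Lemma mul_eigvec i : A *m e i = D ord0 i *: e i.
Proof.
rewrite AE /e -!mulmxA (mulmxA P) PP mul1mx scalemxAr; congr (_ *m _).
apply/colP => j; rewrite mul_diag_mx !mxE.
by case: eqVneq => [->|]; rewrite ?mulr1// !mulr0.
Qed.

Lemma qf_eigvec i : qf A (e i) = D ord0 i.
Proof.
by rewrite /qf -mulmxA mul_eigvec -scalemxAr mxE -sqnE sqn_eigvec mulr1.
Qed.

Lemma eigenvalue_spectral i : eigenvalue A (D ord0 i).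
Proof.
apply/eigenvalueP; exists (e i)^T.
  have symA : A^T = A by rewrite AE !trmx_mul trmxK tr_diag_mx mulmxA.
  by rewrite -[in LHS]symA -trmx_mul mul_eigvec linearZ.
apply/eqP => /(congr1 trmx); rewrite trmxK trmx0 => e0.
have := sqn_eigvec i; rewrite e0 sqnE mulmx0 mxE => /eqP.
by rewrite eq_sym oner_eq0.
Qed.

Lemma det_spectral : \det A = \prod_i D ord0 i.
Proof.
rewrite AE !det_mulmx det_tr mulrAC -expr2 det_diag.
have : \det P ^+ 2 = 1 by rewrite expr2 -{2}det_tr -det_mulmx PP det1.
by move=> ->; rewrite mul1r.
Qed.

Lemma tr_spectral : \tr A = \sum_i D ord0 i.
Proof. by rewrite AE mxtrace_mulC mulmxA PP mul1mx mxtrace_diag. Qed.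

Lemma qf_inv_spectral x : (forall i, D ord0 i != 0) ->
  qf (invmx A) x = \sum_i (D ord0 i)^-1 * (P *m x) i ord0 ^+ 2.
Proof.
move=> D0; pose D' : 'rV[R]_n := \row_i (D ord0 i)^-1.
have DD : diag_mx D *m diag_mx D' = 1%:M.
  apply/matrixP => i j; rewrite mul_diag_mx !mxE.
  by case: eqVneq => [->|]; rewrite ?mulr0n ?mulr0// mulr1n divff.
have AI : A *m (P^T *m diag_mx D' *m P) = 1%:M.
  rewrite AE !mulmxA -(mulmxA _ P) PP mulmx1 -(mulmxA _ (diag_mx D)) DD mulmx1.
  exact: PP'.
have -> : invmx A = P^T *m diag_mx D' *m P.
  have [uA _] := mulmx1_unit AI.
  by apply: (can_inj (mulKmx uA)); rewrite AI mulmxV.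
by rewrite qf_conj qf_diag; apply: eq_bigr => i _; rewrite mxE.
Qed.

Lemma qf_spectral_le c : (forall i, D ord0 i <= c) -> forall x, qf A x <= c * sqn x.
Proof.
move=> Dc x; rewrite qf_spectral -(sqn_orth x PP') mulr_sumr.
by apply: ler_sum => i _; rewrite ler_wpM2r ?sqr_ge0.
Qed.

Lemma qf_spectral_ge c : (forall i, c <= D ord0 i) -> forall x, c * sqn x <= qf A x.
Proof.
move=> Dc x; rewrite qf_spectral -(sqn_orth x PP') mulr_sumr.
by apply: ler_sum => i _; rewrite ler_wpM2r ?sqr_ge0.
Qed.

End decomposed.

Lemma sym_psd_of_eigenvalue n (A : 'M[R]_n) : A^T = A ->
  (forall a (x : 'cV[R]_n), sqn x = 1 -> A *m x = a *: x -> 0 <= a) -> psdmx A.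
Proof.
move=> symA ev; split=> // x; have [P [D dec]] := real_spectral symA.
rewrite -[leRHS]/(qf A x) (qf_spectral dec) sumr_ge0// => i _.
rewrite mulr_ge0 ?sqr_ge0//.
by apply: ev (sqn_eigvec dec i) _; exact: mul_eigvec dec i.
Qed.

(** If A^2 has no positive semidefinite root, [xget] returns 0, which is positive semidefinite as
    well. Hence [reg_abs] is positive definite for every argument, in particular at points where the
    chosen weak Hessian fails to be symmetric. *)
Lemma absmx_psd n (A : 'M[R]_n) : psdmx (absmx A).
Proof.
rewrite /absmx; case: xgetP => [B _ []//|_]; split; first exact: trmx0.
by move=> x; rewrite mulmx0 mul0mx mxE.
Qed.

(** Replacing the eigenvalues of A by their absolute values gives one admissible root, so [xget]
    returns some root. Its uniqueness is never called upon: later arguments rest on its square and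
    its sign alone. *)
Lemma absmx_sqr n (A : 'M[R]_n) : A^T = A -> absmx A *m absmx A = A *m A.
Proof.
move=> symA; have [P [D [PP PP' AE]]] := real_spectral symA.
pose D' : 'rV[R]_n := \row_i `|D ord0 i|.
have ex : exists B : 'M[R]_n, psdmx B /\ B *m B = A *m A.
  exists (P^T *m diag_mx D' *m P); split; first split.
  - by rewrite !trmx_mul trmxK tr_diag_mx mulmxA.
  - move=> x; rewrite -[leRHS]/(qf _ x) qf_conj qf_diag sumr_ge0// => i _.
    by rewrite mxE mulr_ge0 ?sqr_ge0.
  - rewrite AE !mulmxA -!(mulmxA _ P) PP !mulmx1 -!(mulmxA P^T).
    congr (_ *m (_ *m _)); apply/matrixP => i j; rewrite !mul_diag_mx !mxE.
    by case: eqVneq => [->|]; rewrite ?mulr0n ?mulr0// !mulr1n -normrM ger0_norm// -expr2 sqr_ge0.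
by rewrite /absmx; case: xgetP => [B _ []//|/(_ _)]; case: ex => B hB /(_ B).
Qed.

(* With X = |A| - A and Y = |A| + A, XY + YX = 2(|A|^2 - A^2) = 0: if X x = a x
   with a < 0, then x^T Y x = 0, so that 2 x^T |A| x = a |x|^2 < 0. *)
Lemma qf_le_absmx n (A : 'M[R]_n) : A^T = A -> forall x, qf A x <= qf (absmx A) x.
Proof.
move=> symA; have [symB psdB] := absmx_psd A; have BB := absmx_sqr symA.
set B := absmx A in symB psdB BB *.
suff [_ X0] : psdmx (B - A).
  by move=> x; rewrite -subr_ge0 -qfN -qfD; exact: X0.
apply: sym_psd_of_eigenvalue; first by rewrite linearB /= symB symA.
move=> a x x1 Xx; rewrite leNgt; apply/negP => a0.
have XY : (B - A) *m (B + A) + (B + A) *m (B - A) = 0.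
  rewrite mulmxBl mulmxDl !mulmxDr !mulmxN BB.
  by apply/matrixP => i j; rewrite !mxE; ring.
have Y0 : qf (B + A) x = 0.
  have e1 : qf ((B + A) *m (B - A)) x = a * qf (B + A) x.
    by rewrite /qf !mulmxA -mulmxA Xx -scalemxAr mxE.
  have e2 : qf ((B - A) *m (B + A)) x = a * qf (B + A) x.
    have xX : x^T *m (B - A) = a *: x^T.
      by rewrite -[B - A]trmxK -trmx_mul linearB /= symB symA Xx linearZ.
    by rewrite /qf !mulmxA xX -!scalemxAl mxE.
  have : a * qf (B + A) x + a * qf (B + A) x = 0.
    by rewrite -[X in X + _]e2 -[X in _ + X]e1 -qfD XY /qf mulmx0 mul0mx mxE.
  move/eqP; rewrite -mulr2n mulrn_eq0 mulf_eq0 (lt_eqF a0) => /eqP; exact.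
have X1 : qf (B - A) x = a by rewrite /qf -mulmxA Xx -scalemxAr mxE -sqnE x1 mulr1.
have := psdB x; rewrite -/(qf B x).
by move: Y0 X1; rewrite !qfD qfN; lra.
Qed.

Lemma absmxN n (A : 'M[R]_n) : absmx (- A) = absmx A.
Proof. by rewrite /absmx mulNmx mulmxN opprK. Qed.

Lemma normr_qf_le n (A : 'M[R]_n) x : A^T = A -> `|qf A x| <= qf (absmx A) x.
Proof.
move=> symA; rewrite ler_norml qf_le_absmx// andbT lerNl -qfN -absmxN.
by apply: qf_le_absmx; rewrite linearN /= symA.
Qed.

Definition spdmx n (A : 'M[R]_n) : Prop :=
  A^T = A /\ forall x : 'cV[R]_n, x != 0 -> 0 < qf A x.

Lemma reg_abs_ge n (A : 'M[R]_n) alpha x : alpha * sqn x <= qf (reg_abs alpha A) x.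
Proof. by rewrite qfD qf_scalar lerDl; have [_] := absmx_psd A; exact. Qed.

Lemma reg_abs_spd n (A : 'M[R]_n) alpha : 0 < alpha -> spdmx (reg_abs alpha A).
Proof.
move=> a0; split => [|x x0].
  by rewrite /reg_abs linearD /= tr_scalar_mx; have [-> _] := absmx_psd A.
by rewrite (lt_le_trans _ (reg_abs_ge A alpha x))// mulr_gt0// sqn_gt0.
Qed.

Lemma spd_spectral n (A : 'M[R]_n) : spdmx A ->
  exists (P : 'M[R]_n) (D : 'rV[R]_n), spectral_dec A P D /\ forall i, 0 < D ord0 i.
Proof.
move=> [symA A0]; have [P [D dec]] := real_spectral symA.
exists P, D; split=> // i; rewrite -(qf_eigvec dec i) A0//.
apply/eqP => e0; have := sqn_eigvec dec i; rewrite e0 sqnE mulmx0 mxE => /eqP.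
by rewrite eq_sym oner_eq0.
Qed.

Lemma spd_det_gt0 n (A : 'M[R]_n) : spdmx A -> 0 < \det A.
Proof.
move=> /spd_spectral[P [D [dec D0]]].
by rewrite (det_spectral dec) prodr_gt0.
Qed.

Lemma spd_unit n (A : 'M[R]_n) : spdmx A -> A \in unitmx.
Proof. by move=> /spd_det_gt0 A0; rewrite unitmxE unitfE gt_eqF. Qed.

Lemma spd_ge0 n (A : 'M[R]_n) x : spdmx A -> 0 <= qf A x.
Proof.
move=> [_ A0]; have [->|/A0/ltW//] := eqVneq x 0.
by rewrite /qf mulmx0 mxE.
Qed.

Lemma spd_factor n (A : 'M[R]_n) : spdmx A ->
  exists2 Q : 'M[R]_n, Q \in unitmx & A = Q^T *m Q.
Proof.
move=> /[dup] spdA /spd_spectral[P [D [[PP PP' AE] D0]]].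
have AQ : A = (diag_mx (map_mx Num.sqrt D) *m P)^T *m (diag_mx (map_mx Num.sqrt D) *m P).
  rewrite AE trmx_mul tr_diag_mx !mulmxA; congr (_ *m _).
  rewrite -!mulmxA; congr (_ *m _); apply/matrixP => i j.
  rewrite mul_diag_mx !mxE; case: eqVneq => [->|]; rewrite ?mulr0n ?mulr0//.
  by rewrite !mulr1n -expr2 sqr_sqrtr// ltW.
exists (diag_mx (map_mx Num.sqrt D) *m P) => //.
have := spd_unit spdA; rewrite {1}AQ unitmx_mul => /andP[_]; exact.
Qed.

Lemma qf_factor n (B Q : 'M[R]_n) x : B = Q^T *m Q -> qf B x = sqn (Q *m x).
Proof. by move=> ->; rewrite -[Q^T]mulmx1 qf_conj qf_scalar mul1r. Qed.

Section congruence.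
Variables (n : nat) (X B Q : 'M[R]_n).
Hypothesis Qu : Q \in unitmx.
Hypothesis BE : B = Q^T *m Q.
Hypothesis symX : X^T = X.

(** For B = Q^T Q one has B^-1 X = Q^-1 Y Q. So Y is the symmetric matrix similar to B^-1 X, with Q
    in the place of the square root of B. *)
Let Y := invmx Q^T *m X *m invmx Q.

Lemma congr_sym : Y^T = Y.
Proof. by rewrite /Y !trmx_mul !trmx_inv trmxK symX mulmxA. Qed.

Lemma congrK : X = Q^T *m Y *m Q.
Proof. by rewrite /Y !mulmxA mulmxV ?unitmx_tr// mul1mx mulmxKV. Qed.

Lemma eigenvalue_congr a : eigenvalue Y a -> eigenvalue (invmx B *m X) a.
Proof.
move=> /eigenvalueP[v vY v0]; apply/eigenvalueP; exists (v *m Q).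
  have -> : invmx B = invmx Q *m invmx Q^T.
    have uB : B \in unitmx by rewrite BE unitmx_mul unitmx_tr Qu.
    apply: (can_inj (mulKmx uB)); rewrite mulmxV// BE !mulmxA mulmxK//.
    by rewrite mulmxV// unitmx_tr.
  by rewrite !mulmxA mulmxK// scalemxAl -vY /Y !mulmxA mulmxKV.
by apply: contra v0 => /eqP vQ; rewrite -(mulmxK Qu v) vQ mul0mx.
Qed.

End congruence.

(** The eigenvalues of the symmetric matrix Y are among those of B^-1 X, so the form of Y is at most
    c times the squared norm; substitute Q x. This and [eig_ge_qf] turn the recovery hypotheses into
    inequalities between quadratic forms. *)
Lemma eig_le_qf n (B X : 'M[R]_n) c : spdmx B -> X^T = X ->
  eig_le c (invmx B *m X) -> forall x, qf X x <= c * qf B x.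
Proof.
move=> /spd_factor[Q Qu BE] symX ev x.
have [P [D dec]] := real_spectral (congr_sym Q symX).
rewrite [in leLHS](congrK X Qu) qf_conj (qf_factor _ BE).
apply: (qf_spectral_le dec) => i; apply: ev.
exact: (eigenvalue_congr Qu BE (eigenvalue_spectral dec i)).
Qed.

Lemma eig_ge_qf n (B X : 'M[R]_n) c : spdmx B -> X^T = X ->
  eig_ge c (invmx B *m X) -> forall x, c * qf B x <= qf X x.
Proof.
move=> /spd_factor[Q Qu BE] symX ev x.
have [P [D dec]] := real_spectral (congr_sym Q symX).
rewrite [in leRHS](congrK X Qu) qf_conj (qf_factor _ BE).
apply: (qf_spectral_ge dec) => i; apply: ev.
exact: (eigenvalue_congr Qu BE (eigenvalue_spectral dec i)).
Qed.

(** Here \det X is \det B times the product of the n eigenvalues of Y, and each of them is at least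
    c. *)
Lemma det_ge n (B X : 'M[R]_n) c : spdmx B -> X^T = X -> 0 <= c ->
  (forall x, c * qf B x <= qf X x) -> c ^+ n * \det B <= \det X.
Proof.
move=> /[dup] /spd_det_gt0 B0 /spd_factor[Q Qu BE] symX c0 cBX.
have [P [D dec]] := real_spectral (congr_sym Q symX).
have detE Z : \det (Q^T *m Z *m Q) = (\det B * \det Z)%R.
  by rewrite BE !det_mulmx mulrAC.
rewrite (congrK X Qu) detE mulrC ler_wpM2l ?(ltW B0)//.
rewrite (det_spectral dec).
have -> : c ^+ n = \prod_(i < n) c by rewrite prodr_const card_ord.
apply: ler_prod => i _; rewrite c0 /=.
(* Chosen so that Q x is the i-th unit eigenvector of Y. *)
pose x := invmx Q *m (P^T *m delta_mx i (ord0 : 'I_1)).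
have := cBX x.
rewrite [in leRHS](congrK X Qu) qf_conj (qf_factor _ BE).
by rewrite /x mulKVmx// (qf_eigvec dec) (sqn_eigvec dec) mulr1.
Qed.

Lemma enorm_le1 n (x : 'cV[R]_n) : (enorm x <= 1) = (sqn x <= 1).
Proof. by rewrite -[RHS](ler_sqrt _ ler01) sqrtr1. Qed.

(** [sup] carries information only for a nonempty set that is bounded above. The bound used is the
    Frobenius norm, written with the eigenvalues. *)
Lemma spectral_norm_has_sup n (A : 'M[R]_n) : A^T = A ->
  has_sup [set enorm (A *m x) | x in [set x | enorm x <= 1]].
Proof.
move=> symA; split.
  by exists (enorm (A *m 0)); exists 0 => //=; rewrite enorm_le1 sqnE mulmx0 mxE.
have [P [D dec]] := real_spectral symA.
have [PP PP' AE] := dec; exists (Num.sqrt (\sum_i D ord0 i ^+ 2)) => _ [x /= x1 <-].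
rewrite ler_sqrt ?sumr_ge0// => [|i _]; last exact: sqr_ge0.
rewrite -/(sqn _) AE -mulmxA -mulmxA sqn_orth ?trmxK//.
apply: ler_sum => i _; rewrite mul_diag_mx mxE exprMn ler_piMr ?sqr_ge0//.
move: x1; rewrite enorm_le1 -(sqn_orth x (orth_dec dec)); apply: le_trans.
by rewrite /sqn (bigD1 i)//= lerDl sumr_ge0// => j _; exact: sqr_ge0.
Qed.

(** For positive semidefinite A the norm is the maximum of the Rayleigh quotient. With
    [qf_le_spectral_norm], the converse bound, it can be handled through quadratic forms alone. *)
Lemma spectral_norm_le n (A : 'M[R]_n) c : psdmx A -> 0 <= c ->
  (forall x, qf A x <= c * sqn x) -> spectral_norm A <= c.
Proof.
move=> [symA A0] c0 Ac; apply: ge_sup => [|_ [x /= x1 <-]].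
  by have [] := spectral_norm_has_sup symA.
have [P [D dec]] := real_spectral symA.
rewrite -(ler_pXn2r (n := 2))// ?nnegrE ?sqrtr_ge0// enorm_sqr.
apply: (@le_trans _ _ (c ^+ 2 * sqn x)); last first.
  by rewrite ler_piMr ?sqr_ge0// -enorm_le1.
have [PP PP' AE] := dec.
rewrite AE -mulmxA -mulmxA sqn_orth ?trmxK// -(sqn_orth x (orth_dec dec)) mulr_sumr.
apply: ler_sum => i _; rewrite mul_diag_mx mxE exprMn ler_wpM2r ?sqr_ge0//.
have De := qf_eigvec dec i; have e1 := sqn_eigvec dec i.
rewrite ler_pXn2r ?nnegrE// -De; first by rewrite -[leRHS]mulr1 -e1; exact: Ac.
exact: A0.
Qed.

Lemma qf_le_spectral_norm n (A : 'M[R]_n) : psdmx A ->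
  forall x, qf A x <= spectral_norm A * sqn x.
Proof.
move=> [symA A0]; have [P [D dec]] := real_spectral symA.
apply: (qf_spectral_le dec) => i.
have De := mul_eigvec dec i; have e1 := sqn_eigvec dec i.
apply: ub_le_sup; first by have [] := spectral_norm_has_sup symA.
exists (P^T *m delta_mx i ord0); first by rewrite /= enorm_le1 e1.
rewrite De /enorm -/(sqn _) sqnZ e1 mulr1 sqrtr_sqr ger0_norm//.
by rewrite -(qf_eigvec dec i); exact: A0.
Qed.

Lemma spd_psd n (A : 'M[R]_n) : spdmx A -> psdmx A.
Proof. by move=> spdA; split => [|x]; [case: spdA|exact: spd_ge0]. Qed.

Lemma spectral_norm_ge0 n (A : 'M[R]_n) : A^T = A -> 0 <= spectral_norm A.
Proof.
move=> symA; have [_ ub] := spectral_norm_has_sup symA.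
apply: le_trans (_ : enorm (A *m 0) <= _); first exact: sqrtr_ge0.
by apply: ub_le_sup => //; exists 0 => //=; rewrite enorm_le1 sqnE mulmx0 mxE.
Qed.

Lemma spectral_norm_mono n (A B : 'M[R]_n) c : psdmx A -> psdmx B -> 0 < c ->
  (forall x, c * qf B x <= qf A x) -> c * spectral_norm B <= spectral_norm A.
Proof.
move=> A0 B0 c0 cBA; rewrite mulrC -ler_pdivlMr//; apply: spectral_norm_le => //.
  by case: A0 => symA _; rewrite divr_ge0 ?(ltW c0)// spectral_norm_ge0.
move=> x; rewrite mulrAC ler_pdivlMr// mulrC (le_trans (cBA x))//.
exact: qf_le_spectral_norm.
Qed.

(** The eigenvalues of B^-1 are the inverses of those of B, hence at least 1 / ||B||. *)
Lemma sqn_le_qf_inv n (B : 'M[R]_n) w : spdmx B ->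
  sqn w <= spectral_norm B * qf (invmx B) w.
Proof.
move=> /[dup] spdB /spd_spectral[P [D [dec D0]]].
rewrite (qf_inv_spectral dec) => [|i]; last by rewrite gt_eqF.
rewrite -(sqn_orth w (orth_dec dec)) mulr_sumr; apply: ler_sum => i _.
rewrite mulrA ler_peMl ?sqr_ge0// ler_pdivlMr// mul1r -(qf_eigvec dec i).
rewrite -[leRHS]mulr1 -(sqn_eigvec dec i); apply: qf_le_spectral_norm.
exact: spd_psd.
Qed.

(** The inverse of an eigenvalue of S is the product of the n - 1 others divided by \det S, and each
    of these is at most the trace. *)
Lemma qf_inv_le n (S : 'M[R]_n) y : spdmx S ->
  qf (invmx S) y <= \tr S ^+ n.-1 / \det S * sqn y.
Proof.
move=> /spd_spectral[P [D [dec D0]]].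
rewrite (qf_inv_spectral dec) => [|i]; last by rewrite gt_eqF.
rewrite -(sqn_orth y (orth_dec dec)) mulr_sumr; apply: ler_sum => i _.
rewrite ler_wpM2r ?sqr_ge0// (det_spectral dec) (tr_spectral dec).
rewrite ler_pdivlMr ?prodr_gt0// (bigD1 i)//= mulKf ?gt_eqF//.
have -> : n.-1 = #|[pred j : 'I_n | j != i]| by rewrite cardC1 card_ord.
rewrite -prodr_const; apply: ler_prod => j _; rewrite ltW//=.
by rewrite (bigD1 j)//= lerDl sumr_ge0// => k _; rewrite ltW.
Qed.

Lemma spd_congr n (B E : 'M[R]_n) : spdmx B -> E \in unitmx -> spdmx (E^T *m B *m E).
Proof.
move=> [symB B0] Eu; split => [|x x0].
  by rewrite !trmx_mul trmxK symB mulmxA.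
rewrite qf_conj B0//; apply: contra x0 => /eqP Ex0.
by rewrite -(mulKmx Eu x) Ex0 mulmx0.
Qed.

(** With S = E^T B E, the form of B^-1 at w is the form of S^-1 at E^T w. For a gradient w and the
    edge matrix E, the entries of E^T w are the derivatives along the edges, so this recovers a
    gradient from its edge derivatives. *)
Lemma sqn_le_congr n (B E : 'M[R]_n) w : spdmx B -> E \in unitmx ->
  sqn w <= spectral_norm B * (\tr (E^T *m B *m E) ^+ n.-1 / \det (E^T *m B *m E)
    * sqn (E^T *m w)).
Proof.
move=> spdB Eu; apply: le_trans (sqn_le_qf_inv w spdB) _.
rewrite ler_wpM2l ?spectral_norm_ge0//; first by case: spdB.
have spdS := spd_congr spdB Eu; apply: le_trans (qf_inv_le _ spdS).
rewrite le_eqVlt; apply/orP; left; apply/eqP.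
have Bu := spd_unit spdB.
have SI : (E^T *m B *m E) *m (invmx E *m invmx B *m invmx E^T) = 1%:M.
  by rewrite !mulmxA mulmxK// mulmxK// mulmxV// unitmx_tr.
have -> : invmx (E^T *m B *m E) = invmx E *m invmx B *m invmx E^T.
  by apply: (can_inj (mulKmx (spd_unit spdS))); rewrite SI mulmxV// spd_unit.
have -> : invmx E = (invmx E^T)^T by rewrite trmx_inv trmxK.
by rewrite qf_conj mulKmx ?unitmx_tr.
Qed.

Lemma qf_le_tr n (S : 'M[R]_n) x : psdmx S -> qf S x <= \tr S * sqn x.
Proof.
move=> [symS S0]; have [P [D dec]] := real_spectral symS.
apply: (qf_spectral_le dec) => i; rewrite (tr_spectral dec) (bigD1 i)//=.
rewrite lerDl sumr_ge0// => j _; rewrite -(qf_eigvec dec j); exact: S0.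
Qed.

Lemma psd_tr_ge0 n (S : 'M[R]_n) : psdmx S -> 0 <= \tr S.
Proof.
move=> [_ S0]; apply: sumr_ge0 => i _; have := S0 (delta_mx i ord0).
by rewrite trmx_delta -rowE -colE !mxE.
Qed.

(** The trace is the sum of the values of the form of S at the columns of E. It serves to pass from
    the Jacobian of F_K to the edge matrix of K, with E the edge matrix of the reference simplex. *)
Lemma tr_congr_le n (S E : 'M[R]_n) : psdmx S ->
  \tr (E^T *m S *m E) <= \tr S * \sum_j sqn (col j E).
Proof.
move=> S0; rewrite mulr_sumr; apply: ler_sum => j _.
apply: le_trans (qf_le_tr _ S0); rewrite le_eqVlt; apply/orP; left; apply/eqP.
by rewrite colE -qf_conj /qf trmx_delta -rowE -colE !mxE.
Qed.

End quadratic_forms.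

(** * Lebesgue measure on R^d *)

Section boxes.
Context {R : realType}.

Definition box n (a b : 'rV[R]_n) : set 'rV[R]_n :=
  [set x | forall i, a ord0 i <= x ord0 i <= b ord0 i].

Definition boxes n : set (set 'rV[R]_n) := [set box p.1 p.2 | p in setT].

Lemma boxes_setI_closed n : setI_closed (@boxes n).
Proof.
move=> _ _ [[a b] _ <-] [[c d] _ <-] /=.
exists (\row_i Num.max (a ord0 i) (c ord0 i), \row_i Num.min (b ord0 i) (d ord0 i)) => //.
apply/seteqP; split => x /=.
  by move=> H; split=> i; have := H i; rewrite !mxE ge_max le_min => /andP[/andP[? ?] /andP[? ?]]; apply/andP.
by move=> [H1 H2] i; rewrite !mxE ge_max le_min; move: (H1 i) (H2 i) => /andP[-> ->] /andP[-> ->].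
Qed.

Definition cube n (k : nat) : set 'rV[R]_n := box (const_mx (- k%:R)) (const_mx k%:R).

Lemma boxes_cube n k : boxes (@cube n k).
Proof. by exists (const_mx (- k%:R), const_mx k%:R). Qed.

Lemma in_cube n (x : 'rV[R]_n) : exists k, forall m, (k <= m)%N -> cube m x.
Proof.
pose s := \sum_i `|x ord0 i|.
have s0 : 0 <= s by rewrite sumr_ge0.
exists (Num.bound s) => m km i; rewrite !mxE -ler_norml.
apply: (@le_trans _ _ s); first by rewrite /s (bigD1 i)//= lerDl sumr_ge0.
by rewrite (le_trans (ltW (archi_boundP s0)))// ler_nat.
Qed.

Lemma bigcup_cube n : \bigcup_k @cube n k = setT.
Proof. by apply/seteqP; split=> // x _; have [k /(_ k (leqnn k)) ?] := in_cube x; exists k. Qed.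

(** A half-space is a countable union of boxes. As boxes are stable under intersection and the cubes
    have finite measure, a measure is determined by its values on boxes; translation invariance
    follows. *)
Lemma measurable_boxes n : @measurable _ 'rV[R]_n = <<s @boxes n >>.
Proof.
apply/seteqP; split; last first.
  apply: smallest_sub; first exact: sigma_algebra_measurable.
  by move=> _ [[a b] _ <-]; exact: measurable_box.
move=> A mA.
suff mid : measurable_fun setT (id : g_sigma_algebraType (@boxes n) -> 'rV[R]_n).
  by have := mid measurableT A mA; rewrite setTI.
apply/measurable_fun_rVP => i.
apply: (measurability _ (measurable_realfun.RGenCInfty.measurableE R)) => _ [_ [c ->] <-].
rewrite setTI.
have -> : (fun t : 'rV[R]_n => t ord0 i) @^-1` `[c, +oo[ =
  \bigcup_k box (\row_j if j == i then c else - k%:R) (const_mx k%:R).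
  apply/seteqP; split => x /=; rewrite in_itv/= andbT.
    move=> cx; have [k /(_ k (leqnn k)) xk] := in_cube x; exists k => // j.
    have := xk j; rewrite !mxE => /andP[xl ->]; rewrite andbT.
    by case: eqVneq => [->|].
  by move=> [k _ /(_ i)]; rewrite !mxE eqxx => /andP[].
apply: bigcupT_measurable => k; apply: sub_sigma_algebra.
by eexists (_, _).
Qed.

Lemma lebesgue_rV_cube_fin n k : (lebesgue_rV n (@cube n k) < +oo)%E.
Proof.
rewrite lebesgue_rV_box ?ltry// => i; rewrite !mxE.
by rewrite (le_trans _ (ler0n _ k))// oppr_le0.
Qed.

Lemma box_shift n (a b v : 'rV[R]_n) :
  (fun y : 'rV[R]_n => y + v) @^-1` box a b = box (a - v) (b - v).
Proof.
by apply/seteqP; split => x H i; have := H i; rewrite !mxE lerBlDr lerBrDr.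
Qed.

Lemma box_eq0 n (a b : 'rV[R]_n) i : b ord0 i < a ord0 i -> box a b = set0.
Proof.
move=> ba; apply/seteqP; split => // x /(_ i) /andP[ax xb].
by have := le_trans ax xb; rewrite leNgt ba.
Qed.

Lemma measurable_shift n (v : 'rV[R]_n) : measurable_fun setT (fun y : 'rV[R]_n => y + v).
Proof.
apply/measurable_fun_rVP => i.
apply: (eq_measurable_fun (fun y : 'rV[R]_n => y ord0 i + v ord0 i)).
  by move=> y _; rewrite mxE.
by apply: measurable_funD => //; exact: measurable_coord.
Qed.

Lemma lebesgue_rV_shift n (v : 'rV[R]_n) A : measurable A ->
  pushforward (lebesgue_rV n) (fun y : 'rV[R]_n => y + v) A = lebesgue_rV n A.
Proof.
pose m2 : {measure set 'rV[R]_n -> \bar R} :=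
  measure_function_pushforward__canonical__measure_function_Measure (lebesgue_rV n) (measurable_shift v).
move=> mA; apply/esym.
apply: (measure_unique (@boxes n) (@cube n) (measurable_boxes n) (@boxes_setI_closed n)
  (@boxes_cube n) (bigcup_cube n) (lebesgue_rV n) m2) => //.
  move=> _ [[a b] _ <-] /=; rewrite /pushforward box_shift.
  have [ab|/existsNP[i ab]] := pselect (forall i, a ord0 i <= b ord0 i).
    rewrite !lebesgue_rV_box// => [|i]; last by rewrite !mxE lerD2r.
    by congr (_%:E); apply: eq_bigr => i _; rewrite !mxE; ring.
  have ba : b ord0 i < a ord0 i by rewrite ltNge; exact/negP.
  by rewrite (box_eq0 ba) (@box_eq0 _ (a - v) (b - v) i) ?measure0// !mxE ltrD2r.
by move=> k; exact: lebesgue_rV_cube_fin.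
Qed.

Definition obox n (a b : 'rV[R]_n) : set 'rV[R]_n :=
  [set x | forall i, a ord0 i < x ord0 i < b ord0 i].

(** The index type is countable, so almost everywhere statements on O reduce to single boxes. The
    closed box must lie in O, since it carries the supports of test functions, while the open boxes
    do the covering. *)
Lemma open_rat_boxes n (O : set 'rV[R]_n) : open O -> exists B : 'rV[rat]_n * rat -> 'rV[R]_n * 'rV[R]_n,
  O `<=` \bigcup_(p in [set p | box (B p).1 (B p).2 `<=` O]) obox (B p).1 (B p).2.
Proof.
move=> oO; exists (fun p : 'rV[rat]_n * rat => (\row_i ratr (p.1 ord0 i - p.2), \row_i ratr (p.1 ord0 i + p.2))).
move=> x Ox.
have /nbhs_ballP[e /= e0 eO] := open_nbhs_nbhs (conj oO Ox).
have [r] : exists r : rat, ratr r \in `]0, (e / 2)[%R by apply: rat_in_itvoo; rewrite divr_gt0.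
rewrite in_itv/= => /andP[r0 re].
have /choice[q qx] : forall i, exists q : rat, ratr q \in `]x ord0 i - ratr r, (x ord0 i + ratr r)[%R.
  by move=> i; apply: rat_in_itvoo; lra.
exists (\row_i q i, r) => /=.
  move=> y yB; apply: eO; split => // i j; rewrite ord1.
  have := yB j; have := qx j; rewrite !mxE in_itv/= rmorphB rmorphD /ball/= => /andP[? ?] /andP[? ?].
  rewrite ltr_norml; apply/andP; split; lra.
by move=> i; have := qx i; rewrite !mxE in_itv/= rmorphB rmorphD => /andP[? ?]; apply/andP; split; lra.
Qed.

Lemma open_measurable_rV n (A : set 'rV[R]_n) : open A -> measurable A.
Proof.
move=> /open_rat_boxes[B AB].
have -> : A = \bigcup_(p in [set p | box (B p).1 (B p).2 `<=` A]) box (B p).1 (B p).2.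
  apply/seteqP; split=> [x /AB[p pA xp]|x [p /= pA]]; last exact: pA.
  by exists p => // i; have /andP[/ltW -> /ltW ->] := xp i.
rewrite bigcup_mkcond; apply: countable_bigcupT_measurable; first exact: countableP.
by move=> p; case: ifP => // _; exact: measurable_box.
Qed.

End boxes.

Section hyperplane.
Context {R : realType}.

Lemma measurable_linear n (a : 'I_n -> R) :
  measurable_fun setT (fun x : 'rV[R]_n => \sum_i a i * x ord0 i).
Proof.
apply: measurable_sum => i.
by apply: measurable_funM => //; exact: measurable_coord.
Qed.

Definition hyperplane n (a : 'I_n -> R) b : set 'rV[R]_n :=
  [set x | \sum_i a i * x ord0 i = b].

Lemma lebesgue_rVS n (A : set 'rV[R]_n.+1) :
  lebesgue_rV n.+1 A = (\int[@lebesgue_measure R]_t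
    lebesgue_rV n (xsection (@cons_rV R n @^-1` A) t))%E.
Proof. by []. Qed.

(** Slice along the first coordinate. If a later coefficient is nonzero, every slice is a
    hyperplane, null by induction; otherwise the set is a point times the whole space. *)
Lemma hyperplane_null n (a : 'I_n -> R) b : (exists i, a i != 0) ->
  lebesgue_rV n (hyperplane a b) = 0%E.
Proof.
elim: n a b => [a b [[]//]|n IHn a b [i ai]].
rewrite lebesgue_rVS.
have [[j aj]|a0] := pselect (exists j, a (lift ord0 j) != 0).
  apply: integral0_eq => t _.
  rewrite -(IHn (fun j => a (lift ord0 j)) (b - a ord0 * t)); last by exists j.
  congr (lebesgue_rV n _); apply/seteqP; split => x.
    rewrite /xsection /= inE /= /hyperplane/= big_ord_recl cons_rV0/=.
    under eq_bigr do rewrite cons_rVS.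
    by move=> <-; rewrite addrAC subrr add0r.
  rewrite /xsection /= inE /= /hyperplane/= big_ord_recl cons_rV0/= => H.
  under eq_bigr do rewrite cons_rVS.
  by rewrite H addrC subrK.
have {}a0 j : a (lift ord0 j) = 0 by apply/eqP/negPn/negP => aj; apply: a0; exists j.
have a00 : a ord0 != 0.
  by move: ai; have [k ->|->//] := unliftP ord0 i; rewrite a0 eqxx.
rewrite -[LHS]/((@lebesgue_measure R \x lebesgue_rV n)%E _).
have -> : @cons_rV R n @^-1` hyperplane a b = [set b / a ord0] `*` setT.
  apply/seteqP; split => -[t x] /=; rewrite /hyperplane/= big_ord_recl cons_rV0/= big1.
  - by rewrite addr0 => <-; rewrite mulrAC divff// mul1r.
  - by move=> k _; rewrite a0 mul0r.
  - by move=> [-> _]; rewrite addr0 mulrC divfK.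
  - by move=> k _; rewrite a0 mul0r.
rewrite product_measure1E//.
by rewrite (_ : _ [set b / a ord0] = 0%E) ?mul0e//; exact: lebesgue_measure_set1.
Qed.

End hyperplane.

(** * Volume of a parallelepiped against the determinant *)

Section parallelepiped.
Context {R : realType}.

(* Row operations with pivot row k, the entries of column 0 other than the pivot
   being cancelled. *)
Lemma det_pivot n (E : 'M[R]_n.+1) k : E k ord0 != 0 ->
  `|\det E| = `|E k ord0| * `|\det (\matrix_(i < n, j < n)
     (E (lift k i) (lift ord0 j) - E (lift k i) ord0 / E k ord0 * E k (lift ord0 j)))|.
Proof.
move=> Ek0.
pose T : 'M[R]_n.+1 := \matrix_(i, j) ((i == j)%:R -
  (if i == k then 0 else E i ord0 / E k ord0 * (j == k)%:R)).
have detT : \det T = 1.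
  rewrite (expand_det_row T k) (bigD1 k)//= big1 ?addr0 => [|j /negPf jk]; last first.
    by rewrite !mxE eqxx eq_sym jk subr0 mul0r.
  rewrite mxE !eqxx subr0 mul1r /cofactor addnn -signr_odd odd_double expr0 mul1r.
  rewrite (_ : row' k (col' k T) = 1%:M) ?det1//.
  apply/matrixP => i j; rewrite !mxE.
  rewrite (inj_eq lift_inj) [lift k i == k]eq_sym [lift k j == k]eq_sym.
  by rewrite !(negPf (neq_lift _ _)) mulr0 subr0.
have TE i j : (T *m E) i j =
    if i == k then E k j else E i j - E i ord0 / E k ord0 * E k j.
  rewrite mxE.
  transitivity (\sum_l ((i == l)%:R * E l j) -
     \sum_l ((if i == k then 0 else E i ord0 / E k ord0 * (l == k)%:R) * E l j)).
    by rewrite -sumrB; apply: eq_bigr => l _; rewrite mxE mulrBl.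
  rewrite (bigD1 i)//= eqxx mul1r big1 ?addr0 => [|l /negPf li]; last first.
    by rewrite eq_sym li mul0r.
  have [->|ik] := eqVneq i k.
    by rewrite big1 ?subr0// => l _; rewrite mul0r.
  rewrite (bigD1 k)//= eqxx mulr1 [X in _ - (_ + X)]big1 ?addr0// => l /negPf lk.
  by rewrite lk mulr0 mul0r.
rewrite -[\det E]mul1r -detT -det_mulmx (expand_det_col _ ord0).
rewrite (bigD1 k)//= big1 ?addr0 => [|i ik]; last first.
  by rewrite TE (negPf ik) divfK// subrr mul0r.
rewrite TE eqxx normrM; congr (_ * _).
rewrite /cofactor normrM normrX normrN1 expr1n mul1r; congr (`|\det _|).
apply/matrixP => i j; rewrite mxE [LHS]mxE TE mxE.
by rewrite eq_sym (negPf (neq_lift _ _)).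
Qed.

Definition parallelepiped n (c : R) (b : 'rV[R]_n) (E : 'M[R]_n) : set 'rV[R]_n :=
  [set x | exists2 t : 'rV[R]_n, (forall i, `|t ord0 i| <= c) & x = b + t *m E].

(** Fixing the first coordinate to s determines the parameter t_k. Eliminating it leaves the
    remaining parameters, still bounded by c, acting through the reduced matrix of [det_pivot]; the
    maximal pivot bounds the range of s. *)
Lemma parallelepiped_section n c b (E : 'M[R]_n.+1) k s (x : 'rV[R]_n) :
  E k ord0 != 0 -> (forall i, `|E i ord0| <= `|E k ord0|) ->
  parallelepiped c b E (cons_rV (s, x)) ->
  `|s - b ord0 ord0| <= n.+1%:R * c * `|E k ord0| /\
  parallelepiped c (\row_j (b ord0 (lift ord0 j) +
      (s - b ord0 ord0) / E k ord0 * E k (lift ord0 j))) (\matrix_(i < n, j < n)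
     (E (lift k i) (lift ord0 j) - E (lift k i) ord0 / E k ord0 * E k (lift ord0 j))) x.
Proof.
move=> Ek0 Emax [t tc xt].
have s_eq : s = b ord0 ord0 + \sum_i t ord0 i * E i ord0.
  by have := congr1 (fun y : 'rV_ _ => y ord0 ord0) xt; rewrite cons_rV0/= !mxE.
have x_eq j : x ord0 j = b ord0 (lift ord0 j) + \sum_i t ord0 i * E i (lift ord0 j).
  have := congr1 (fun y : 'rV_ _ => y ord0 (lift ord0 j)) xt.
  by rewrite cons_rVS/= !mxE.
split.
  rewrite s_eq addrAC subrr add0r (le_trans (ler_norm_sum _ _ _))//.
  have -> : n.+1%:R * c * `|E k ord0| = \sum_(i < n.+1) (c * `|E k ord0|).
    by rewrite sumr_const card_ord -mulrA mulr_natl.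
  by apply: ler_sum => i _; rewrite normrM ler_pM.
exists (\row_i t ord0 (lift k i)); first by move=> i; rewrite mxE.
apply/rowP => j; rewrite x_eq s_eq [_ + _ - b _ _]addrAC subrr add0r !mxE -addrA; congr (_ + _).
have sumk (F : 'I_n.+1 -> R) : \sum_i F i = F k + \sum_i F (lift k i).
  rewrite (bigD1 k)//=; congr (_ + _).
  rewrite (reindex_omap (lift k) (unlift k)) => [|i ik]; last first.
    by have := @unlift_some _ k i; rewrite eq_sym ik => /(_ isT)[l -> ->].
  by apply: eq_bigl => i; rewrite liftK eqxx andbT eq_sym neq_lift.
rewrite !sumk.
under [X in _ = _ + X]eq_bigr do rewrite !mxE mulrBr.
rewrite sumrB.
have -> : \sum_i t ord0 (lift k i) *
    (E (lift k i) ord0 / E k ord0 * E k (lift ord0 j)) =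
    (\sum_i t ord0 (lift k i) * E (lift k i) ord0) / E k ord0 * E k (lift ord0 j).
  by rewrite !mulr_suml; apply: eq_bigr => i _; rewrite !mulrA.
by field.
Qed.

(** Induction on n by slicing: the slices have volume at most C |det E'|, they are nonempty only for
    s in an interval of length 2 (n+1) c |E_k0|, and |det E| = |E_k0| |det E'|. Applied to simplices
    with c = 1, this bounds |K| by the determinant of the edge matrix. *)
Lemma parallelepiped_volume n (c : R) : 0 <= c -> exists2 C : R, 0 < C &
  forall (b : 'rV[R]_n) (E : 'M[R]_n) (X : set 'rV[R]_n), measurable X ->
    \det E != 0 -> X `<=` parallelepiped c b E ->
    (lebesgue_rV n X <= (C * `|\det E|)%:E)%E.
Proof.
move=> c0; elim: n => [|n [C C0 IHn]].
  exists 1 => // b E X _ _ _; rewrite det_mx00 normr1 mulr1 /= diracE.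
  by rewrite lee_fin; case: (_ \in _).
(* The summand 1 keeps the constant positive when c = 0. *)
exists (2 * (n.+1%:R * c) * C + 1).
  by rewrite ltr_wpDl// !mulr_ge0// ltW.
move=> b E X mX detE XE.
have [k Ek] : exists k, forall i, `|E i ord0| <= `|E k ord0|.
  exists [arg max_(i > ord0) `|E i ord0|]%O.
  by case: Order.TotalTheory.arg_maxP => // k _ H i; exact: H.
have Ek0 : E k ord0 != 0.
  apply: contra detE => /eqP Ek0; rewrite (expand_det_col _ ord0) big1// => i _.
  have := Ek i; rewrite Ek0 normr0 normr_le0 => /eqP ->; exact: mul0r.
set E' : 'M[R]_n := \matrix_(i < n, j < n) (E (lift k i) (lift ord0 j) -
  E (lift k i) ord0 / E k ord0 * E k (lift ord0 j)).
have dE : `|\det E| = `|E k ord0| * `|\det E'| by exact: det_pivot.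
have detE' : \det E' != 0.
  by move: detE; rewrite -normr_eq0 dE mulf_eq0 negb_or !normr_eq0 => /andP[].
pose r := n.+1%:R * c * `|E k ord0|.
have r0 : 0 <= r by rewrite !mulr_ge0.
have mX' : measurable (@cons_rV R n @^-1` X).
  by rewrite -[X in measurable X]setTI; exact: measurable_cons_rV.
pose J : set R := `[b ord0 ord0 - r, b ord0 ord0 + r]%classic.
rewrite lebesgue_rVS.
apply: (@le_trans _ _ (\int[@lebesgue_measure R]_t ((C * `|\det E'|) * \1_J t)%:E)%E).
  apply: ge0_le_integral => //.
  - exact: measurable_fun_xsection.
  - by apply/measurable_EFinP; apply: measurable_funM => //; apply: measurable_indic; exact: measurable_itv.
  move=> t _; rewrite indicE.
  have [tJ|tJ] := boolP (t \in J); last first.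
    rewrite mulr0 (_ : xsection _ _ = set0) ?measure0//.
    apply/seteqP; split => // x; rewrite /xsection/= inE/= => /XE.
    move=> /(parallelepiped_section Ek0 Ek)[+ _]; rewrite ler_norml => sb.
    by move: tJ; rewrite notin_setE /J/= in_itv/=; apply; move: sb; rewrite -/r; lra.
  rewrite mulr1.
  pose b' : 'rV[R]_n := \row_j (b ord0 (lift ord0 j) +
    (t - b ord0 ord0) / E k ord0 * E k (lift ord0 j)).
  apply: (IHn b') => //; first exact: measurable_xsection.
  move=> x; rewrite /xsection/= inE/= => /XE.
  by move=> /(parallelepiped_section Ek0 Ek)[].
under eq_integral do rewrite EFinM.
rewrite ge0_integralZl//=; last first.
- by rewrite lee_fin mulr_ge0// ltW.
- by apply/measurable_EFinP; apply: measurable_indic; exact: measurable_itv.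
have mJ : measurable J by exact: measurable_itv.
have -> : (\int[@lebesgue_measure R]_t (\1_J t)%:E = @lebesgue_measure R J)%E.
  by rewrite integral_indic// setIT.
rewrite lebesgue_measure_itv/= lte_fin.
case: ifPn => _; last by rewrite mule0 lee_fin mulr_ge0// addr_ge0// !mulr_ge0// ltW.
rewrite -EFinB -EFinM lee_fin.
have -> : b ord0 ord0 + r - (b ord0 ord0 - r) = 2 * r by ring.
have -> : C * `|\det E'| * (2 * r) = 2 * (n.+1%:R * c) * C * `|\det E|.
  by rewrite dE /r; ring.
by rewrite ler_wpM2r// lerDl.
Qed.

End parallelepiped.

(** * Test functions and weak derivatives *)

Section smooth_bumps_1d.
Context {R : realType}.
Implicit Types (f g : R -> R) (x y : R).

Lemma is_derive_quadratic f x C :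
  (forall y, `|f y - f x| <= C * (y - x) ^+ 2) -> is_derive x 1 f 0.
Proof.
move=> fC; have C0 : 0 <= C.
  by have := fC (x + 1); rewrite addrAC subrr add0r expr1n mulr1; exact: le_trans.
have cv : (fun h => h^-1 *: ((f \o shift x) (h *: (1 : R)) - f x)) @ 0^' --> (0 : R).
  apply/cvgrPdist_le => e e0; near=> h.
  have h0 : h != 0 by near: h; exact: nbhs_dnbhs_neq.
  rewrite sub0r normrN normrZ normfV -(ler_pM2l (_ : 0 < `|h|)) ?normr_gt0//.
  rewrite mulVKf ?normr_eq0// (le_trans (fC _))//= scaler1 addrK -(ger0_norm (sqr_ge0 h)) normrX expr2 mulrCA.
  rewrite ler_wpM2l// (@le_trans _ _ ((C + 1) * `|h|))// ?ler_wpM2r ?lerDl//.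
  rewrite -ler_pdivlMl ?ltr_wpDl// mulrC.
  near: h; apply: nbhs_dnbhs; apply/nbhs_ballP.
  exists (e / (C + 1)) => /=; first by rewrite divr_gt0// ltr_wpDl.
  by move=> h; rewrite /ball/= sub0r normrN => /ltW.
apply: DeriveDef; first by apply/cvg_ex; exists 0.
exact/cvg_lim.
Unshelve. all: by end_near. Qed.

(** The derivatives of exp(-1/x), extended by 0, are combinations of these functions: theta_k' =
    theta_(k+2) - k theta_(k+1), also at 0. *)
Definition theta (k : nat) x : R := if 0 < x then x^-1 ^+ k * expR (- x^-1) else 0.

Lemma theta_ge0 k x : 0 <= theta k x.
Proof.
by rewrite /theta; case: ifPn => // x0; rewrite mulr_ge0 ?expR_ge0// exprn_ge0// invr_ge0 ltW.
Qed.

Lemma theta_le k x : theta k x <= k.+2`!%:R * x ^+ 2.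
Proof.
rewrite /theta; case: ifPn => x0; last by rewrite mulr_ge0// sqr_ge0.
have y0 : 0 < x^-1 by rewrite invr_gt0.
have := @expR_ge1Dxn R x^-1 k.+1 (ltW y0) => H.
rewrite expRN -(ler_pM2r (expR_gt0 x^-1)) mulfVK ?gt_eqF ?expR_gt0//.
have {H} : x^-1 ^+ k.+2 / k.+2`!%:R <= expR x^-1 by apply: le_trans H; rewrite lerDr.
rewrite ler_pdivrMr ?ltr0n ?fact_gt0// => H.
rewrite mulrC mulrA mulrC -ler_pdivrMl ?exprn_gt0//.
by rewrite -exprVn -exprD addnC addn2.
Qed.

Lemma is_derive_theta k x :
  is_derive x 1 (theta k) (theta k.+2 x - k%:R * theta k.+1 x).
Proof.
have [x0|x0|->] := ltgtP x 0.
- have -> : theta k.+2 x - k%:R * theta k.+1 x = 0.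
    by rewrite /theta ltNge (ltW x0)/= mulr0 subr0.
  have H : \near x, cst 0 x = theta k x.
    near=> y; rewrite /theta ltNge ltW//.
    by near: y; exact: lt_nbhsl.
  exact: (near_eq_is_derive H (is_derive_cst _ _ _)).
- apply: (@near_eq_is_derive _ _ _ (fun y => y^-1 ^+ k * expR (- y^-1))).
    near=> y; rewrite /theta; have -> // : 0 < y.
    by near: y; exact: lt_nbhsr.
  have xn0 : (id x : R) != 0 by rewrite gt_eqF.
  have Dv : is_derive x 1 (fun y : R => y^-1) (- x ^- 2).
    by have := @is_deriveV R id x 1 1 xn0 (is_derive_id _ _); rewrite /= scaler1.
  have De : is_derive x 1 (fun y : R => expR (- y^-1)) (expR (- x^-1) * x ^- 2).
    have DN : is_derive x 1 (fun y : R => - y^-1) (x ^- 2).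
      by have := is_deriveN Dv; rewrite opprK.
    exact: (@is_derive1_comp _ expR (fun y => - y^-1) x _ _ (is_derive_expR (- x^-1)) DN).
  have Dx := @is_deriveX _ _ (fun y : R => y^-1) k x 1 _ Dv.
  have XE y : ((fun y : R => y^-1) ^+ k) y = y^-1 ^+ k.
    by elim: (k) => // n; rewrite !exprS => <-.
  rewrite (_ : (fun y => _) = (fun y : R => y^-1) ^+ k * (fun y => expR (- y^-1))); last first.
    by apply/funext => y; rewrite -XE.
  apply: (is_derive_eq (is_deriveM Dx De)).
  rewrite /theta x0 /GRing.scale /= XE -!exprVn.
  case: (k) => [|n]; first by rewrite !expr0 !mul0r mulr0 addr0 mul1r subr0 !exprS; ring.
  by rewrite /= !exprS; ring.
- have -> : theta k.+2 0 - k%:R * theta k.+1 0 = 0.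
    by rewrite /theta ltxx mulr0 subr0.
  apply: (@is_derive_quadratic _ _ k.+2`!%:R) => y.
  by rewrite {2}/theta ltxx !subr0 ger0_norm ?theta_ge0// theta_le.
Unshelve. all: by end_near. Qed.

(* Differentiating a generator gives an element of the class again, so membership
   propagates to all derivatives. *)
Inductive smf : (R -> R) -> Prop :=
| smf_theta k s a : smf (fun x => theta k (s * x + a))
| smf_scale c f : smf f -> smf (fun x => c * f x)
| smf_add f g : smf f -> smf g -> smf (fun x => f x + g x)
| smf_mul f g : smf f -> smf g -> smf (fun x => f x * g x).

Lemma smf_is_derive f : smf f -> exists2 g, smf g & forall x, is_derive x 1 f (g x).
Proof.
elim=> {f} [k s a|c f sf [f' sf' Df]|f g sf [f' sf' Df] sg [g' sg' Dg]|
  f g sf [f' sf' Df] sg [g' sg' Dg]].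
- exists (fun x => s * (theta k.+2 (s * x + a) + (- k%:R) * theta k.+1 (s * x + a))).
    apply: smf_scale; apply: smf_add; first exact: smf_theta.
    by apply: smf_scale; exact: smf_theta.
  move=> x.
  have Da : is_derive x 1 (fun y : R => s * y + a) s.
    have D1 : is_derive x 1 (fun y : R => s * y) s.
      by have := @is_deriveZ R _ _ id s x 1 1 (is_derive_id _ _); rewrite scaler1.
    by have := is_deriveD D1 (is_derive_cst a x 1); rewrite addr0.
  have := @is_derive1_comp _ (theta k) (fun y => s * y + a) x _ s (is_derive_theta k _) Da.
  by rewrite mulrC mulNr.
- exists (fun x => c * f' x); first exact: smf_scale.
  by move=> x; exact: (is_deriveZ c (Df x)).
- exists (fun x => f' x + g' x); first exact: smf_add.
  by move=> x; exact: is_deriveD.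
- exists (fun x => f x * g' x + g x * f' x); last by move=> x; exact: is_deriveM.
  by apply: smf_add; exact: smf_mul.
Qed.

Lemma smf_derivable f x : smf f -> derivable f x 1.
Proof. by move=> /smf_is_derive[g _ /(_ x)[]]. Qed.

Lemma smf_derive f : smf f -> smf (derive1 f).
Proof.
move=> /smf_is_derive[g sg fg]; rewrite (_ : (derive1 f) = g)//.
by apply/funext => x; rewrite derive1E derive_val.
Qed.

Lemma smf_is_derive1 f x : smf f -> is_derive x 1 f ((derive1 f) x).
Proof. by move=> /smf_is_derive[g _ fg]; rewrite derive1E; apply/derivableP; case: (fg x). Qed.

Lemma smf_continuous f : smf f -> continuous f.
Proof.
move=> sf x; apply/differentiable_continuous/derivable1_diffP.
exact: smf_derivable.
Qed.

Lemma smf_shift f t : smf f -> smf (fun x => f (x + t)).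
Proof.
elim=> {f} [k s a|c f _ sf|f g _ sf _ sg|f g _ sf _ sg].
- rewrite (_ : (fun x => _) = (fun x => theta k (s * x + (s * t + a)))).
    exact: smf_theta.
  by apply/funext => x; rewrite mulrDr addrA.
- exact: smf_scale.
- exact: smf_add.
- exact: smf_mul.
Qed.

Definition smc (a b : R) f := smf f /\ forall x, ~~ (a <= x <= b) -> f x = 0.

Lemma smc_derive a b f : smc a b f -> smc a b (derive1 f).
Proof.
move=> [sf f0]; split; first exact: smf_derive.
move=> x xab; rewrite derive1E -(@derive_cst R R R 0 x 1).
apply: near_eq_derive; move: xab; rewrite negb_and -!ltNge => /orP[xa|bx]; near=> y; apply: f0.
  have ya : y < a by near: y; exact: lt_nbhsl.
  by rewrite leNgt ya.
have yb : b < y by near: y; exact: lt_nbhsr.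
by rewrite [y <= b]leNgt yb andbF.
Unshelve. all: by end_near. Qed.

Lemma smc_bounded a b f : smc a b f -> exists M, forall x, `|f x| <= M.
Proof.
move=> [sf f0].
have [M [_ Mf]] := compact_bounded (continuous_compact
  (continuous_subspaceT (smf_continuous sf)) (@segment_compact _ a b)).
exists (Num.max 0 (M + 1)) => x; have [xab|/f0 ->] := boolP (a <= x <= b); last first.
  by rewrite normr0 le_max lexx.
rewrite le_max; apply/orP; right; apply: Mf; first by rewrite ltrDl.
by exists x => //=; rewrite in_itv.
Qed.

Lemma smc_shift a b f t : smc a b f -> smc (a + t) (b + t) (fun x => f (x - t)).
Proof.
move=> [sf f0]; split; first exact: smf_shift.
by move=> x xab; apply: f0; rewrite lerBrDr lerBlDr.
Qed.

(** On ]a, b[ this is exp(- c (1/(x - a) + 1/(b - x))). It takes values in [0, 1] and tends to the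
    indicator of ]a, b[ as c tends to 0, which is the purpose of the parameter. *)
Definition cbump (a b c : R) x : R := theta 0 (c^-1 * x + - (c^-1 * a)) * theta 0 ((- c^-1) * x + c^-1 * b).

Lemma cbump_smc a b c : 0 < c -> smc a b (cbump a b c).
Proof.
move=> c0; split; first by apply: smf_mul; exact: smf_theta.
move=> x; rewrite negb_and -!ltNge /cbump /theta.
rewrite -mulrBr mulNr (addrC (- _)) -mulrBr !pmulr_rgt0 ?invr_gt0// !subr_gt0.
by move=> /orP[xa|bx]; [rewrite (lt_gtF xa) mul0r|rewrite (lt_gtF bx) mulr0].
Qed.

Lemma cbumpE a b c x : 0 < c -> a < x < b ->
  cbump a b c x = expR (- (c * ((x - a)^-1 + (b - x)^-1))).
Proof.
move=> c0 /andP[ax xb]; rewrite /cbump /theta -mulrBr mulNr (addrC (- _)) -mulrBr.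
rewrite !pmulr_rgt0 ?invr_gt0// !subr_gt0 ax xb !expr0 !mul1r -expRD.
by rewrite !invfM invrK mulrDr opprD.
Qed.

Lemma cbump0 a b c x : 0 < c -> ~~ (a < x < b) -> cbump a b c x = 0.
Proof.
move=> c0; rewrite negb_and /cbump /theta -mulrBr mulNr (addrC (- _)) -mulrBr.
rewrite !pmulr_rgt0 ?invr_gt0// !subr_gt0.
by move=> /orP[/negPf ->|/negPf ->]; rewrite ?mul0r ?mulr0.
Qed.

Lemma cbump_ge0 a b c x : 0 <= cbump a b c x.
Proof. by rewrite mulr_ge0// theta_ge0. Qed.

Lemma cbump_gt0 a b c x : 0 < c -> a < x < b -> 0 < cbump a b c x.
Proof. by move=> c0 axb; rewrite cbumpE// expR_gt0. Qed.

Lemma cbump_le1 a b c x : 0 < c -> cbump a b c x <= 1.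
Proof.
move=> c0; have [axb|naxb] := boolP (a < x < b); last by rewrite cbump0.
rewrite cbumpE// -expR0 ler_expR oppr_le0 mulr_ge0 ?ltW//.
by move: axb => /andP[ax xb]; rewrite addr_gt0// invr_gt0 subr_gt0.
Qed.

Lemma cbump_cvg a b x :
  cbump a b n.+1%:R^-1 x @[n --> \oo] --> ((a < x < b)%R%:R : R).
Proof.
have [axb|naxb] := boolP (a < x < b); last first.
  under eq_cvg do rewrite cbump0//.
  exact: cvg_cst.
under eq_cvg do rewrite cbumpE//.
have H : - (n.+1%:R^-1 * ((x - a)^-1 + (b - x)^-1)) @[n --> \oo] --> (0 : R).
  rewrite -oppr0; apply: cvgN; rewrite -[X in _ --> X](mul0r ((x - a)^-1 + (b - x)^-1)).
  by apply: cvgMl; exact: cvg_harmonic.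
by have := @cvg_comp _ _ _ (fun n : nat => - (n.+1%:R^-1 * ((x - a)^-1 + (b - x)^-1))) expR _ _ _ H (@continuous_expR R 0); rewrite expR0.
Qed.

End smooth_bumps_1d.

Section tensor_products.
Context {R : realType} {d : nat}.
Implicit Types (F : 'I_d -> R -> R) (x v a b : 'rV[R]_d).

(** Tensor products of one-variable functions. Their i-th partial derivative replaces factor i by
    its derivative, which [upd] expresses, so smoothness in d variables reduces to one variable. *)
Definition prodf F x : R := \prod_i F i (x ord0 i).

Definition upd F i (g : R -> R) : 'I_d -> R -> R := fun j => if j == i then g else F j.

Lemma prodf_upd F i g x : prodf (upd F i g) x = g (x ord0 i) * \prod_(j | j != i) F j (x ord0 j).
Proof.
rewrite /prodf (bigD1 i)//= /upd eqxx; congr (_ * _).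
by apply: eq_bigr => j /negPf ->.
Qed.

Lemma is_derive_prod n (g : 'I_n -> R -> R) (g' : 'I_n -> R) (s : R) :
  (forall i, is_derive s 1 (g i) (g' i)) ->
  is_derive s 1 (fun t => \prod_i g i t) (\sum_i g' i * \prod_(j | j != i) g j s).
Proof.
elim: n g g' => [|n IHn] g g' Dg.
  rewrite big_ord0 (_ : (fun t => _) = cst 1); first exact: is_derive_cst.
  by apply/funext => t; rewrite big_ord0.
rewrite (_ : (fun t => _) = g ord0 * (fun t => \prod_i g (lift ord0 i) t)); last first.
  by apply/funext => t; rewrite big_ord_recl.
apply: (is_derive_eq (is_deriveM (Dg ord0) (IHn _ _ (fun i => Dg (lift ord0 i))))).
rewrite /GRing.scale /= addrC big_ord_recl mulrC; congr (_ * _ + _).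
  by rewrite [RHS]big_mkcond big_ord_recl/= mul1r.
rewrite mulr_sumr; apply: eq_bigr => i _.
rewrite mulrCA; congr (_ * _).
rewrite [RHS]big_mkcond big_ord_recl/= [X in _ * X = _]big_mkcond; congr (_ * _).
Qed.

Lemma is_derive_prodf_line F v x (s : R) : (forall i, smf (F i)) ->
  is_derive s 1 (fun t => prodf F (x - t *: v))
    (- \sum_i v ord0 i * prodf (upd F i (derive1 (F i))) (x - s *: v)).
Proof.
move=> sF.
have D i : is_derive s 1 (fun t => F i (x ord0 i - t * v ord0 i))
    (- (v ord0 i * derive1 (F i) (x ord0 i - s * v ord0 i))).
  have D1 : is_derive s 1 (fun t : R => t * v ord0 i) (v ord0 i).
    rewrite (_ : (fun t => _) = (v ord0 i) *: (id : R -> R)).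
      by apply: (is_derive_eq (is_deriveZ _ (is_derive_id s 1))); rewrite /GRing.scale/= mulr1.
    by apply/funext => t; rewrite /= mulrC.
  have D2 : is_derive s 1 (fun t : R => x ord0 i - t * v ord0 i) (- v ord0 i).
    by apply: (is_derive_eq (is_deriveB (is_derive_cst (x ord0 i) s 1) D1)); rewrite sub0r.
  have := @is_derive1_comp _ (F i) (fun t => x ord0 i - t * v ord0 i) s _ _
    (smf_is_derive1 _ (sF i)) D2.
  by rewrite mulrN mulrC.
rewrite (_ : (fun t => _) = (fun t => \prod_i F i (x ord0 i - t * v ord0 i))); last first.
  by apply/funext => t; apply: eq_bigr => i _; rewrite !mxE.
apply: (is_derive_eq (is_derive_prod D)).
rewrite -sumrN; apply: eq_bigr => i _; rewrite prodf_upd mulNr !mxE mulrA.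
by congr (- (_ * _)); apply: eq_bigr => j _; rewrite !mxE.
Qed.

Lemma partial_prodf F i x : smf (F i) ->
  is_derive x (delta_mx ord0 i) (prodf F) (prodf (upd F i (derive1 (F i))) x).
Proof.
move=> sF; set P := \prod_(j | j != i) F j (x ord0 j).
have E h : (prodf F \o shift x) (h *: delta_mx ord0 i) - prodf F x =
    P * ((F i \o shift (x ord0 i)) (h *: 1) - F i (x ord0 i)).
  rewrite /= /prodf (bigD1 i)//= [X in _ - X](bigD1 i)//= -/P.
  rewrite mulrBr ![P * _]mulrC !mxE !eqxx; congr (_ * _ - _).
  by apply: eq_bigr => j /negPf ji; rewrite !mxE ji andbF mulr0 add0r.
have [c e] := smf_is_derive1 (x ord0 i) sF.
have cv : (fun h : R => h^-1 *: ((prodf F \o shift x) (h *: delta_mx ord0 i) - prodf F x)) @ 0^' -->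
    prodf (upd F i (derive1 (F i))) x.
  rewrite prodf_upd -/P mulrC -e.
  under eq_cvg do rewrite E /GRing.scale /= mulrCA.
  by apply: cvgMr; exact: c.
by apply: DeriveDef; [apply/cvg_ex; eexists; exact: cv|exact/cvg_lim].
Qed.

Lemma continuous_prodf F : (forall i, continuous (F i)) -> continuous (prodf F).
Proof.
move=> cF x; rewrite /prodf; elim: (index_enum _) => [|i r IHr].
  rewrite (_ : (fun x => _) = cst 1); first exact: cst_continuous.
  by apply/funext => y; rewrite big_nil.
rewrite (_ : (fun x => _) = (fun x : 'rV[R]_d => F i (x ord0 i) * \prod_(i <- r) F i (x ord0 i))).
  apply: continuousM => //; apply: continuous_comp; first exact: coord_continuous.
  exact: cF.
by apply/funext => y; rewrite big_cons.
Qed.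

Definition smc_box a b F := forall i, smc (a ord0 i) (b ord0 i) (F i).

Lemma smc_box_upd a b F i : smc_box a b F -> smc_box a b (upd F i (derive1 (F i))).
Proof. by move=> sF j; rewrite /upd; case: eqVneq => // ->; exact: smc_derive. Qed.

Lemma partial_prodfE a b F i : smc_box a b F ->
  partial i (prodf F) = prodf (upd F i (derive1 (F i))).
Proof.
by move=> sF; apply/funext => x; have [_] := @partial_prodf F i x (sF i).1.
Qed.

Lemma smooth_prodf a b F : smc_box a b F -> smooth (prodf F).
Proof.
move=> sF s; have [F' sF' ->] : exists2 F', smc_box a b F' & foldr partial (prodf F) s = prodf F'.
  elim: s => [|i s [F' sF' IH]]; first by exists F.
  exists (upd F' i (derive1 (F' i))); first exact: smc_box_upd.
  by rewrite /= IH (partial_prodfE _ sF').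
split; first by apply: continuous_prodf => i; exact: smf_continuous (sF' i).1.
by move=> x i; have [] := @partial_prodf F' i x (sF' i).1.
Qed.

Lemma compact_box a b : compact (box a b).
Proof.
rewrite (_ : box a b = [set x : 'rV[R]_d | forall i, `[a ord0 i, b ord0 i]%classic (x ord0 i)]).
  exact: (@rV_compact R d (fun i => `[a ord0 i, b ord0 i]%classic) (fun i => @segment_compact _ _ _)).
by apply/seteqP; split => x /= H i; have := H i; rewrite in_itv.
Qed.

Lemma prodf_out a b F x : smc_box a b F -> ~ box a b x -> prodf F x = 0.
Proof.
move=> sF /existsNP[i /negP xi]; rewrite /prodf (bigD1 i)//= (sF i).2// ?mul0r//.
Qed.

Lemma test_prodf Omega a b F : smc_box a b F -> box a b `<=` Omega ->
  test_function Omega (prodf F).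
Proof.
move=> sF bO; split; first exact: smooth_prodf sF.
by exists (box a b); [split => //; exact: compact_box|move=> x; exact: prodf_out].
Qed.

Lemma prodf_bounded a b F : smc_box a b F -> exists2 M, 0 <= M & forall x, `|prodf F x| <= M.
Proof.
move=> sF.
have /choice[M HM] i : exists M, forall y, `|F i y| <= M by exact: smc_bounded (sF i).
exists (\prod_i M i); first by rewrite prodr_ge0// => i _; exact: le_trans (HM i 0).
by move=> x; rewrite /prodf normr_prod; apply: ler_prod => i _; rewrite normr_ge0 HM.
Qed.

Lemma measurable_prodf a b F : smc_box a b F -> measurable_fun setT (prodf F).
Proof.
move=> sF; apply: measurable_prod => i _.
apply: (measurableT_comp _ (measurable_coord i)).
exact: continuous_measurable_fun (smf_continuous (sF i).1).
Qed.

Definition shiftf F v : 'I_d -> R -> R := fun i y => F i (y - v ord0 i).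

Lemma prodf_shift F v x : prodf (shiftf F v) x = prodf F (x - v).
Proof. by apply: eq_bigr => i _; rewrite !mxE. Qed.

Lemma smc_box_shift a b F v : smc_box a b F -> smc_box (a + v) (b + v) (shiftf F v).
Proof. by move=> sF i; rewrite !mxE; exact: smc_shift. Qed.

Definition bumps a b (c : R) : 'I_d -> R -> R := fun i => cbump (a ord0 i) (b ord0 i) c.

Lemma smc_bumps a b c : 0 < c -> smc_box a b (bumps a b c).
Proof. by move=> c0 i; exact: cbump_smc. Qed.

Lemma prodf_bumps_ge0 a b c x : 0 <= prodf (bumps a b c) x.
Proof. by rewrite prodr_ge0// => i _; exact: cbump_ge0. Qed.

Lemma prodf_bumps_gt0 a b c x : 0 < c -> obox a b x -> 0 < prodf (bumps a b c) x.
Proof. by move=> c0 xab; rewrite prodr_gt0// => i _; exact: cbump_gt0. Qed.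

Lemma prodf_bumps_cvg a b x :
  prodf (bumps a b n.+1%:R^-1) x @[n --> \oo] --> (\1_(obox a b) x : R).
Proof.
have -> : \1_(obox a b) x = \prod_i ((a ord0 i < x ord0 i < b ord0 i)%R%:R : R).
  rewrite indicE; have [xab|/existsNP[i /negP xi]] := pselect (obox a b x).
    by rewrite mem_set// big1// => i _; rewrite xab.
  rewrite memNset; first by rewrite (bigD1 i)//= (negPf xi) mul0r.
  by move=> /(_ i); exact/negP.
rewrite /prodf; elim: (index_enum _) => [|i r IHr].
  by under eq_cvg do rewrite big_nil; rewrite big_nil; exact: cvg_cst.
under eq_cvg do rewrite big_cons; rewrite big_cons.
by apply: cvgM => //; exact: cbump_cvg.
Qed.

End tensor_products.

Section open_boxes.
Context {R : realType} {d : nat}.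
Implicit Types a b : 'rV[R]_d.

(** A second generating family, closed under intersection: the limits of bumps are indicators of
    open boxes. *)
Definition oboxes : set (set 'rV[R]_d) := [set obox p.1 p.2 | p in setT].

Lemma oboxI a b c e : obox a b `&` obox c e =
  obox (\row_i Num.max (a ord0 i) (c ord0 i)) (\row_i Num.min (b ord0 i) (e ord0 i)).
Proof.
apply/seteqP; split => x /=.
  by move=> [H1 H2] i; rewrite !mxE gt_max lt_min; move: (H1 i) (H2 i) => /andP[-> ->] /andP[-> ->].
by move=> H; split=> i; have := H i; rewrite !mxE gt_max lt_min => /andP[/andP[? ?] /andP[? ?]]; apply/andP.
Qed.

Lemma oboxes_setI_closed : setI_closed oboxes.
Proof. by move=> _ _ [[a b] _ <-] [[c e] _ <-] /=; rewrite oboxI; eexists (_, _). Qed.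

Lemma measurable_obox a b : measurable (obox a b).
Proof.
have -> : obox a b =
    \bigcap_(i in [set: 'I_d]) (fun x : 'rV[R]_d => x ord0 i) @^-1` `]a ord0 i, b ord0 i[.
  by apply/seteqP; split=> x H i => [_|]; have := H i; rewrite /= in_itv/=; last exact.
apply: fin_bigcap_measurable => // i _.
by rewrite -[X in measurable X]setTI; exact: measurable_coord.
Qed.

Lemma measurable_oboxes : @measurable _ 'rV[R]_d = <<s oboxes >>.
Proof.
apply/seteqP; split; last first.
  apply: smallest_sub; first exact: sigma_algebra_measurable.
  by move=> _ [[a b] _ <-]; exact: measurable_obox.
rewrite measurable_boxes; apply: smallest_sub; first exact: smallest_sigma_algebra.
move=> _ [[a b] _ <-] /=.
have -> : box a b = \bigcap_n obox (a - const_mx n.+1%:R^-1) (b + const_mx n.+1%:R^-1).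
  apply/seteqP; split => x /= H.
    move=> n _ i; have /andP[ax xb] := H i; rewrite !mxE.
    by rewrite ltrBlDr ltr_pwDr//= ltr_pwDr.
  move=> i; apply/andP; split; apply/ler_addgt0Pr => e e0.
    have [n] := near_infty_natSinv_lt (PosNum e0); move=> _ /(_ n (leqnn n)) /= ne.
    by have := H n I i; rewrite !mxE => /andP[ax _]; rewrite -lerBlDr (le_trans _ (ltW ax))// lerB// ltW.
  have [n] := near_infty_natSinv_lt (PosNum e0); move=> _ /(_ n (leqnn n)) /= ne.
  by have := H n I i; rewrite !mxE => /andP[_ /ltW xb]; rewrite (le_trans xb)// lerD// ltW.
apply: (@bigcapT_measurable _ (g_sigma_algebraType oboxes)) => n.
by apply: sub_sigma_algebra; eexists (_, _).
Qed.

End open_boxes.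

(** * Fundamental lemma of the calculus of variations for tensor-product tests *)

Section fundamental_lemma.
Context {R : realType} {d : nat}.
Let mu := @lebesgue_rV R d.
Implicit Types (a b : 'rV[R]_d) (g : 'rV[R]_d -> R).

Lemma integrable_mul_bounded g (phi : 'rV[R]_d -> R) M :
  mu.-integrable setT (EFin \o g) -> measurable_fun setT phi ->
  (forall x, `|phi x| <= M) -> mu.-integrable setT (EFin \o (fun x => g x * phi x)).
Proof.
move=> ig mphi Mphi.
have -> : EFin \o (fun x => g x * phi x) = ((EFin \o g) \* (EFin \o phi))%E by [].
apply: integrableMl => //.
by exists M; split; rewrite ?num_real // => N MN x _ /=; rewrite (le_trans (Mphi x))// ltW.
Qed.

Lemma integrable_mul_prodf g a b F : smc_box a b F -> mu.-integrable setT (EFin \o g) ->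
  mu.-integrable setT (EFin \o (fun x => g x * prodf F x)).
Proof.
move=> sF ig; have [M _ HM] := prodf_bounded sF.
by apply: (integrable_mul_bounded ig (measurable_prodf sF) HM).
Qed.

Lemma prodf_bumps_le1 a b c x : 0 < c -> prodf (bumps a b c) x <= 1.
Proof.
move=> c0; rewrite /prodf; apply: prodr_ile1 => i _.
by rewrite cbump_ge0 cbump_le1.
Qed.

(** Bumps with parameter 1/(n+1) converge to the indicator of the open box, dominated by 1, so |g|
    dominates the integrands. *)
Lemma integral_obox0 g a b : mu.-integrable setT (EFin \o g) ->
  (forall F, smc_box a b F -> \int[mu]_x (g x * prodf F x) = 0) ->
  (\int[mu]_(x in obox a b) (g x)%:E = 0)%E.
Proof.
move=> ig H0.
have mg : measurable_fun setT g by apply/measurable_EFinP; case/integrableP : ig.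
have n0 n : 0 < n.+1%:R^-1 :> R by rewrite invr_gt0.
pose f_ n (x : 'rV[R]_d) := (g x * prodf (bumps a b n.+1%:R^-1) x)%:E.
have [] := @dominated_convergence _ _ _ mu setT measurableT f_
  (fun x => (g x * \1_(obox a b) x)%:E) (fun x => `|g x|%:E).
- by move=> n; apply/measurable_EFinP; apply: measurable_funM => //; exact: (measurable_prodf (smc_bumps a b (n0 n))).
- apply/measurable_EFinP; apply: measurable_funM => //; apply: measurable_indic; exact: measurable_obox.
- apply: aeW => x _; apply: cvg_EFin; first exact: nearW.
  by apply: cvgMr; exact: prodf_bumps_cvg.
- exact: integrable_abse ig.
- apply: aeW => x n _; rewrite lee_fin normrM ler_piMr//.
  by rewrite ger0_norm ?prodf_bumps_ge0// prodf_bumps_le1.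
move=> _ _.
have -> : (fun n => \int[mu]_x f_ n x)%E = cst 0%E.
  apply/funext => n; have sF := smc_bumps a b (n0 n).
  rewrite /= -[RHS]/(0%:E) -(H0 _ sF) /Rintegral fineK//.
  by apply: integrable_fin_num => //; exact: (integrable_mul_prodf sF ig).
move=> /(cvg_unique (@ereal_hausdorff _)) /(_ (cvg_cst _)) E.
rewrite integral_mkcond -[RHS]E; apply: eq_integral => x _.
by rewrite patchE indicE; case: ifPn => _; rewrite ?mulr1// mulr0.
Qed.

(** Restricted to the open box, g has integral 0 over every open box, since the intersection is an
    open box again and its closed companion lies in [box a b]. By Dynkin's theorem the integral
    vanishes on all measurable sets. *)
Lemma ae0_obox g a b : mu.-integrable setT (EFin \o g) ->
  (forall c e, box c e `<=` box a b -> (\int[mu]_(x in obox c e) (g x)%:E = 0)%E) ->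
  {ae mu, forall x, obox a b x -> g x = 0}.
Proof.
move=> ig H0; pose gU := g \_ (obox a b).
have igU : mu.-integrable setT (EFin \o gU).
  rewrite /gU -restrict_EFin; apply/(integrable_mkcond _ (measurable_obox a b)).
  by apply: integrableS ig => //; exact: measurable_obox.
have igA A : measurable A -> mu.-integrable A (EFin \o gU).
  by move=> mA; apply: integrableS igU.
have P0 : (\int[mu]_x (gU x)%:E = 0)%E.
  rewrite -(H0 a b)// [in RHS]integral_mkcond; apply: eq_integral => x _.
  by rewrite restrict_EFin.
have all0 A : measurable A -> (\int[mu]_(x in A) (gU x)%:E = 0)%E.
  move=> mA; rewrite measurable_oboxes in mA.
  apply: (@dynkin_induction _ _ _ (fun A => (\int[mu]_(x in A) (gU x)%:E = 0)%E)
    measurable_oboxes oboxes_setI_closed _ _ _ _ _ mA) => //.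
  - move=> _ [[c e] _ <-] /=.
    transitivity (\int[mu]_(x in obox c e `&` obox a b) (g x)%:E)%E.
      by rewrite integral_mkcondr; apply: eq_integral => x _; rewrite /gU /patch; case: ifP.
    rewrite oboxI; apply: H0 => x H i; have := H i.
    by rewrite !mxE ge_max le_min => /andP[/andP[_ ->] /andP[_ ->]].
  - move=> S mS S0.
    have : (\int[mu]_(x in S `|` ~` S) (gU x)%:E = 0)%E by rewrite setUv.
    rewrite integral_setU//; last 3 first.
    + exact: measurableC.
    + by rewrite setUv; case/integrableP : igU.
    + by apply/disj_setPS => x [].
    by rewrite S0 add0e.
  - move=> F mF tF F0; rewrite integral_bigcup//; last by apply: igA; exact: bigcupT_measurable.
    by rewrite eseries0// => n _ _; exact: F0.
have := @integral_ae_eq _ _ _ mu setT measurableT (cst 0%E) (EFin \o gU) igU (measurable_cst _).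
have E0 : forall E, E `<=` setT -> measurable E ->
    (\int[mu]_(x in E) (EFin \o gU) x = \int[mu]_(x in E) cst 0 x)%E.
  by move=> E _ mE; rewrite integral0; exact: all0.
move=> /(_ E0); apply: filterS => x /(_ I) /= [gx] abx.
by move: gx; rewrite /gU patchE mem_set.
Qed.

Lemma ae_forall_countable (T : countType) (P : T -> 'rV[R]_d -> Prop) :
  (forall t, {ae mu, forall x, P t x}) -> {ae mu, forall x t, P t x}.
Proof.
move=> H; have : {ae mu, forall x n, if unpickle n is Some t then P t x else True}.
  by apply: ae_foralln => n; case: (unpickle n) => // ; exact: aeW.
by apply: filterS => x Hx t; have := Hx (pickle t); rewrite pickleK.
Qed.

Lemma fundamental_lemma g (O : set 'rV[R]_d) : open O -> mu.-integrable setT (EFin \o g) ->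
  (forall a b F, smc_box a b F -> box a b `<=` O -> \int[mu]_x (g x * prodf F x) = 0) ->
  {ae mu, forall x, O x -> g x = 0}.
Proof.
move=> oO ig H0; have [B OB] := open_rat_boxes oO.
have H p : {ae mu, forall x, box (B p).1 (B p).2 `<=` O -> obox (B p).1 (B p).2 x -> g x = 0}.
  have [BO|nBO] := pselect (box (B p).1 (B p).2 `<=` O); last by apply: aeW.
  apply: filterS (ae0_obox (a := (B p).1) (b := (B p).2) ig _) => [x H _ //|c e ceB].
  by apply: integral_obox0 => // F sF; apply: H0 sF _; exact: subset_trans BO.
have {H} := ae_forall_countable H.
apply: filterS => x H Ox; have [p /= pO xp] := OB x Ox; exact: H pO xp.
Qed.

End fundamental_lemma.

(** * Convexity estimate on an interval *)

Section one_dimensional.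
Context {R : realType}.

Lemma second_derivative_convex_ineq (G G1 G2 : R -> R) (t : R) :
  (forall s : R, is_derive s 1 G (G1 s)) -> (forall s : R, is_derive s 1 G1 (G2 s)) ->
  (forall s, 0 <= s <= 1 -> 0 <= G2 s) -> 0 <= t <= 1 ->
  G t <= (1 - t) * G 0 + t * G 1.
Proof.
move=> D1 D2 G2_ge0 /andP[t0 t1].
have E1 : 'D_1 G = G1 by apply/funext => s; have [] := D1 s.
have cG x : {for x, continuous G}.
  by apply/differentiable_continuous/derivable1_diffP; case: (D1 x).
have t'0 : 0 <= 1 - t by rewrite subr_ge0.
have t'1 : 1 - t <= 1 by rewrite gerBl.
have := @second_derivative_convex R G 0 1 _ _ _ _ _ (Itv01 t'0 t'1) ler01.
rewrite !convRE/= /unstable.onem !mulr0 add0r mulr1 opprB addrCA subrr addr0; apply.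
- move=> x /andP[x0 x1]; rewrite E1; have [_ ->] := D2 x; apply: G2_ge0.
  by rewrite !ltW.
- exact/cvg_at_left_filter/cG.
- exact/cvg_at_right_filter/cG.
- by move=> x _; case: (D1 x).
- by move=> x _; rewrite E1; case: (D2 x).
Qed.

(** Both m s^2 / 2 + G and m s^2 / 2 - G are convex on [0, 1]; the defect of s^2 from its chord is t
    (1 - t). *)
Lemma second_derivative_bound (G G1 G2 : R -> R) (m t : R) :
  (forall s : R, is_derive s 1 G (G1 s)) -> (forall s : R, is_derive s 1 G1 (G2 s)) ->
  (forall s, 0 <= s <= 1 -> `|G2 s| <= m) -> 0 <= t <= 1 ->
  `|G t - ((1 - t) * G 0 + t * G 1)| <= t * (1 - t) * m / 2.
Proof.
move=> D1 D2 G2m t01.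
have Q1 (s : R) : is_derive s 1 (fun x : R => m / 2 * x ^+ 2) (m * s).
  have := @is_deriveZ _ _ _ _ (m / 2) s 1 _ (@is_deriveX _ _ id 2 s 1 _ (is_derive_id s 1)).
  rewrite (_ : _ *: (_ *: _) = m * s) //.
  by rewrite /GRing.scale /= expr1; field.
have Q2 (s : R) : is_derive s 1 (fun x : R => m * x) m.
  by have := @is_deriveZ _ _ _ id m s 1 _ (is_derive_id s 1); rewrite /GRing.scale/= mulr1.
have sgn (e : R) : (forall s, 0 <= s <= 1 -> 0 <= m + e * G2 s) ->
    m / 2 * t ^+ 2 + e * G t <= (1 - t) * (m / 2 * 0 ^+ 2 + e * G 0) + t * (m / 2 * 1 ^+ 2 + e * G 1).
  move=> H.
  apply: (@second_derivative_convex_ineq (fun x => m / 2 * x ^+ 2 + e * G x)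
    (fun x => m * x + e * G1 x) (fun x => m + e * G2 x)) => //.
have H1 := sgn 1; have H2 := sgn (-1).
have {}H1 : m / 2 * t ^+ 2 + 1 * G t <= (1 - t) * (m / 2 * 0 ^+ 2 + 1 * G 0) + t * (m / 2 * 1 ^+ 2 + 1 * G 1).
  by apply: H1 => s /G2m; rewrite ler_norml => /andP[? _]; lra.
have {}H2 : m / 2 * t ^+ 2 + -1 * G t <= (1 - t) * (m / 2 * 0 ^+ 2 + -1 * G 0) + t * (m / 2 * 1 ^+ 2 + -1 * G 1).
  by apply: H2 => s /G2m; rewrite ler_norml => /andP[_ ?]; lra.
by rewrite ler_norml; apply/andP; split; nra.
Qed.
End one_dimensional.

Section Rintegral_sum.
Context d (T : measurableType d) (R : realType) (mu : {measure set T -> \bar R}).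

Lemma Rintegral_sum (I : Type) (r : seq I) (D : set T) (h : I -> T -> R) : measurable D ->
  (forall i, mu.-integrable D (EFin \o h i)) ->
  \int[mu]_(x in D) (\sum_(i <- r) h i x) = \sum_(i <- r) \int[mu]_(x in D) h i x.
Proof.
move=> mD ih; elim: r => [|i r IHr].
  by under eq_Rintegral do rewrite big_nil; rewrite big_nil /Rintegral integral0_eq.
under eq_Rintegral do rewrite big_cons; rewrite big_cons RintegralD ?IHr//.
rewrite (_ : _ \o _ = fun x => (\sum_(i <- r) (h i x)%:E)%E).
  by apply: integrable_sum => // j _; exact: ih.
by apply/funext => x /=; rewrite sumEFin.
Qed.

End Rintegral_sum.

Section translation.
Context {R : realType} {d : nat}.
Let mu := @lebesgue_rV R d.

Lemma ge0_integral_shift (f : 'rV[R]_d -> \bar R) v : measurable_fun setT f ->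
  (forall x, 0 <= f x)%E -> (\int[mu]_x f (x + v)%R = \int[mu]_x f x)%E.
Proof.
move=> mf f0.
transitivity (\int[pushforward mu (fun y : 'rV[R]_d => (y + v)%R)]_x f x)%E.
  by rewrite ge0_integral_pushforward//; exact: measurable_shift.
apply: eq_measure_integral; first exact: measurable_shift.
by move=> ? A mA _; exact: (lebesgue_rV_shift v mA).
Qed.

Lemma measurable_fun_shift (f : 'rV[R]_d -> R) v : measurable_fun setT f ->
  measurable_fun setT (fun x : 'rV[R]_d => f (x + v)).
Proof. by move=> mf; apply: (measurableT_comp mf); exact: measurable_shift. Qed.

Lemma integrable_shift (f : 'rV[R]_d -> R) v : mu.-integrable setT (EFin \o f) ->
  mu.-integrable setT (EFin \o (fun x => f (x + v))).
Proof.
move=> /integrableP[mf foo]; apply/integrableP; split.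
  by apply/measurable_EFinP; apply: measurable_fun_shift; apply/measurable_EFinP.
have := @ge0_integral_shift (fun x => `|(f x)%:E|)%E v _ _ => -> //.
exact: measurableT_comp.
Qed.

Lemma Rintegral_shift (f : 'rV[R]_d -> R) v : mu.-integrable setT (EFin \o f) ->
  \int[mu]_x f (x + v) = \int[mu]_x f x.
Proof.
move=> intf; rewrite /Rintegral; congr fine.
transitivity (\int[pushforward mu (fun y : 'rV[R]_d => (y + v)%R)]_x (f x)%:E)%E.
  rewrite integral_pushforward//; first exact: measurable_shift.
  - by case/integrableP : intf.
  - by rewrite preimage_setT; exact: integrable_shift.
apply: eq_measure_integral; first exact: measurable_shift.
by move=> ? A mA _; exact: (lebesgue_rV_shift v mA).
Qed.

End translation.

Section convolution.
Context {R : realType} {d : nat}.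
Let mu := @lebesgue_rV R d.
Implicit Types (a b v x : 'rV[R]_d) (g : 'rV[R]_d -> R).

Lemma integrable_mul_prodf_shift g a b F v : smc_box a b F -> mu.-integrable setT (EFin \o g) ->
  mu.-integrable setT (EFin \o (fun x => g x * prodf F (x - v))).
Proof.
move=> sF ig; have := integrable_mul_prodf (smc_box_shift v sF) ig.
by congr (mu.-integrable _ (_ \o _)); apply/funext => x; rewrite prodf_shift.
Qed.

(** The translation sits in the smooth factor, so g has only to be integrable: C |g| dominates the
    derivative for all parameters. The result has the same form with F differentiated, hence the
    lemma can be iterated. *)
Lemma is_derive_conv g a b F v (s : R) : smc_box a b F -> mu.-integrable setT (EFin \o g) ->
  is_derive s 1 (fun t => \int[mu]_x (g x * prodf F (x - t *: v)))
    (- \sum_i v ord0 i * \int[mu]_x (g x * prodf (upd F i (derive1 (F i))) (x - s *: v))).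
Proof.
move=> sF ig.
have /choice[M HM] i : exists M, 0 <= M /\ forall x, `|prodf (upd F i (derive1 (F i))) x| <= M.
  by have [M M0 HM] := prodf_bounded (smc_box_upd i sF); exists M.
pose C := \sum_i `|v ord0 i| * M i.
have C0 : 0 <= C by rewrite sumr_ge0// => i _; rewrite mulr_ge0//; case: (HM i).
pose f (t : R) x := g x * prodf F (x - t *: v).
have Df (t : R) x : is_derive t 1 (f ^~ x)
    (g x * (- \sum_i v ord0 i * prodf (upd F i (derive1 (F i))) (x - t *: v))).
  exact: (is_deriveZ (g x) (is_derive_prodf_line v x t (fun i => (sF i).1))).
have d1f (t : R) x : partial1of2 f t x =
    g x * (- \sum_i v ord0 i * prodf (upd F i (derive1 (F i))) (x - t *: v)).
  by rewrite /partial1of2 derive1E; have [_] := Df t x.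
have sI : `]s - 1, s + 1[%classic s by rewrite /= in_itv/=; apply/andP; split; lra.
have intf t : `]s - 1, s + 1[%classic t -> mu.-integrable setT (EFin \o f t).
  by move=> _; exact: integrable_mul_prodf_shift sF ig.
have derf t x : `]s - 1, s + 1[%classic t -> [set: 'rV[R]_d] x -> derivable (f ^~ x) t 1.
  by move=> _ _; case: (Df t x).
have intG : mu.-integrable setT (EFin \o (fun x => C * `|g x|)).
  have -> : EFin \o (fun x => C * `|g x|) = (fun x => C%:E * `|(EFin \o g) x|)%E by [].
  exact/integrableZl/integrable_abse.
have G_ub t x : `]s - 1, s + 1[%classic t -> [set: 'rV[R]_d] x ->
    `|partial1of2 f t x| <= C * `|g x|.
  move=> _ _; rewrite d1f normrM mulrC ler_wpM2r// normrN (le_trans (ler_norm_sum _ _ _))//.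
  apply: ler_sum => i _; rewrite normrM ler_wpM2l//; have [_] := HM i; exact.
have G0 (x : 'rV[R]_d) : 0 <= C * `|g x| by rewrite mulr_ge0.
have D1 := @derivable_under_integral _ _ _ mu f setT measurableT s (s - 1) (s + 1) sI intf derf _ G0 intG G_ub.
have D2 := @differentiation_under_integral _ _ _ mu f setT measurableT s (s - 1) (s + 1) sI intf derf _ G0 intG G_ub.
apply: DeriveDef; first exact: D1.
rewrite -derive1E D2.
have iF i : mu.-integrable setT (EFin \o (fun x => v ord0 i * (g x * prodf (upd F i (derive1 (F i))) (x - s *: v)))).
  have := integrable_mul_prodf_shift (s *: v) (smc_box_upd i sF) ig.
  by move=> /(integrableZl measurableT (v ord0 i)).
transitivity (\int[mu]_x (- 1 * \sum_i v ord0 i * (g x * prodf (upd F i (derive1 (F i))) (x - s *: v)))).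
  apply: eq_Rintegral => x _; rewrite d1f mulN1r mulrN; congr (- _).
  by rewrite mulr_sumr; apply: eq_bigr => i _; rewrite mulrCA.
rewrite RintegralZl//; last first.
  rewrite (_ : _ \o _ = fun x => (\sum_i (v ord0 i * (g x * prodf (upd F i (derive1 (F i))) (x - s *: v)))%:E)%E).
    by apply: integrable_sum => // j _; exact: iF.
  by apply/funext => x /=; rewrite sumEFin.
rewrite mulN1r Rintegral_sum//; congr (- _); apply: eq_bigr => i _.
by rewrite RintegralZl//; exact: integrable_mul_prodf_shift (smc_box_upd i sF) ig.
Qed.

Lemma derive1_shift (f : R -> R) (c y : R) : smf f ->
  derive1 (fun z : R => f (z - c)) y = derive1 f (y - c).
Proof.
move=> sf; have [_ <-] := smf_is_derive1 (y - c) sf.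
have D := @is_derive1_comp _ f (fun z : R => z - c) y _ _ (smf_is_derive1 (y - c) sf)
  (is_deriveB (is_derive_id y 1) (is_derive_cst c y 1)).
by rewrite derive1E; have [_ ->] := D; rewrite subr0 mulr1 derive1E.
Qed.

Lemma upd_shiftf F v i : (forall j, smf (F j)) ->
  upd (shiftf F v) i (derive1 (shiftf F v i)) = shiftf (upd F i (derive1 (F i))) v.
Proof.
move=> sF; apply/funext => j; apply/funext => y; rewrite /upd /shiftf.
by case: eqVneq => // ->; rewrite derive1_shift.
Qed.

Lemma int_bumps_gt0 a b c : 0 < c -> (forall i, a ord0 i < b ord0 i) ->
  0 < \int[mu]_x prodf (bumps a b c) x.
Proof.
move=> c0 ab; have sF := smc_bumps a b c0.
rewrite lt_neqAle Rintegral_ge0 ?andbT => [|x _]; last exact: prodf_bumps_ge0.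
apply/eqP => I0.
(* The middle third of the box has positive measure and the bump is positive on it, which
   contradicts a vanishing integral. *)
pose a' : 'rV[R]_d := \row_i ((2 * a ord0 i + b ord0 i) / 3).
pose b' : 'rV[R]_d := \row_i ((a ord0 i + 2 * b ord0 i) / 3).
have mp : measurable_fun setT (EFin \o prodf (bumps a b c)).
  by apply/measurable_EFinP; exact: measurable_prodf sF.
have fin : (\int[mu]_x (prodf (bumps a b c) x)%:E)%E \is a fin_num.
  have boxfin : (mu (box a b) < +oo)%E.
    by rewrite /mu lebesgue_rV_box ?ltry// => i; exact: ltW.
  rewrite ge0_fin_numE; last by apply: integral_ge0 => x _; rewrite lee_fin prodf_bumps_ge0.
  apply: le_lt_trans boxfin.
  rewrite -[leRHS]mul1e -integral_cst; last exact: measurable_box.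
  rewrite [leRHS]integral_mkcond; apply: ge0_le_integral => //.
  - by move=> x _; rewrite lee_fin prodf_bumps_ge0.
  - by apply/(measurable_restrictT _ _).1 => //; exact: measurable_box.
  - move=> x _; rewrite patchE; case: ifPn => [_|]; first by rewrite lee_fin prodf_bumps_le1.
    by rewrite notin_setE => xab; rewrite (prodf_out sF xab).
have I0' : (\int[mu]_x `|(prodf (bumps a b c) x)%:E| = 0)%E.
  rewrite -[RHS]/(0%:E) I0 /Rintegral fineK//; apply: eq_integral => x _.
  by rewrite gee0_abs// lee_fin prodf_bumps_ge0.
have [N [mN N0 NS]] := (ae_eq_integral_abs mu measurableT mp).1 I0'.
have bN : box a' b' `<=` N.
  move=> x xab; apply: NS => /= /(_ I) [] /eqP.
  apply/negP; rewrite gt_eqF// prodf_bumps_gt0// => i.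
  have := xab i; have := ab i; rewrite !mxE => ? /andP[? ?]; apply/andP; split; lra.
have : (mu (box a' b') <= mu N)%E.
  by apply: le_measure => //; rewrite inE//; exact: measurable_box.
rewrite N0 /mu lebesgue_rV_box => [|i]; last by rewrite !mxE; have := ab i; lra.
apply/negP; rewrite -ltNge lte_fin prodr_gt0// => i _; rewrite !mxE; have := ab i; lra.
Qed.

End convolution.

Section weak_derivatives.
Context {R : realType} {d : nat}.
Let mu := @lebesgue_rV R d.
Implicit Types (a b v x y : 'rV[R]_d) (g u w phi : 'rV[R]_d -> R) (U : set 'rV[R]_d).

(* Weak derivatives on U, tested only against products of one-variable functions. *)
Definition weak_box U i u w : Prop := forall a b F, smc_box a b F -> box a b `<=` U ->
  \int[mu]_x (u x * prodf (upd F i (derive1 (F i))) x) = - \int[mu]_x (w x * prodf F x).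

Lemma integrable_prodf a b F : smc_box a b F -> mu.-integrable setT (EFin \o prodf F).
Proof.
move=> sF; have mb : measurable (box a b) by exact: measurable_box.
have ib : mu.-integrable setT (EFin \o (\1_(box a b) : 'rV[R]_d -> R)).
  apply/integrableP; split.
    by apply/measurable_EFinP; exact: measurable_indic.
  rewrite (eq_integral (fun x => (\1_(box a b) x)%:E)); last first.
    by move=> x _; rewrite /= ger0_norm.
  rewrite integral_indic// setIT.
  have [ab|/existsNP[i /negP]] := pselect (forall i, a ord0 i <= b ord0 i).
    suff : (lebesgue_rV d (box a b) < +oo)%E by [].
    by rewrite lebesgue_rV_box ?ltry.
  by rewrite -ltNge => /box_eq0 ->; rewrite measure0.
have := integrable_mul_prodf sF ib; congr (mu.-integrable _ (_ \o _)).
apply/funext => x; rewrite indicE; have [xab|xab] := boolP (x \in box a b).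
  by rewrite mul1r.
by rewrite mul0r (prodf_out sF)//; move: xab; rewrite notin_setE.
Qed.

Lemma norm_int_le g phi (m : R) : 0 <= m -> mu.-integrable setT (EFin \o (fun x => g x * phi x)) ->
  mu.-integrable setT (EFin \o phi) -> (forall x, 0 <= phi x) ->
  {ae mu, forall x, phi x != 0 -> `|g x| <= m} ->
  `|\int[mu]_x (g x * phi x)| <= m * \int[mu]_x phi x.
Proof.
move=> m0 ig iphi phi0 gm.
have imphi : mu.-integrable setT (EFin \o (fun x => m * phi x)).
  exact: (integrableZl measurableT m iphi).
rewrite -RintegralZl// (le_trans (le_normr_Rintegral _ _))//.
have iga : mu.-integrable setT (EFin \o (fun x => `|g x * phi x|)).
  exact: integrable_abse ig.
rewrite /Rintegral fine_le//.
- exact: (integrable_fin_num measurableT iga).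
- exact: (integrable_fin_num measurableT imphi).
have f10 x : [set: 'rV[R]_d] x -> (0 <= (`|g x * phi x|)%:E)%E by rewrite lee_fin.
have f20 x : [set: 'rV[R]_d] x -> (0 <= (m * phi x)%:E)%E by rewrite lee_fin mulr_ge0.
apply: (ae_ge0_le_integral measurableT f10 (measurable_int _ iga) f20 (measurable_int _ imphi)).
apply: filterS gm => x gm _; rewrite lee_fin normrM (ger0_norm (phi0 x)).
have [->|p0] := eqVneq (phi x) 0; first by rewrite !mulr0.
by rewrite ler_wpM2r// gm.
Qed.

Lemma is_derive_lincomb n (c : 'I_n -> R) (h : 'I_n -> R -> R) (h' : 'I_n -> R) (s : R) :
  (forall i, is_derive s 1 (h i) (h' i)) ->
  is_derive s 1 (fun t => - \sum_i c i * h i t) (- \sum_i c i * h' i).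
Proof.
move=> D; rewrite (_ : (fun t => _) = - \sum_i (c i *: h i)); last first.
  by apply/funext => t; rewrite -[RHS]/(- ((\sum_i (c i *: h i)) t)) fct_sumE.
by apply: is_deriveN; apply: is_derive_sum => i; exact: is_deriveZ.
Qed.

Lemma Rintegral_prodf_shift a b F v : smc_box a b F ->
  \int[mu]_x prodf F (x - v) = \int[mu]_x prodf F x.
Proof. by move=> sF; rewrite (Rintegral_shift (- v) (integrable_prodf sF)). Qed.

Lemma prodf_neq0_box a b F x : smc_box a b F -> prodf F x != 0 -> box a b x.
Proof. by move=> sF; apply: contra_neqP => xab; rewrite (prodf_out sF xab). Qed.

(** The mollified values g approximate I times the values of u, each within eta I / 2. The
    intermediate point costs one such error and the convex combination of the end points another,
    which makes eta after division by I. *)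
Lemma segment_combine (I t m eta g0 g1 gt u0 u1 ut : R) : 0 < I -> 0 <= t <= 1 ->
  `|gt - ((1 - t) * g0 + t * g1)| <= t * (1 - t) * (m * I) / 2 ->
  `|g0 - u0 * I| <= eta / 2 * I -> `|g1 - u1 * I| <= eta / 2 * I ->
  `|gt - ut * I| <= eta / 2 * I ->
  `|ut - ((1 - t) * u0 + t * u1)| <= t * (1 - t) * m / 2 + eta.
Proof.
move=> I0 /andP[t0 t1] main N0 N1 Nt.
have t1' : 0 <= 1 - t by rewrite subr_ge0.
rewrite -(ler_pM2r I0) -[X in `|_| * X](gtr0_norm I0) -normrM.
have -> : (ut - ((1 - t) * u0 + t * u1)) * I =
  (gt - ((1 - t) * g0 + t * g1)) - (gt - ut * I)
  + ((1 - t) * (g0 - u0 * I) + t * (g1 - u1 * I)) by ring.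
rewrite (le_trans (ler_normD _ _))// (le_trans (lerD (ler_normB _ _) (ler_normD _ _)))//.
rewrite !normrM (ger0_norm t0) (ger0_norm t1').
have M0 := ler_wpM2l t1' N0; have M1 := ler_wpM2l t0 N1.
apply: (le_trans (lerD (lerD main Nt) (lerD M0 M1))).
by rewrite le_eqVlt; apply/orP; left; apply/eqP; field.
Qed.

Section segment.
Variables (U : set 'rV[R]_d) (u : 'rV[R]_d -> R) (W : 'I_d -> 'rV[R]_d -> R)
  (H : 'I_d -> 'I_d -> 'rV[R]_d -> R) (v : 'rV[R]_d) (m : R).
Hypothesis oU : open U.
Hypothesis cvxU : forall y z (s : R), U y -> U z -> 0 <= s <= 1 -> U ((1 - s) *: y + s *: z).
Hypothesis cu : forall x, U x -> {for x, continuous u}.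
Hypothesis iu : mu.-integrable setT (EFin \o u).
Hypothesis iW : forall i, mu.-integrable setT (EFin \o W i).
Hypothesis iH : forall i j, mu.-integrable setT (EFin \o H i j).
Hypothesis uW : forall i, weak_box U i u (W i).
Hypothesis WH : forall i j, weak_box U i (W j) (H i j).
Hypothesis m0 : 0 <= m.
Hypothesis Hm : {ae mu, forall x, U x ->
  `|\sum_i \sum_j v ord0 i * v ord0 j * H i j x| <= m}.

Let d2 (F : 'I_d -> R -> R) (i j : 'I_d) := upd (upd F i (derive1 (F i))) j (derive1 (upd F i (derive1 (F i)) j)).

(** Two integrations by parts move both derivatives from the test function to u. What remains is the
    average of v^T H v against the translated bump, supported in U. *)
Lemma mollified_second_derivative a b F (s : R) : smc_box a b F ->
  (forall x, 0 <= prodf F x) -> box (a + s *: v) (b + s *: v) `<=` U ->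
  `|\sum_i v ord0 i * \sum_j v ord0 j * \int[mu]_x (u x * prodf (d2 F i j) (x - s *: v))|
    <= m * \int[mu]_x prodf F x.
Proof.
move=> sF F0 sU; have sFs := smc_box_shift (s *: v) sF.
set Fs := shiftf F (s *: v) in sFs.
have E i j : \int[mu]_x (u x * prodf (d2 F i j) (x - s *: v)) = \int[mu]_x (H i j x * prodf Fs x).
  transitivity (\int[mu]_x (u x * prodf (d2 Fs i j) x)).
    apply: eq_Rintegral => x _; rewrite -prodf_shift; congr (_ * prodf _ _).
    rewrite /d2 /Fs upd_shiftf => [|k]; last by case: (sF k).
    by rewrite upd_shiftf// => k; case: (smc_box_upd i sF k).
  rewrite (uW j (smc_box_upd i sFs) sU).
  by rewrite (WH i j sFs sU) opprK.
have iHF i j : mu.-integrable setT (EFin \o (fun x => H i j x * prodf Fs x)).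
  exact: (integrable_mul_prodf sFs).
have iS i : mu.-integrable setT (EFin \o (fun x => \sum_j v ord0 j * (H i j x * prodf Fs x))).
  rewrite (_ : _ \o _ = fun x => (\sum_j (v ord0 j * (H i j x * prodf Fs x))%:E)%E).
    apply: integrable_sum => // j _.
    exact: (integrableZl measurableT (v ord0 j) (iHF i j)).
  by apply/funext => x /=; rewrite sumEFin.
have SE x : (\sum_i \sum_j v ord0 i * v ord0 j * H i j x) * prodf Fs x =
    \sum_i v ord0 i * \sum_j v ord0 j * (H i j x * prodf Fs x).
  rewrite mulr_suml; apply: eq_bigr => i _; rewrite mulr_suml mulr_sumr.
  by apply: eq_bigr => j _; rewrite !mulrA.
rewrite (_ : \sum_i _ = \int[mu]_x ((\sum_i \sum_j v ord0 i * v ord0 j * H i j x) * prodf Fs x)).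
  rewrite -(Rintegral_prodf_shift (s *: v) sF).
  rewrite [X in _ <= m * X](_ : _ = \int[mu]_x prodf Fs x); last first.
    by apply: eq_Rintegral => x _; rewrite prodf_shift.
  apply: norm_int_le => //.
  - rewrite (_ : _ \o _ = fun x => (\sum_i (v ord0 i * \sum_j v ord0 j * (H i j x * prodf Fs x))%:E)%E).
      apply: integrable_sum => // i _.
      exact: (integrableZl measurableT (v ord0 i) (iS i)).
    by apply/funext => x /=; rewrite sumEFin SE.
  - exact: integrable_prodf sFs.
  - by move=> x; rewrite prodf_shift.
  - by apply: filterS Hm => x Hx p0; apply: Hx; apply: sU; exact: prodf_neq0_box p0.
under [RHS]eq_Rintegral do rewrite SE.
rewrite Rintegral_sum//; last first.
  by move=> i; exact: (integrableZl measurableT (v ord0 i) (iS i)).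
apply: eq_bigr => i _; rewrite RintegralZl// Rintegral_sum//; last first.
  by move=> j; exact: (integrableZl measurableT (v ord0 j) (iHF i j)).
by congr (_ * _); apply: eq_bigr => j _; rewrite RintegralZl// E.
Qed.

Lemma open_box_at U' z : open U' -> U' z -> exists2 e : R, 0 < e &
  forall e', 0 < e' <= e -> box (z - const_mx e') (z + const_mx e') `<=` U'.
Proof.
move=> oU' Uz; have /nbhs_ballP[e /= e0 eU] := open_nbhs_nbhs (conj oU' Uz).
exists (e / 2); first by rewrite divr_gt0.
move=> e' /andP[e'0 e'e] y yz; apply: eU; split => // i j; rewrite ord1.
have := yz j; rewrite !mxE /ball/= ltr_distlC => /andP[? ?]; apply/andP; split; lra.
Qed.

Lemma continuous_box_at z (eta : R) : {for z, continuous u} -> 0 < eta -> exists2 e : R, 0 < e &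
  forall e', 0 < e' <= e -> forall y, box (z - const_mx e') (z + const_mx e') y -> `|u y - u z| <= eta.
Proof.
move=> /cvgrPdist_le cz eta0.
have /nbhs_ballP[e /= e0 eU] := cz _ eta0.
exists (e / 2); first by rewrite divr_gt0.
move=> e' /andP[e'0 e'e] y yz; rewrite distrC; apply: eU; split => // i j; rewrite ord1.
have := yz j; rewrite !mxE /ball/= ltr_distlC => /andP[? ?]; apply/andP; split; lra.
Qed.

(* With phi a bump at x, G(s) = \int u phi(. - s v) is twice differentiable and
   |G''| <= m \int phi on [0, 1]; the estimate follows by shrinking the bump. *)
Lemma segment_estimate x (t : R) : U x -> U (x + v) -> 0 <= t <= 1 ->
  `|u (x + t *: v) - ((1 - t) * u x + t * u (x + v))| <= t * (1 - t) * m / 2.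
Proof.
move=> Ux Uxv t01; have /andP[t0 t1] := t01.
have Uxt : U (x + t *: v).
  have -> : x + t *: v = (1 - t) *: x + t *: (x + v).
    by rewrite scalerDr addrA -scalerDl subrK scale1r.
  exact: cvxU.
apply/ler_addgt0Pr => eta eta0.
have [e1 e10 H1] := open_box_at oU Ux; have [e2 e20 H2] := open_box_at oU Uxv.
have eta20 : 0 < eta / 2 by rewrite divr_gt0.
have [e3 e30 H3] := continuous_box_at (cu Ux) eta20.
have [e4 e40 H4] := continuous_box_at (cu Uxv) eta20.
have [e5 e50 H5] := continuous_box_at (cu Uxt) eta20.
(* One radius for all demands: the bumps at both end points lie in U, and u varies by at most eta /
   2 over the bumps at x, x + v and x + t v. *)
pose e := Num.min e1 (Num.min e2 (Num.min e3 (Num.min e4 e5))).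
have e0 : 0 < e by rewrite !lt_min e10 e20 e30 e40 e50.
have L1 : 0 < e <= e1 by rewrite e0 /e !ge_min lexx.
have L2 : 0 < e <= e2 by rewrite e0 /e !ge_min lexx !orbT.
have L3 : 0 < e <= e3 by rewrite e0 /e !ge_min lexx !orbT.
have L4 : 0 < e <= e4 by rewrite e0 /e !ge_min lexx !orbT.
have L5 : 0 < e <= e5 by rewrite e0 /e !ge_min lexx !orbT.
have {L1}H1 := H1 e L1; have {L2}H2 := H2 e L2; have {L3}H3 := H3 e L3.
have {L4}H4 := H4 e L4; have {L5}H5 := H5 e L5.
clearbody e.
set a := x - const_mx e in H1 H3; set b := x + const_mx e in H1 H3.
have ab i : a ord0 i < b ord0 i by rewrite !mxE; lra.
have sF := smc_bumps a b ltr01; set F := bumps a b 1 in sF.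
have F0 y : 0 <= prodf F y by exact: prodf_bumps_ge0.
set I := \int[mu]_x prodf F x; have I0 : 0 < I by exact: int_bumps_gt0.
pose G (s : R) := \int[mu]_x (u x * prodf F (x - s *: v)).
pose G1 (s : R) := - \sum_i v ord0 i * \int[mu]_x (u x * prodf (upd F i (derive1 (F i))) (x - s *: v)).
pose G2 (s : R) := - \sum_i v ord0 i * (- \sum_j v ord0 j * \int[mu]_x (u x * prodf (d2 F i j) (x - s *: v))).
have D1 (s : R) : is_derive s 1 G (G1 s) by exact: is_derive_conv sF iu.
have D2 (s : R) : is_derive s 1 G1 (G2 s).
  by apply: is_derive_lincomb => i; exact: (is_derive_conv v s (smc_box_upd i sF) iu).
have G2m (s : R) : 0 <= s <= 1 -> `|G2 s| <= m * I.
  move=> s01; rewrite /G2; under eq_bigr do rewrite mulrN; rewrite sumrN opprK.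
  apply: mollified_second_derivative => // y yb.
  (* A point of the bump translated by s v lies on the segment between a point near x and a point
     near x + v; convexity of U keeps it inside. *)
  have -> : y = (1 - s) *: (y - s *: v) + s *: (y - s *: v + v).
    by apply/rowP => k; rewrite !mxE; ring.
  apply: cvxU => //; [apply: H1|apply: H2] => i; have := yb i; rewrite !mxE => /andP[? ?]; apply/andP; split; lra.
have main := second_derivative_bound D1 D2 G2m t01.
have near_u (s : R) : (forall y, box (x + s *: v - const_mx e) (x + s *: v + const_mx e) y ->
    `|u y - u (x + s *: v)| <= eta / 2) -> `|G s - u (x + s *: v) * I| <= eta / 2 * I.
  move=> Hs; rewrite /I -(Rintegral_prodf_shift (s *: v) sF) /G.
  have iFs : mu.-integrable setT (EFin \o (fun y => prodf F (y - s *: v))).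
    exact: (integrable_shift (- (s *: v)) (integrable_prodf sF)).
  have iuF := integrable_mul_prodf_shift (s *: v) sF iu.
  have icF : mu.-integrable setT (EFin \o (fun y => u (x + s *: v) * prodf F (y - s *: v))).
    exact: (integrableZl measurableT (u (x + s *: v)) iFs).
  rewrite -RintegralZl// -RintegralB//.
  rewrite (_ : \int[mu]_y _ = \int[mu]_y ((u y - u (x + s *: v)) * prodf F (y - s *: v))); last first.
    by apply: eq_Rintegral => y _; rewrite mulrBl.
  apply: norm_int_le => //; first exact: ltW.
    have := integrableB measurableT iuF icF; congr (mu.-integrable _ _).
    by apply/funext => y /=; rewrite mulrBl EFinB.
  apply: aeW => y p0; apply: Hs => i; have := prodf_neq0_box sF p0 i.
  by rewrite !mxE => /andP[? ?]; apply/andP; split; lra.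
have N0 : `|G 0 - u x * I| <= eta / 2 * I.
  by have := near_u 0; rewrite scale0r addr0; apply.
have N1 : `|G 1 - u (x + v) * I| <= eta / 2 * I.
  by have := near_u 1; rewrite scale1r; apply.
have Nt := near_u t H5.
exact: (segment_combine I0 t01 main N0 N1 Nt).
Qed.

End segment.

End weak_derivatives.

(** * Weak directional derivatives as limits of difference quotients *)

Section directional_bound.
Context {R : realType} {d : nat}.
Let mu := @lebesgue_rV R d.
Implicit Types (a b v x y : 'rV[R]_d) (e w phi : 'rV[R]_d -> R) (U : set 'rV[R]_d).

(** Halving the step raises the quotient by 2 / t times the midpoint defect, hence by at most 2 m t;
    this is exactly what 4 m t loses when t is halved. *)
Lemma dyadic_step (t m e0 e1 e2 : R) : 0 < t -> e1 - (e0 + e2) / 2 <= m * t ^+ 2 ->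
  (t / 2)^-1 * (e1 - e0) + 4 * m * (t / 2) <= t^-1 * (e2 - e0) + 4 * m * t.
Proof.
move=> t0 H; rewrite -subr_ge0.
have -> : t^-1 * (e2 - e0) + 4 * m * t - ((t / 2)^-1 * (e1 - e0) + 4 * m * (t / 2)) =
  t^-1 * (2 * (m * t ^+ 2 - (e1 - (e0 + e2) / 2))) by field; rewrite gt_eqF.
by rewrite mulr_ge0 ?invr_ge0 ?(ltW t0)// mulr_ge0// subr_ge0.
Qed.

Section dyadic.
Variables (e : 'rV[R]_d -> R) (v : 'rV[R]_d) (delta L m : R) (y : 'rV[R]_d).
Hypothesis delta0 : 0 < delta.
Hypothesis m0 : 0 <= m.
Hypothesis eL : forall t, 0 <= t <= delta -> `|e (y + t *: v) - e y| <= L * t.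
Hypothesis e2 : forall t, 0 <= t <= delta ->
  `|e (y + (t / 2) *: v) - (e y + e (y + t *: v)) / 2| <= m * t ^+ 2.

Definition dquot (h : R) := h^-1 * (e (y + h *: v) - e y).

Let h n := delta / 2 ^+ n.

Let h_gt0 n : 0 < h n. Proof. by rewrite divr_gt0// exprn_gt0. Qed.

Let h_le n : 0 <= h n <= delta.
Proof.
rewrite ltW//= ler_pdivrMr ?exprn_gt0// ler_peMr ?(ltW delta0)//.
by rewrite exprn_ege1// ler1n.
Qed.

Let hS n : h n.+1 = h n / 2.
Proof. by rewrite /h exprS invfM mulrCA mulrC -mulrA. Qed.

Lemma dquot_bound t : 0 < t <= delta -> `|dquot t| <= L.
Proof.
move=> /andP[t0 td]; rewrite /dquot normrM normfV (gtr0_norm t0) ler_pdivrMl// mulrC.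
by apply: eL; rewrite ltW.
Qed.

(* h |-> dquot h + 4 m h decreases along halvings of h. *)
Lemma dquot_cvg : cvgn (fun n => dquot (h n)).
Proof.
have mono : nonincreasing_seq (fun n => dquot (h n) + 4 * m * h n).
  apply/nonincreasing_seqP => n; rewrite hS /dquot.
  have := e2 (h_le n); rewrite ler_norml => /andP[_ H].
  have hn := h_gt0 n; set t := h n in H hn *.
  exact: dyadic_step.
have h0 : h n @[n --> \oo] --> (0 : R).
  have := @cvg_geometric R delta (2^-1); rewrite ger0_norm// => /(_ _).
  rewrite invf_lt1// ltr1n => /(_ isT); rewrite /geometric/= /h.
  by under eq_cvg do rewrite exprVn.
have c1 : cvgn (fun n => dquot (h n) + 4 * m * h n).
  apply: nonincreasing_is_cvgn => //; exists (- L) => _ [n _ <-].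
  have := @dquot_bound (h n); rewrite h_gt0/= => /(_ _); have /andP[_ ->] := h_le n.
  move=> /(_ isT); rewrite ler_norml => /andP[H _].
  by rewrite (le_trans H)// lerDl !mulr_ge0// ltW.
have -> : (fun n => dquot (h n)) = (fun n => dquot (h n) + 4 * m * h n) - (fun n => 4 * m * h n).
  by apply/funext => n; rewrite fctE addrK.
apply: is_cvgB => //; apply: is_cvgMr; apply/cvg_ex; exists 0; exact: h0.
Qed.

End dyadic.

(** The bound on second differences makes the dyadic quotients converge at every point of U, the
    bound on first differences keeps the limit below L, and the fundamental lemma identifies the
    limit with the weak derivative. No classical differentiability of e enters. *)
Lemma directional_bound (e : 'rV[R]_d -> R) (W : 'I_d -> 'rV[R]_d -> R) v U (delta L m : R) :
  open U -> (mu U < +oo)%E -> 0 < delta -> 0 <= m -> 0 <= L ->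
  mu.-integrable setT (EFin \o e) ->
  (forall i, mu.-integrable setT (EFin \o W i)) ->
  (forall i, weak_box U i e (W i)) ->
  (forall y t, U y -> 0 <= t <= delta -> `|e (y + t *: v) - e y| <= L * t) ->
  (forall y t, U y -> 0 <= t <= delta ->
     `|e (y + (t / 2) *: v) - (e y + e (y + t *: v)) / 2| <= m * t ^+ 2) ->
  {ae mu, forall y, U y -> `|\sum_i v ord0 i * W i y| <= L}.
Proof.
move=> oU muU delta0 m0 L0 ie iW eW eL e2.
pose h n : R := delta / 2 ^+ n.
have h0 n : 0 < h n by rewrite divr_gt0// exprn_gt0.
have hd n : h n <= delta.
  rewrite ler_pdivrMr ?exprn_gt0// ler_peMr ?(ltW delta0)//.
  by rewrite exprn_ege1// ler1n.
have mU : measurable U by exact: open_measurable_rV.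
have me : measurable_fun setT e by apply/measurable_EFinP; case/integrableP : ie.
(* Cut off by U: the sequence converges at every point and is dominated by an integrable function,
   as U has finite measure. *)
pose q_ n y := dquot e v y (h n) * \1_U y.
have mq_ n : measurable_fun setT (q_ n).
  apply: measurable_funM; last exact: measurable_indic.
  apply: measurable_funM => //; apply: measurable_funB => //.
  exact: measurable_fun_shift.
have q_L n y : `|q_ n y| <= L * \1_U y.
  rewrite /q_ indicE; have [yU|yU] := boolP (y \in U); last by rewrite !mulr0 normr0.
  rewrite !mulr1; apply: (@dquot_bound e v delta L y) => //.
    by move=> t; apply: eL; rewrite inE in yU.
  by rewrite h0 hd.
have q_cvg y : cvgn (q_ ^~ y).
  rewrite /q_ indicE; have [yU|yU] := boolP (y \in U).
    rewrite inE in yU; under eq_fun do rewrite mulr1.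
    by apply: (@dquot_cvg e v delta L m y) => // t; [exact: eL|exact: e2].
  by under eq_fun do rewrite mulr0; exact: is_cvg_cst.
pose q y := limn (q_ ^~ y).
have q_q y : q_ n y @[n --> \oo] --> q y by exact: q_cvg.
have mq : measurable_fun setT q.
  by apply: (measurable_fun_cvg mq_) => y _; exact: q_q.
have qL y : `|q y| <= L * \1_U y.
  have C : `|q_ n y| @[n --> \oo] --> `|q y| by apply: cvg_norm; exact: q_q.
  rewrite -(cvg_lim _ C)//.
  apply: limr_le; first by apply: is_cvg_norm; exact: q_cvg.
  by apply: nearW => n; exact: q_L.
have iLU : mu.-integrable setT (fun y => (L * \1_U y)%:E).
  apply/integrableP; split.
    by apply/measurable_EFinP; apply: measurable_funM => //; exact: measurable_indic.
  under eq_integral do rewrite gee0_abs ?lee_fin ?mulr_ge0// EFinM.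
  rewrite ge0_integralZl//; last by apply/measurable_EFinP; exact: measurable_indic.
  by rewrite integral_indic// setIT lte_mul_pinfty// lee_fin.
have iq_ n : mu.-integrable setT (EFin \o q_ n).
  apply: le_integrable iLU => //; first exact/measurable_EFinP.
  by move=> y _; rewrite lee_fin (le_trans (q_L n y))// ler_norm.
have iq : mu.-integrable setT (EFin \o q).
  apply: le_integrable iLU => //; first exact/measurable_EFinP.
  by move=> y _; rewrite lee_fin (le_trans (qL y))// ler_norm.
pose g y := (\sum_i v ord0 i * W i y) - q y.
have iS : mu.-integrable setT (EFin \o (fun y => \sum_i v ord0 i * W i y)).
  rewrite (_ : _ \o _ = fun y => (\sum_i (v ord0 i * W i y)%:E)%E).
    apply: integrable_sum => // i _; exact: (integrableZl measurableT (v ord0 i) (iW i)).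
  by apply/funext => x /=; rewrite sumEFin.
have ig : mu.-integrable setT (EFin \o g).
  have := integrableB measurableT iS iq; congr (mu.-integrable _ _).
suff : {ae mu, forall y, U y -> g y = 0}.
  apply: filterS => y gy Uy; move/eqP: (gy Uy); rewrite subr_eq0 => /eqP ->.
  by have := qL y; rewrite indicE mem_set// mulr1.
apply: fundamental_lemma => // a b F sF bU.
have iqF : mu.-integrable setT (EFin \o (fun y => q y * prodf F y)) by exact: integrable_mul_prodf sF iq.
have iWF i : mu.-integrable setT (EFin \o (fun y => v ord0 i * (W i y * prodf F y))).
  exact: (integrableZl measurableT (v ord0 i) (integrable_mul_prodf sF (iW i))).
have -> : \int[mu]_x (g x * prodf F x) =
    \sum_i v ord0 i * \int[mu]_x (W i x * prodf F x) - \int[mu]_x (q x * prodf F x).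
  transitivity (\int[mu]_x ((\sum_i v ord0 i * (W i x * prodf F x)) - q x * prodf F x)).
    apply: eq_Rintegral => x _; rewrite mulrBl mulr_suml; congr (_ - _).
    by apply: eq_bigr => i _; rewrite mulrA.
  rewrite RintegralB//; last first.
    rewrite (_ : _ \o _ = fun y => (\sum_i (v ord0 i * (W i y * prodf F y))%:E)%E).
      by apply: integrable_sum => // i _; exact: iWF.
    by apply/funext => x /=; rewrite sumEFin.
  rewrite Rintegral_sum//; congr (_ - _); apply: eq_bigr => i _.
  by rewrite RintegralZl//; exact: integrable_mul_prodf sF (iW i).
apply/eqP; rewrite subr_eq0; apply/eqP.
(* Both sides are the limit of the integrals of q_ n against the test function. *)
pose G (s : R) := \int[mu]_x (e x * prodf F (x - s *: v)).
have DG : is_derive (0 : R) 1 G (\sum_i v ord0 i * \int[mu]_x (W i x * prodf F x)).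
  apply: (is_derive_eq (is_derive_conv v 0 sF ie)).
  rewrite -sumrN; apply: eq_bigr => i _; rewrite -mulrN; congr (_ * _).
  rewrite -[RHS]opprK -(eW i _ _ _ sF bU); congr (- _).
  by apply: eq_Rintegral => x _; rewrite scale0r subr0.
have lhs : \int[mu]_x (q_ n x * prodf F x) @[n --> \oo] -->
    \sum_i v ord0 i * \int[mu]_x (W i x * prodf F x).
  have qG n : \int[mu]_x (q_ n x * prodf F x) = (h n)^-1 * (G (h n) - G 0).
    transitivity (\int[mu]_x ((h n)^-1 * (e (x + h n *: v) * prodf F x - e x * prodf F x))).
      apply: eq_Rintegral => x _; rewrite /q_ indicE.
      have [xU|xU] := boolP (x \in U); first by rewrite mulr1 /dquot -mulrBl mulrA.
      rewrite (prodf_out sF) ?mulr0 ?subrr ?mulr0// => /bU.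
      by move: xU; rewrite notin_setE.
    have i1 : mu.-integrable setT (EFin \o (fun x => e (x + h n *: v) * prodf F x)).
      exact: integrable_mul_prodf sF (integrable_shift _ ie).
    have i2 : mu.-integrable setT (EFin \o (fun x => e x * prodf F x)) by exact: integrable_mul_prodf sF ie.
    rewrite RintegralZl//; last first.
      by have := integrableB measurableT i1 i2; congr (mu.-integrable _ _).
    rewrite RintegralB//; congr (_ * (_ - _)); last first.
      by apply: eq_Rintegral => x _; rewrite scale0r subr0.
    rewrite /G -(Rintegral_shift (h n *: v) (integrable_mul_prodf_shift (h n *: v) sF ie)).
    by apply: eq_Rintegral => x _; rewrite addrK.
  under eq_cvg do rewrite qG.
  have [dG eG] := DG; rewrite -eG.
  have cG : t^-1 * (G t - G 0) @[t --> 0^'] --> 'D_1 G 0.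
    rewrite (_ : (fun t => _) = (fun t : R => t^-1 *: ((G \o shift 0) (t *: (1 : R)) - G 0))); first exact: dG.
    by apply/funext => t; rewrite /= scaler1 addr0.
  have /cvgr_dnbhsP/(_ h) := cG; apply; split.
    by move=> n; rewrite gt_eqF.
  have := @cvg_geometric R delta (2^-1); rewrite ger0_norm// => /(_ _).
  rewrite invf_lt1// ltr1n => /(_ isT); rewrite /geometric/= /h.
  by under eq_cvg do rewrite exprVn.
have rhs : \int[mu]_x (q_ n x * prodf F x) @[n --> \oo] --> \int[mu]_x (q x * prodf F x).
  have [M M0 FM] := prodf_bounded sF.
  have iq_F n : mu.-integrable setT (EFin \o (fun y => q_ n y * prodf F y)) by exact: integrable_mul_prodf sF (iq_ n).
  have iM : mu.-integrable setT (fun y => (M * (L * \1_U y))%:E).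
    exact: (integrableZl measurableT M iLU).
  have [] := @dominated_convergence _ _ _ mu setT measurableT (fun n y => (q_ n y * prodf F y)%:E)
    (fun y => (q y * prodf F y)%:E) (fun y => (M * (L * \1_U y))%:E).
  - by move=> n; case/integrableP : (iq_F n).
  - by case/integrableP : iqF.
  - apply: aeW => y _; apply: cvg_EFin; first exact: nearW.
    by apply: cvgMl; exact: q_q.
  - exact: iM.
  - apply: aeW => y n _; rewrite lee_fin normrM mulrC ler_pM//; exact: q_L.
  by move=> _ _ C; apply: fine_cvg; rewrite /Rintegral fineK//; exact: integrable_fin_num.
exact: (cvg_unique _ lhs rhs).
Qed.

(** Integration by parts out of translation invariance. The integral of l against F(. - s v) is
    differentiated at s = 0 twice over: under the integral sign, and after moving the shift to l,
    where it is an explicit affine function of s. *)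
Lemma weak_box_affine U (A : set 'rV[R]_d) (c : 'rV[R]_d) c0 i : U `<=` A ->
  weak_box U i ((fun x => \sum_k c ord0 k * x ord0 k + c0) \_ A) (cst (c ord0 i)).
Proof.
move=> UA a b F sF bU.
pose l x := \sum_k c ord0 k * x ord0 k + c0.
(* Enlarged by 1 so that shifts of the support by |s| < 1 stay where g coincides with the affine
   function, while g remains integrable. *)
pose B := box (a - const_mx 1) (b + const_mx 1).
have mB : measurable B by exact: measurable_box.
pose g := l \_ B.
have abB : box a b `<=` B.
  by move=> x xab k; have := xab k; rewrite !mxE => /andP[? ?]; apply/andP; split; lra.
have muB : (mu B < +oo)%E.
  have [ab|/existsNP[k /negP]] :=
      pselect (forall k, (a - const_mx 1) ord0 k <= (b + const_mx 1) ord0 k).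
    by rewrite /mu /B lebesgue_rV_box ?ltry.
  by rewrite -ltNge => /box_eq0 ab0; rewrite /mu /B ab0 measure0.
have ml : measurable_fun setT l.
  by apply: measurable_funD => //; exact: measurable_linear.
have ig : mu.-integrable setT (EFin \o g).
  rewrite /g -restrict_EFin; apply/(integrable_mkcond _ mB).
  apply: measurable_bounded_integrable => //; first exact: measurable_funTS.
  exists (\sum_k `|c ord0 k| * (`|a ord0 k| + `|b ord0 k| + 1) + `|c0|); split; first exact: num_real.
  move=> M HM x xB /=; rewrite (le_trans _ (ltW HM))// (le_trans (ler_normD _ _))// lerD2r.
  rewrite (le_trans (ler_norm_sum _ _ _))//; apply: ler_sum => k _.
  rewrite normrM ler_wpM2l//; have := xB k; rewrite !mxE => /andP[H1 H2].
  have := ler_norm (- a ord0 k); have := ler_norm (b ord0 k); rewrite normrN => ? ?.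
  have := normr_ge0 (a ord0 k); have := normr_ge0 (b ord0 k) => ? ?.
  by rewrite ler_norml; apply/andP; split; lra.
pose v : 'rV[R]_d := delta_mx ord0 i.
pose G (s : R) := \int[mu]_x (g x * prodf F (x - s *: v)).
set Fi := upd F i (derive1 (F i)).
have sFi : smc_box a b Fi by exact: smc_box_upd.
have DG : is_derive (0 : R) 1 G (- \int[mu]_x (g x * prodf Fi x)).
  apply: (is_derive_eq (is_derive_conv v 0 sF ig)); congr (- _).
  rewrite (bigD1 i)//= big1 ?addr0 => [|k /negPf ki]; last by rewrite mxE ki andbF mul0r.
  by rewrite mxE !eqxx mul1r; apply: eq_Rintegral => x _; rewrite scale0r subr0.
have -> : \int[mu]_x ((l \_ A) x * prodf Fi x) = \int[mu]_x (g x * prodf Fi x).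
  apply: eq_Rintegral => x _; have [xab|xab] := pselect (box a b x).
    by rewrite /g !patchE !mem_set//; [exact: abB|exact/UA/bU].
  by rewrite (prodf_out sFi xab) !mulr0.
have iF := integrable_prodf sF.
have igF : mu.-integrable setT (EFin \o (fun x => g x * prodf F x)) by exact: integrable_mul_prodf sF ig.
set I := \int[mu]_x prodf F x.
have GE (s : R) : `|s| < 1 -> G s = \int[mu]_x (g x * prodf F x) + s * (c ord0 i * I).
  move=> s1; rewrite /G -(Rintegral_shift (s *: v) (integrable_mul_prodf_shift (s *: v) sF ig)).
  rewrite -RintegralZl// -RintegralZl//; last exact: (integrableZl measurableT (c ord0 i) iF).
  rewrite -RintegralD//; last first.
    have icF : mu.-integrable setT (EFin \o (fun x => c ord0 i * prodf F x)).
      exact: (integrableZl measurableT (c ord0 i) iF).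
    exact: (integrableZl measurableT s icF).
  apply: eq_Rintegral => x _; rewrite addrK.
  have [xab|xab] := pselect (box a b x); last by rewrite (prodf_out sF xab) !mulr0 addr0.
  rewrite /g !patchE !mem_set; [|exact: abB|]; last first.
    move=> k; have := xab k; rewrite !mxE eqxx/= => /andP[? ?].
    move: s1; rewrite ltr_norml => /andP[? ?].
    by case: eqVneq => _; rewrite ?mulr1 ?mulr0; apply/andP; split; lra.
  rewrite !mulrA -mulrDl; congr (_ * _); rewrite /l addrAC; congr (_ + _).
  under eq_bigr do rewrite !mxE mulrDr; rewrite big_split/=; congr (_ + _).
  rewrite (bigD1 i)//= big1 ?addr0 => [|k /negPf ki]; last by rewrite ki ?andbF !mulr0.
  by rewrite eqxx mulr1 mulrC.
have DG' : is_derive (0 : R) 1 G (c ord0 i * I).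
  have Dl : is_derive (0 : R) 1 (fun s : R => \int[mu]_x (g x * prodf F x) + s * (c ord0 i * I)) (c ord0 i * I).
    have Dm : is_derive (0 : R) 1 (fun s : R => s * (c ord0 i * I)) (c ord0 i * I).
      rewrite (_ : (fun s => _) = (c ord0 i * I) *: (id : R -> R)).
        by apply: (is_derive_eq (is_deriveZ _ (is_derive_id (0 : R) 1))); rewrite /GRing.scale/= mulr1.
      by apply/funext => s; rewrite /= mulrC.
    by apply: (is_derive_eq (is_deriveD (is_derive_cst (\int[mu]_x (g x * prodf F x)) (0 : R) 1) Dm)); rewrite add0r.
  apply: near_eq_is_derive Dl; apply/nbhs_ballP; exists 1 => //= s.
  by rewrite /ball/= sub0r normrN => s1; rewrite GE.
rewrite RintegralZl// -/I; have [_ E1] := DG; have [_ E2] := DG'.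
by rewrite -E2 E1 opprK.
Qed.

Lemma ae_weak_unique U i w1 w2 e : open U -> mu.-integrable setT (EFin \o w1) ->
  mu.-integrable setT (EFin \o w2) -> weak_box U i e w1 -> weak_box U i e w2 ->
  {ae mu, forall x, U x -> w1 x = w2 x}.
Proof.
move=> oU i1 i2 H1 H2.
have := @fundamental_lemma R d (fun x => w1 x - w2 x) U oU.
have ig : mu.-integrable setT (EFin \o (fun x => w1 x - w2 x)).
  by have := integrableB measurableT i1 i2; congr (mu.-integrable _ _).
move=> /(_ ig) H.
suff : {ae mu, forall x, U x -> w1 x - w2 x = 0}.
  by apply: filterS => x Hx /Hx /eqP; rewrite subr_eq0 => /eqP.
apply: H => a b F sF bU; under eq_Rintegral do rewrite mulrBl.
rewrite RintegralB//; [|exact: integrable_mul_prodf sF _..].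
by apply/eqP; rewrite subr_eq0 -eqr_opp -(H1 _ _ _ sF bU) -(H2 _ _ _ sF bU).
Qed.

End directional_bound.

(** * Simplices *)

Section barycentric.
Context {R : realType} {d : nat}.
Let mu := @lebesgue_rV R d.
Implicit Types (v : 'I_d.+1 -> 'rV[R]_d) (x y z : 'rV[R]_d).

Definition baryv v x : 'cV[R]_d := invmx (edge_mx v) *m (x - v ord0)^T.

Definition bary v x (k : 'I_d.+1) : R :=
  if unlift ord0 k is Some j then baryv v x j ord0 else 1 - \sum_j baryv v x j ord0.

Lemma bary0 v x : bary v x ord0 = 1 - \sum_j baryv v x j ord0.
Proof. by rewrite /bary unlift_none. Qed.

Lemma baryS v x j : bary v x (lift ord0 j) = baryv v x j ord0.
Proof. by rewrite /bary liftK. Qed.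

Lemma bary_sum v x : \sum_k bary v x k = 1.
Proof.
rewrite big_ord_recl bary0; under [X in _ + X]eq_bigr do rewrite baryS.
by rewrite subrK.
Qed.

Lemma comb_edge v (c : 'I_d.+1 -> R) : \sum_k c k = 1 ->
  \sum_k c k *: v k = v ord0 + (edge_mx v *m \col_j c (lift ord0 j))^T.
Proof.
move=> c1; apply/rowP => i; rewrite summxE big_ord_recl !mxE.
under [in LHS]eq_bigr do rewrite mxE.
under [in RHS]eq_bigr do rewrite !mxE mulrBl.
have -> : c ord0 = 1 - \sum_j c (lift ord0 j) by rewrite -c1 big_ord_recl addrK.
rewrite sumrB -mulr_sumr.
under [X in _ = _ + (X - _)]eq_bigr do rewrite mulrC.
by ring.
Qed.

Section nondegenerate.
Variable v : 'I_d.+1 -> 'rV[R]_d.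
Hypothesis nd : nondeg_simplex v.

Lemma bary_comb x : \sum_k bary v x k *: v k = x.
Proof.
rewrite comb_edge ?bary_sum//.
have -> : \col_j bary v x (lift ord0 j) = baryv v x.
  by apply/colP => j; rewrite mxE baryS.
by rewrite /baryv mulKVmx// trmxK addrC subrK.
Qed.

Lemma bary_unique c x : \sum_k c k = 1 -> x = \sum_k c k *: v k -> bary v x = c.
Proof.
move=> c1 xc; have E : baryv v x = \col_j c (lift ord0 j).
  by rewrite /baryv xc comb_edge// addrAC subrr add0r trmxK mulKmx.
apply/funext => k; have [j ->|->] := unliftP ord0 k; first by rewrite baryS E mxE.
rewrite bary0 E; under eq_bigr do rewrite mxE.
by rewrite -c1 big_ord_recl addrK.
Qed.

Lemma bary_sum_comb n (c : 'I_n -> R) (p : 'I_n -> 'rV[R]_d) : \sum_l c l = 1 ->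
  forall k, bary v (\sum_l c l *: p l) k = \sum_l c l * bary v (p l) k.
Proof.
move=> c1 k.
suff -> : bary v (\sum_l c l *: p l) = fun k => \sum_l c l * bary v (p l) k by [].
apply: bary_unique.
  rewrite exchange_big/= -[RHS]c1; apply: eq_bigr => l _.
  by rewrite -mulr_sumr bary_sum mulr1.
under [RHS]eq_bigr do rewrite scaler_suml.
rewrite exchange_big/=; apply: eq_bigr => l _.
under eq_bigr do rewrite -scalerA.
by rewrite -scaler_sumr bary_comb.
Qed.

Lemma bary_vtx j k : bary v (v j) k = (k == j)%:R.
Proof.
suff -> : bary v (v j) = fun k => (k == j)%:R by [].
apply: bary_unique.
  by rewrite (bigD1 j)//= eqxx big1 ?addr0// => i /negPf ->.
rewrite (bigD1 j)//= eqxx scale1r big1 ?addr0// => i /negPf ->.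
by rewrite scale0r.
Qed.

Lemma bary_conv x y (t : R) k :
  bary v ((1 - t) *: x + t *: y) k = (1 - t) * bary v x k + t * bary v y k.
Proof.
have H := @bary_sum_comb 2 (fun l => if l == ord0 then 1 - t else t) (fun l => if l == ord0 then x else y).
have := H _ k; rewrite !big_ord_recl !big_ord0/= !addr0 subrK; exact.
Qed.

Lemma bary_move x (t : R) i j k :
  bary v (x + t *: (v i - v j)) k = bary v x k + t * ((k == i)%:R - (k == j)%:R).
Proof.
suff -> : bary v (x + t *: (v i - v j)) =
  fun k => bary v x k + t * ((k == i)%:R - (k == j)%:R) by [].
apply: bary_unique.
  rewrite big_split/= bary_sum -mulr_sumr sumrB.
  have S l : \sum_k (k == l)%:R = 1 :> R.
    by rewrite (bigD1 l)//= eqxx big1 ?addr0// => i' /negPf ->.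
  by rewrite !S subrr mulr0 addr0.
under eq_bigr do rewrite scalerDl; rewrite big_split/= bary_comb; congr (_ + _).
under eq_bigr do rewrite -scalerA; rewrite -scaler_sumr; congr (_ *: _).
under eq_bigr do rewrite scalerBl; rewrite sumrB.
have S l : \sum_k (k == l)%:R *: v k = v l.
  rewrite (bigD1 l)//= eqxx scale1r big1 ?addr0// => i' /negPf ->.
  by rewrite scale0r.
by rewrite !S.
Qed.

Lemma bary_linear k : exists (a : 'rV[R]_d) (b : R), forall x, bary v x k = \sum_i a ord0 i * x ord0 i + b.
Proof.
have S j : exists (a : 'rV[R]_d) (b : R), forall x, baryv v x j ord0 = \sum_i a ord0 i * x ord0 i + b.
  exists (row j (invmx (edge_mx v))), (- \sum_i invmx (edge_mx v) j i * v ord0 ord0 i) => x.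
  rewrite mxE -sumrB; apply: eq_bigr => i _.
  by rewrite !mxE mulrBr.
have [j ->|->] := unliftP ord0 k.
  by have [a [b H]] := S j; exists a, b => x; rewrite baryS H.
have /choice[a /choice[b H]] := S.
exists (- \sum_j a j), (1 - \sum_j b j) => x; rewrite bary0.
have -> : \sum_j baryv v x j ord0 =
    \sum_i (\sum_j a j) ord0 i * x ord0 i + \sum_j b j.
  under eq_bigr do rewrite H; rewrite big_split/= exchange_big/=; congr (_ + _).
  by apply: eq_bigr => i _; rewrite summxE mulr_suml.
have -> : \sum_i (- \sum_j a j) ord0 i * x ord0 i = - \sum_i (\sum_j a j) ord0 i * x ord0 i.
  by rewrite -[RHS]sumrN; apply: eq_bigr => i _; rewrite mxE mulNr.
by ring.
Qed.

Lemma in_simplex x : simplex v x <-> forall k, 0 <= bary v x k.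
Proof.
split=> [[n [c [p [cp c1 ->]]]] k|x0].
  rewrite bary_sum_comb// sumr_ge0// => l _; have [c0 [j _ <-]] := cp l.
  by rewrite mulr_ge0// bary_vtx.
exists d.+1, (bary v x), v; split; first by move=> k; split => //; exists k.
  exact: bary_sum.
by rewrite bary_comb.
Qed.

Lemma simplex_vtx k : simplex v (v k).
Proof. by apply/in_simplex => j; rewrite bary_vtx. Qed.

(** For delta = 0 this is the open simplex. A positive delta leaves room: moving by t <= delta along
    an edge vector changes the barycentric coordinates by at most t, so the point stays in the open
    simplex. *)
Definition isimplex (delta : R) : set 'rV[R]_d := [set x | forall k, delta < bary v x k].

Lemma isimplex_sub delta : 0 <= delta -> isimplex delta `<=` simplex v.
Proof. by move=> d0 x xd; apply/in_simplex => k; rewrite (le_trans d0)// ltW. Qed.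

Lemma isimplex_le delta1 delta2 : delta1 <= delta2 -> isimplex delta2 `<=` isimplex delta1.
Proof. by move=> d12 x xd k; rewrite (le_lt_trans d12). Qed.

Lemma simplex_conv x y (t : R) : simplex v x -> simplex v y -> 0 <= t <= 1 ->
  simplex v ((1 - t) *: x + t *: y).
Proof.
move=> /in_simplex x0 /in_simplex y0 /andP[t0 t1]; apply/in_simplex => k.
by rewrite bary_conv addr_ge0// mulr_ge0// subr_ge0.
Qed.

Lemma isimplex_conv x y (t : R) delta : isimplex delta x -> isimplex delta y -> 0 <= t <= 1 ->
  isimplex delta ((1 - t) *: x + t *: y).
Proof.
move=> x0 y0 /andP[t0 t1] k; rewrite bary_conv.
have := x0 k; have := y0 k; move: t0; rewrite le_eqVlt => /predU1P[<-|t0].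
  by rewrite subr0 mul1r mul0r addr0.
move=> H1 H2; have : 0 <= (1 - t) * (bary v x k - delta) by rewrite mulr_ge0 ?subr_ge0// ltW.
have : 0 < t * (bary v y k - delta) by rewrite mulr_gt0// subr_gt0.
lra.
Qed.

Lemma isimplex_conv_l x y (t : R) : isimplex 0 x -> simplex v y -> 0 <= t < 1 ->
  isimplex 0 ((1 - t) *: x + t *: y).
Proof.
move=> x0 /in_simplex y0 /andP[t0 t1] k; rewrite bary_conv.
by rewrite ltr_pwDl ?mulr_ge0// mulr_gt0 ?subr_gt0// x0.
Qed.

Lemma continuous_linear (a : 'rV[R]_d) (b : R) :
  continuous (fun x : 'rV[R]_d => \sum_i a ord0 i * x ord0 i + b).
Proof.
move=> x; apply: (@continuousD _ R^o _ (fun x : 'rV[R]_d => \sum_i a ord0 i * x ord0 i) (cst b)); last exact: cst_continuous.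
elim: (index_enum _) => [|i r IHr].
  rewrite (_ : (fun x => _) = cst 0); first exact: cst_continuous.
  by apply/funext => y; rewrite big_nil.
rewrite (_ : (fun x => _) = (fun x : 'rV[R]_d => a ord0 i * x ord0 i + \sum_(i <- r) a ord0 i * x ord0 i)); last first.
  by apply/funext => y; rewrite big_cons.
apply: (@continuousD _ R^o) => //; apply: continuousM; first exact: cst_continuous.
exact: coord_continuous.
Qed.

Lemma continuous_bary k : continuous (fun x => bary v x k).
Proof.
have [a [b H]] := bary_linear k; rewrite (_ : (fun x => _) = (fun x => \sum_i a ord0 i * x ord0 i + b)).
  exact: continuous_linear.
exact/funext.
Qed.

Lemma open_isimplex delta : open (isimplex delta).
Proof.
rewrite openE => x xd.
apply: (@filter_forall _ _ (fun k => [set y | delta < bary v y k]) (nbhs x)) => k.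
apply: (@continuous_bary k x [set r | delta < r]); apply: open_nbhs_nbhs; split; last exact: xd.
exact: open_gt.
Qed.

Lemma closed_simplex : closed (simplex v).
Proof.
have -> : simplex v = \bigcap_(k in setT) (fun x => bary v x k) @^-1` [set r | 0 <= r].
  by apply/seteqP; split=> x; [move=> /in_simplex H k _; exact: H|move=> H; apply/in_simplex => k; exact: H].
apply: closed_bigI => k _; apply: closed_comp; last exact: closed_ge.
by move=> x _; exact: continuous_bary.
Qed.

Lemma measurable_bary k : measurable_fun setT (fun x => bary v x k).
Proof.
have [a [b H]] := bary_linear k.
apply: (eq_measurable_fun (fun x : 'rV[R]_d => \sum_i a ord0 i * x ord0 i + b)).
  by move=> x _; rewrite H.
by apply: measurable_funD => //; exact: measurable_linear.
Qed.

Lemma measurable_simplex : measurable (simplex v).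
Proof.
have -> : simplex v = \bigcap_(k in [set: 'I_d.+1]) (fun x => bary v x k) @^-1` [set r | 0 <= r].
  by apply/seteqP; split=> x; [move=> /in_simplex H k _; exact: H|move=> H; apply/in_simplex => k; exact: H].
apply: fin_bigcap_measurable => // k _.
rewrite -[X in measurable X]setTI; apply: measurable_bary => //.
by rewrite -set_itvcy; exact: measurable_itv.
Qed.

(** The zero set of a nonconstant affine function is a hyperplane. In the constant case, which is d
    = 0, the value is 1 because it is 1 at vertex k, and the set is empty. *)
Lemma facet_null k : mu [set x | bary v x k = 0] = 0%E.
Proof.
have [a [b H]] := bary_linear k.
have -> : [set x | bary v x k = 0] = hyperplane (fun i => a ord0 i) (- b).
  by apply/seteqP; split => x /=; rewrite /hyperplane/= H => /eqP; [rewrite addr_eq0 => /eqP|move=> /eqP ->; rewrite addNr].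
have [[i ai]|a0] := pselect (exists i, a ord0 i != 0).
  by apply: hyperplane_null; exists i.
have {}a0 i : a ord0 i = 0 by apply/eqP/negPn/negP => ai; apply: a0; exists i.
have b1 : b = 1.
  have E1 : bary v (v k) k = 1 by rewrite bary_vtx eqxx.
  by rewrite -E1 H big1 ?add0r// => i _; rewrite a0 mul0r.
rewrite (_ : hyperplane _ _ = set0) ?measure0//; apply/seteqP; split => // x.
rewrite /hyperplane/= big1 => [/eqP|i _]; last by rewrite a0 mul0r.
by rewrite b1 eq_sym oppr_eq0 oner_eq0.
Qed.

Lemma ae_isimplex : {ae mu, forall x, simplex v x -> isimplex 0 x}.
Proof.
have : {ae mu, forall x k, bary v x k != 0}.
  apply: filter_forall => k; exists [set x | bary v x k = 0]; split.
  - rewrite -[X in measurable X]setTI; exact: (measurable_bary k measurableT (measurable_set1 0)).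
  - exact: facet_null.
  - by move=> x /= /negP; rewrite negbK => /eqP.
by apply: filterS => x x0 /in_simplex xs k; rewrite lt_neqAle eq_sym x0 xs.
Qed.

(** The entries of z are differences of barycentric coordinates, all of which lie in [0, 1]. *)
Lemma simplex_diff x y : simplex v x -> simplex v y -> exists2 z : 'cV[R]_d,
  (forall j, `|z j ord0| <= 1) & (y - x)^T = edge_mx v *m z.
Proof.
move=> /in_simplex x0 /in_simplex y0; exists (baryv v y - baryv v x).
  have le1 w k : (forall k, 0 <= bary v w k) -> 0 <= bary v w k <= 1.
    by move=> w0; rewrite w0 -(bary_sum v w) (bigD1 k)//= lerDl sumr_ge0.
  move=> j.
  have -> : (baryv v y - baryv v x) j ord0 = bary v y (lift ord0 j) - bary v x (lift ord0 j).
    by rewrite !baryS mxE [X in _ + X]mxE.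
  have /andP[? ?] := le1 x (lift ord0 j) x0; have /andP[? ?] := le1 y (lift ord0 j) y0.
  by rewrite ler_norml; apply/andP; split; lra.
rewrite mulmxBr /baryv !mulKVmx// -linearB/=; congr (_ ^T).
by rewrite opprB addrA subrK.
Qed.

Lemma simplex_sub_parallelepiped : simplex v `<=` parallelepiped 1 (v ord0) (edge_mx v)^T.
Proof.
move=> x xv; have [z z1 xz] := simplex_diff (simplex_vtx ord0) xv.
exists z^T; first by move=> i; rewrite mxE.
by rewrite -trmx_mul -xz trmxK addrC subrK.
Qed.

End nondegenerate.

End barycentric.

(** * Interpolation error on an element *)

Section nodal_estimate.
Context {R : realType} {d : nat}.
Variables (v : 'I_d.+1 -> 'rV[R]_d) (e : 'rV[R]_d -> R) (M : R).
Hypothesis nd : nondeg_simplex v.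
Hypothesis M0 : 0 <= M.
Hypothesis eM : forall x y (t : R), simplex v x -> simplex v y -> 0 <= t <= 1 ->
  `|e ((1 - t) *: x + t *: y) - ((1 - t) * e x + t * e y)| <= t * (1 - t) * M / 2.
Hypothesis e0 : forall k, e (v k) = 0.

Let quarter (t : R) : 0 <= t <= 1 -> t * (1 - t) * M / 2 <= t * M.
Proof. by move=> /andP[t0 t1]; have := mulr_ge0 t0 M0; have := mulr_ge0 (mulr_ge0 t0 t0) M0; lra. Qed.

(** Points are added one at a time: the new combination lies on a segment from the old one to a zero
    of e, and leaving the chord costs at most M. *)
Lemma nodal_value_comb n (c : 'I_n.+1 -> R) (p : 'I_n.+1 -> 'rV[R]_d) :
  (forall i, 0 <= c i) -> \sum_i c i = 1 -> (forall i, simplex v (p i) /\ e (p i) = 0) ->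
  simplex v (\sum_i c i *: p i) /\ `|e (\sum_i c i *: p i)| <= n%:R * M.
Proof.
elim: n c p => [|n IHn] c p c0 c1 pe.
  move: c1; rewrite !big_ord_recl !big_ord0 !addr0 => ->; rewrite scale1r.
  by have [? ->] := pe ord0; rewrite normr0 mul0r.
move: c1; rewrite big_ord_recr/= => c1; rewrite big_ord_recr/=.
set s := c ord_max in c1 *.
have s0 : 0 <= s by exact: c0.
(* If the last weight is 1, the others vanish and cannot be renormalized by 1 - s; the combination
   is then a single point, where e = 0. *)
have [s1|s1] := eqVneq s 1.
  have c0' (i : 'I_n.+1) : c (widen_ord (leqnSn n.+1) i) = 0.
    move: c1; rewrite s1 -[RHS]add0r => /addIr/eqP; rewrite psumr_eq0 => [/allP/(_ i (mem_index_enum _))/eqP//|j _].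
    exact: c0.
  rewrite big1 ?add0r => [|i _]; last by rewrite c0' scale0r.
  have [H E] := pe ord_max; rewrite s1 scale1r E normr0; split => //.
  by rewrite mulr_ge0.
have s1' : s < 1.
  rewrite lt_neqAle s1/= -c1 lerDr sumr_ge0// => i _; exact: c0.
have q0 : 1 - s != 0 by rewrite subr_eq0 eq_sym.
have qs : 0 < 1 - s by rewrite subr_gt0.
pose c' i := c (widen_ord (leqnSn n.+1) i) / (1 - s).
have c'1 : \sum_i c' i = 1.
  by rewrite -mulr_suml (_ : \sum_i _ = 1 - s) ?divff// -c1 addrK.
have [ys ye] := IHn c' (fun i => p (widen_ord (leqnSn n.+1) i))
  (fun i => divr_ge0 (c0 _) (ltW qs)) c'1 (fun i => pe _).
set y := \sum_i _ in ys ye.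
have -> : \sum_(i < n.+1) c (widen_ord (leqnSn n.+1) i) *: p (widen_ord (leqnSn n.+1) i) = (1 - s) *: y.
  rewrite scaler_sumr; apply: eq_bigr => i _.
  by rewrite scalerA /c' mulrC divfK.
have [pv pe0] := pe ord_max; have s01 : 0 <= s <= 1 by rewrite s0 ltW.
split; first exact: simplex_conv.
have := eM ys pv s01; rewrite pe0 mulr0 addr0 => H.
have := quarter s01; have := ler_wpM2r M0 (ltW s1'); rewrite mul1r => H1 H2.
have := ler_wpM2l (ltW qs) ye; rewrite -{1}(gtr0_norm qs) -normrM => H3.
have H4 : (1 - s) * (n%:R * M) <= n%:R * M.
  by rewrite ler_piMl ?mulr_ge0// gerBl.
have -> : n.+1%:R * M = n%:R * M + M by rewrite -natr1 mulrDl mul1r.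
rewrite -[X in `|X|](subrK ((1 - s) * e y)) (le_trans (ler_normD _ _))//.
lra.
Qed.

Lemma nodal_value x : simplex v x -> `|e x| <= d%:R * M.
Proof.
move=> /in_simplex-/(_ nd) x0; rewrite -(bary_comb nd x).
have [_] := nodal_value_comb x0 (bary_sum v x) (fun k => conj (simplex_vtx nd k) (e0 k)).
exact.
Qed.

Lemma nodal_slope_vtx x k (t : R) : simplex v x -> 0 <= t <= 1 ->
  `|e ((1 - t) *: x + t *: v k) - e x| <= t * (d.+1%:R * M).
Proof.
move=> xv /[dup] t01 /andP[t0 t1]; have := eM xv (simplex_vtx nd k) t01; rewrite e0 mulr0 addr0 => H.
have H1 := ler_wpM2l t0 (nodal_value xv); have H2 := quarter t01.
rewrite (_ : _ - e x = (e ((1 - t) *: x + t *: v k) - (1 - t) * e x) - t * e x); last by ring.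
have -> : d.+1%:R * M = d%:R * M + M by rewrite -natr1 mulrDl mul1r.
by rewrite (le_trans (ler_normB _ _))// normrM (ger0_norm t0); lra.
Qed.

(** The segments from x to v_i and from z = x + t (v_i - v_j) to v_j meet at the same parameter s =
    t / (1 + t). Each of the two slopes towards a vertex is controlled by [nodal_slope_vtx], and s
    <= t. *)
Lemma nodal_slope x i j (t : R) : simplex v x -> 0 <= t ->
  simplex v (x + t *: (v i - v j)) ->
  `|e (x + t *: (v i - v j)) - e x| <= 2 * (d.+1%:R * M) * t.
Proof.
move=> xv t0 zv; set z := x + _ in zv *.
pose s := t / (1 + t).
have t1 : 0 < 1 + t by rewrite ltr_wpDr.
have s01 : 0 <= s <= 1 by rewrite divr_ge0 ?(ltW t1)//= ler_pdivrMr// mul1r lerDr.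
have st : s <= t by rewrite ler_pdivrMr// ler_peMr// lerDl.
have zx : (1 - s) *: z + s *: v j = (1 - s) *: x + s *: v i.
  by apply/rowP => k; rewrite !mxE /s; field; rewrite gt_eqF.
have H1 := nodal_slope_vtx i xv s01; have H2 := nodal_slope_vtx j zv s01.
rewrite zx in H2.
have M1 : 0 <= d.+1%:R * M by rewrite mulr_ge0.
have H3 := ler_wpM2r M1 st.
rewrite (_ : e z - e x = (e ((1 - s) *: x + s *: v i) - e x) - (e ((1 - s) *: x + s *: v i) - e z)); last by ring.
by rewrite (le_trans (ler_normB _ _))//; lra.
Qed.

End nodal_estimate.

Section closure_extension.
Context {R : realType} {d : nat}.

Lemma within_continuous_seq (A : set 'rV[R]_d) (u : 'rV[R]_d -> R) x (x_ : nat -> 'rV[R]_d) :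
  {within A, continuous u} -> A x -> (forall n, A (x_ n)) -> x_ n @[n --> \oo] --> x ->
  u (x_ n) @[n --> \oo] --> u x.
Proof.
move=> cu Ax Ax_ cx P HP.
have H : nbhs_subspace (x : subspace A) (u @^-1` P) := cu x P HP.
rewrite -nbhs_subspace_in// in H.
have HH : \forall n \near \oo, A (x_ n) -> P (u (x_ n)) := cx _ H.
suff : \forall n \near \oo, P (u (x_ n)) by [].
by apply: filterS HH => n; apply; exact: Ax_.
Qed.

Variables (v : 'I_d.+1 -> 'rV[R]_d) (u : 'rV[R]_d -> R) (A : set 'rV[R]_d) (M : R).
Hypothesis nd : nondeg_simplex v.
Hypothesis vA : simplex v `<=` A.
Hypothesis cu : {within A, continuous u}.
Hypothesis uM : forall x y (t : R), isimplex v 0 x -> isimplex v 0 y -> 0 <= t <= 1 ->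
  `|u ((1 - t) *: x + t *: y) - ((1 - t) * u x + t * u y)| <= t * (1 - t) * M / 2.

Let g : 'rV[R]_d := \sum_k (d.+1%:R^-1 : R) *: v k.

Lemma barycenter_isimplex : isimplex v 0 g.
Proof.
have c1 : \sum_(k < d.+1) (d.+1%:R^-1 : R) = 1.
  by rewrite sumr_const card_ord -[LHS]mulr_natl divff// pnatr_eq0.
by move=> k; rewrite (bary_unique nd c1 erefl) invr_gt0 ltr0n.
Qed.

Let push n x := n.+2%:R^-1 *: g + (1 - n.+2%:R^-1) *: x.

Let push_isimplex n x : simplex v x -> isimplex v 0 (push n x).
Proof.
move=> xv; have := @isimplex_conv_l _ _ _ nd g x (1 - n.+2%:R^-1) barycenter_isimplex xv.
rewrite opprB addrCA subrr addr0 /push; apply.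
by rewrite subr_ge0 invf_le1 ?ltr0n// ler1n/= gtrBl invr_gt0 ltr0n.
Qed.

Let push_cvg x : push n x @[n --> \oo] --> x.
Proof.
have h0 : n.+2%:R^-1 @[n --> \oo] --> (0 : R).
  by have := @cvg_harmonic R; rewrite -cvg_shiftS.
have E : x = 0 *: g + (1 - 0) *: x by rewrite scale0r add0r subr0 scale1r.
suff : push n x @[n --> \oo] --> 0 *: g + (1 - 0) *: x by rewrite -E.
by apply: cvgD; apply: cvgZr_tmp => //; apply: cvgB => //; exact: cvg_cst.
Qed.

(** Pushing towards the barycenter is an affine map, so it carries the segment to a segment of the
    open simplex. The estimate passes to the limit by continuity of u within A. *)
Lemma segment_estimate_closure x y (t : R) : simplex v x -> simplex v y -> 0 <= t <= 1 ->
  `|u ((1 - t) *: x + t *: y) - ((1 - t) * u x + t * u y)| <= t * (1 - t) * M / 2.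
Proof.
move=> xv yv t01; have zv := simplex_conv nd xv yv t01.
have C w : simplex v w -> u (push n w) @[n --> \oo] --> u w.
  move=> wv; apply: (within_continuous_seq cu (vA wv)); last exact: push_cvg.
  by move=> n; apply: vA; apply: isimplex_sub (push_isimplex n wv).
have L : `|u (push n ((1 - t) *: x + t *: y)) - ((1 - t) * u (push n x) + t * u (push n y))| @[n --> \oo]
    --> `|u ((1 - t) *: x + t *: y) - ((1 - t) * u x + t * u y)|.
  apply: cvg_norm; apply: cvgB; first exact: C.
  by apply: cvgD; apply: cvgMr; exact: C.
rewrite -(cvg_lim _ L)//; apply: limr_le; first by apply/cvg_ex; eexists; exact: L.
apply: nearW => n.
have -> : push n ((1 - t) *: x + t *: y) = (1 - t) *: push n x + t *: push n y.
  by apply/rowP => k; rewrite /push !mxE; ring.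
by apply: uM => //; exact: push_isimplex.
Qed.

End closure_extension.

Section element.
Context {R : realType} {d : nat}.
Let mu := @lebesgue_rV R d.

Lemma weak_box_eq (U : set 'rV[R]_d) i u u' w w' :
  (forall x, U x -> u x = u' x) -> (forall x, U x -> w x = w' x) ->
  weak_box U i u w -> weak_box U i u' w'.
Proof.
move=> uu' ww' H a b F sF bU.
have sFi := smc_box_upd i sF.
transitivity (\int[mu]_x (u x * prodf (upd F i (derive1 (F i))) x)).
  apply: eq_Rintegral => x _; have [xab|xab] := pselect (box a b x).
    by rewrite uu'//; exact: bU.
  by rewrite (prodf_out sFi xab) !mulr0.
rewrite (H a b F sF bU); congr (- _); apply: eq_Rintegral => x _.
have [xab|xab] := pselect (box a b x); first by rewrite ww'//; exact: bU.
by rewrite (prodf_out sF xab) !mulr0.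
Qed.

Lemma weak_box_sub (U V : set 'rV[R]_d) i u w : V `<=` U -> weak_box U i u w -> weak_box V i u w.
Proof. by move=> VU H a b F sF bV; apply: H sF _; exact: subset_trans VU. Qed.

Lemma weak_boxB (U : set 'rV[R]_d) i u u' w w' :
  mu.-integrable setT (EFin \o u) -> mu.-integrable setT (EFin \o u') ->
  mu.-integrable setT (EFin \o w) -> mu.-integrable setT (EFin \o w') ->
  weak_box U i u w -> weak_box U i u' w' -> weak_box U i (fun x => u x - u' x) (fun x => w x - w' x).
Proof.
move=> iu iu' iw iw' H H' a b F sF bU; have sFi := smc_box_upd i sF.
under eq_Rintegral do rewrite mulrBl; under [in RHS]eq_Rintegral do rewrite mulrBl.
rewrite !RintegralB//; try exact: integrable_mul_prodf sF _; try exact: integrable_mul_prodf sFi _.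
by rewrite (H _ _ _ sF bU) (H' _ _ _ sF bU) opprB opprK addrC.
Qed.

Lemma integrable_bounded_restrict (U : set 'rV[R]_d) (f : 'rV[R]_d -> R) (C : R) :
  measurable U -> (mu U < +oo)%E -> measurable_fun setT f -> (forall x, U x -> `|f x| <= C) ->
  mu.-integrable setT (EFin \o (f \_ U)).
Proof.
move=> mU muU mf fC; rewrite -restrict_EFin; apply/(integrable_mkcond _ mU).
apply: measurable_bounded_integrable => //; first exact: measurable_funTS.
by exists C; split; rewrite ?num_real // => N CN x Ux; rewrite /= (le_trans (fC x Ux))// ltW.
Qed.

(** The Gram matrix, in the inner product B, of the edge vectors from vertex 0: the matrix S of the
    overview. *)
Definition spreadmx (v : 'I_d.+1 -> 'rV[R]_d) (B : 'M[R]_d) : 'M[R]_d :=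
  (edge_mx v)^T *m B *m edge_mx v.

Definition affine (a : 'rV[R]_d) (b : R) (x : 'rV[R]_d) : R := \sum_i a ord0 i * x ord0 i + b.

Lemma affine_conv a b x y (t : R) :
  affine a b ((1 - t) *: x + t *: y) = (1 - t) * affine a b x + t * affine a b y.
Proof.
rewrite /affine !mulrDr [RHS]addrACA -mulrDl subrK mul1r; congr (_ + _).
by rewrite !mulr_sumr -big_split/=; apply: eq_bigr => i _; rewrite !mxE; ring.
Qed.

Lemma affine_comb a b n (c : 'I_n -> R) p : \sum_l c l = 1 ->
  affine a b (\sum_l c l *: p l) = \sum_l c l * affine a b (p l).
Proof.
move=> c1; rewrite /affine; under [RHS]eq_bigr do rewrite mulrDr.
rewrite big_split/= -mulr_suml c1 mul1r; congr (_ + _).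
under [RHS]eq_bigr do rewrite mulr_sumr.
rewrite exchange_big/=; apply: eq_bigr => i _.
by rewrite summxE mulr_sumr; apply: eq_bigr => l _; rewrite mxE mulrCA.
Qed.

Section affine_perturbation.
Variables (v : 'I_d.+1 -> 'rV[R]_d) (a : 'rV[R]_d) (b : R).
Hypothesis nd : nondeg_simplex v.
Let U := isimplex v 0.

Let mU : measurable U. Proof. by apply: open_measurable_rV; exact: open_isimplex. Qed.

Lemma simplex_finite : (mu (simplex v) < +oo)%E.
Proof.
have [C C0 HC] := @parallelepiped_volume R d 1 ler01.
have := HC (v ord0) (edge_mx v)^T _ (measurable_simplex nd).
rewrite det_tr -unitfE -unitmxE => /(_ nd (simplex_sub_parallelepiped nd)).
by move=> /le_lt_trans; apply; exact: ltry.
Qed.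

Lemma isimplex_finite : (mu U < +oo)%E.
Proof.
apply: le_lt_trans simplex_finite; apply: le_measure; rewrite ?inE//.
  exact: measurable_simplex.
exact: isimplex_sub.
Qed.

Lemma integrable_affine_isimplex : mu.-integrable setT (EFin \o (affine a b \_ U)).
Proof.
apply: (@integrable_bounded_restrict _ _ (\sum_k `|affine a b (v k)|)) => //.
- exact: isimplex_finite.
- by apply: measurable_funD => //; exact: measurable_linear.
move=> x /(isimplex_sub nd (lexx 0))/(in_simplex nd) x0.
rewrite -[x in affine a b x](bary_comb nd) affine_comb ?bary_sum//.
rewrite (le_trans (ler_norm_sum _ _ _))//; apply: ler_sum => k _.
rewrite normrM ler_piMl// ger0_norm; last exact: x0.
by rewrite -(bary_sum v x) (bigD1 k)//= lerDl sumr_ge0.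
Qed.

Lemma integrable_cst_isimplex (k : R) : mu.-integrable setT (EFin \o (cst k \_ U)).
Proof.
by apply: (@integrable_bounded_restrict _ _ `|k|) => //; exact: isimplex_finite.
Qed.

Lemma weak_box_sub_affine i u w :
  mu.-integrable setT (EFin \o (u \_ U)) -> mu.-integrable setT (EFin \o w) ->
  weak_box U i (u \_ U) w ->
  weak_box U i (fun x => (u \_ U) x - (affine a b \_ U) x) (fun x => w x - (cst (a ord0 i) \_ U) x).
Proof.
move=> iu iw uw.
apply: (weak_boxB iu integrable_affine_isimplex iw (integrable_cst_isimplex _) uw).
apply: (@weak_box_eq U i (affine a b \_ U) _ (cst (a ord0 i))) => //.
  by move=> x Ux; rewrite patchE mem_set.
exact: weak_box_affine.
Qed.

End affine_perturbation.

Variables (v : 'I_d.+1 -> 'rV[R]_d) (A : set 'rV[R]_d) (u : 'rV[R]_d -> R)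
  (W : 'I_d -> 'rV[R]_d -> R) (H : 'I_d -> 'I_d -> 'rV[R]_d -> R)
  (B : 'M[R]_d) (c : R) (a : 'rV[R]_d) (b : R).
Hypothesis nd : nondeg_simplex v.
Let U := isimplex v 0.
Hypothesis vA : simplex v `<=` A.
Hypothesis cu : {within A, continuous u}.
Hypothesis iu : mu.-integrable setT (EFin \o (u \_ U)).
Hypothesis iW : forall i, mu.-integrable setT (EFin \o W i).
Hypothesis iH : forall i j, mu.-integrable setT (EFin \o H i j).
Hypothesis uW : forall i, weak_box U i (u \_ U) (W i).
Hypothesis WH : forall i j, weak_box U i (W j) (H i j).
Hypothesis spdB : spdmx B.
Hypothesis c0 : 0 <= c.
Hypothesis Hc : {ae mu, forall x, U x -> forall z : 'rV[R]_d,
  `|\sum_i \sum_j z ord0 i * z ord0 j * H i j x| <= c * qf B z^T}.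
Hypothesis ab : forall k, affine a b (v k) = u (v k).

Let oU : open U. Proof. exact: open_isimplex. Qed.

Let mU : measurable U. Proof. exact: open_measurable_rV oU. Qed.

Let Uv : U `<=` simplex v. Proof. exact: isimplex_sub. Qed.

Let muU : (mu U < +oo)%E. Proof. exact: isimplex_finite. Qed.

(** A chord of the simplex is E z with all |z_j| <= 1, so its squared B-length z^T S z is at most d
    \tr S. Thus M bounds the second differences along all chords. *)
Let M := c * \tr (spreadmx v B) * d%:R.

Let M0 : 0 <= M.
Proof.
by rewrite mulr_ge0// mulr_ge0//; exact: psd_tr_ge0 (spd_psd (spd_congr spdB nd)).
Qed.

Let cu_at x : U x -> {for x, continuous (u \_ U)}.
Proof.
move=> Ux; have : {in U, continuous (u \_ U)}.
  rewrite -continuous_open_subspace//.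
  apply: (@subspace_eq_continuous _ U _ u (u \_ U)).
    by move=> y yU; rewrite /patch yU.
  by apply: continuous_subspaceW cu; exact: subset_trans vA.
by apply; rewrite inE.
Qed.

Let segment_U x y (t : R) : U x -> U y -> 0 <= t <= 1 ->
  `|u ((1 - t) *: x + t *: y) - ((1 - t) * u x + t * u y)| <= t * (1 - t) * (c * qf B (y - x)^T) / 2.
Proof.
move=> Ux Uy t01.
have cv (p q : 'rV[R]_d) (s : R) : U p -> U q -> 0 <= s <= 1 -> U ((1 - s) *: p + s *: q).
  exact: isimplex_conv.
have m0 : 0 <= c * qf B (y - x)^T by rewrite mulr_ge0// spd_ge0.
have Hm : {ae mu, forall z, U z ->
    `|\sum_i \sum_j (y - x) ord0 i * (y - x) ord0 j * H i j z| <= c * qf B (y - x)^T}.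
  by apply: filterS Hc => z Hz /Hz.
have xy : x + (y - x) = y by rewrite addrC subrK.
have := segment_estimate oU cv cu_at iu iH uW WH m0 Hm Ux _ t01.
rewrite xy => /(_ Uy).
have -> : x + t *: (y - x) = (1 - t) *: x + t *: y by apply/rowP => k; rewrite !mxE; ring.
by rewrite !patchE !mem_set//; exact: cv.
Qed.

Let qf_le_M x y : simplex v x -> simplex v y -> c * qf B (y - x)^T <= M.
Proof.
move=> xv yv; have [z z1 ->] := simplex_diff nd xv yv.
rewrite -qf_conj /M -mulrA ler_wpM2l//.
apply: le_trans (qf_le_tr _ (spd_psd (spd_congr spdB nd))) _; rewrite ler_wpM2l//.
  exact: psd_tr_ge0 (spd_psd (spd_congr spdB nd)).
have -> : d%:R = \sum_(i < d) (1 : R) by rewrite sumr_const card_ord.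
apply: ler_sum => i _; rewrite -[leRHS](expr1n _ 2) -[leLHS]real_normK ?num_real//.
by rewrite ler_pXn2r ?nnegrE.
Qed.

Let e x := u x - affine a b x.

Let eM x y (t : R) : simplex v x -> simplex v y -> 0 <= t <= 1 ->
  `|e ((1 - t) *: x + t *: y) - ((1 - t) * e x + t * e y)| <= t * (1 - t) * M / 2.
Proof.
move=> xv yv t01; rewrite /e affine_conv.
rewrite (_ : _ - _ - _ = u ((1 - t) *: x + t *: y) - ((1 - t) * u x + t * u y)); last by ring.
apply: (@segment_estimate_closure R d v u A M nd vA cu) => // {xv yv t01}x {}y {}t Ux Uy /[dup] t01 /andP[t0 t1].
apply: le_trans (segment_U Ux Uy t01) _.
rewrite ler_pM2r ?invr_gt0// ler_wpM2l//; first by rewrite mulr_ge0// subr_ge0.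
by apply: qf_le_M; exact: Uv.
Qed.

Let L := 2 * (d.+1%:R * M).

(** [directional_bound] along an edge, with L the slope constant of [nodal_slope]. The functions are
    extended by 0 outside the open simplex, as all integrals run over the whole space. *)
Lemma element_edge_bound (delta : R) j : 0 < delta ->
  {ae mu, forall x, isimplex v delta x ->
    `|\sum_i (v (lift ord0 j) - v ord0) ord0 i * (W i x - a ord0 i)| <= L}.
Proof.
move=> delta0; pose w := v (lift ord0 j) - v ord0.
have e0 k : e (v k) = 0 by rewrite /e ab subrr.
have Ud : isimplex v delta `<=` U by exact: isimplex_le (ltW delta0).
have muUd : (mu (isimplex v delta) < +oo)%E.
  apply: le_lt_trans muU; apply: le_measure => //; rewrite inE//.
  by apply: open_measurable_rV; exact: open_isimplex.
have move_U y (t : R) : isimplex v delta y -> 0 <= t <= delta -> U (y + t *: w).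
  move=> yd /andP[t0 td] k; rewrite bary_move//.
  have := yd k; case: (_ == _); case: (_ == _) => /=; lra.
have il := integrable_affine_isimplex a b nd.
have ia i := integrable_cst_isimplex nd (a ord0 i).
pose eU x := (u \_ U) x - (affine a b \_ U) x.
pose W' i x := W i x - (cst (a ord0 i) \_ U) x.
have ieU : mu.-integrable setT (EFin \o eU).
  by have := integrableB measurableT iu il; congr (mu.-integrable _ _).
have iW' i : mu.-integrable setT (EFin \o W' i).
  by have := integrableB measurableT (iW i) (ia i); congr (mu.-integrable _ _).
have eW i : weak_box (isimplex v delta) i eU (W' i).
  exact: (weak_box_sub Ud (weak_box_sub_affine a b nd iu (iW i) (uW i))).
have eUE x : U x -> eU x = e x by move=> Ux; rewrite /eU !patchE !mem_set.
have oUd : open (isimplex v delta) by exact: open_isimplex.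
have m0 : 0 <= c * qf B w^T by rewrite mulr_ge0// spd_ge0.
have L0 : 0 <= L by rewrite mulr_ge0// mulr_ge0.
have := @directional_bound R d eU W' w (isimplex v delta) delta L (c * qf B w^T)
  oUd muUd delta0 m0 L0 ieU iW' eW.
have H1 y (t : R) : isimplex v delta y -> 0 <= t <= delta -> `|eU (y + t *: w) - eU y| <= L * t.
  move=> yd td; have /andP[t0 _] := td; rewrite !eUE; [|exact: Ud|exact: move_U].
  by apply: (nodal_slope nd M0 eM e0) => //; [exact/Uv/Ud|exact/Uv/move_U].
have H2 y (t : R) : isimplex v delta y -> 0 <= t <= delta ->
    `|eU (y + (t / 2) *: w) - (eU y + eU (y + t *: w)) / 2| <= c * qf B w^T * t ^+ 2.
  move=> yd td; have /andP[t0 td'] := td.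
  have td2 : 0 <= t / 2 <= delta by rewrite divr_ge0//=; lra.
  rewrite !eUE; [|exact: move_U|exact: Ud|exact: move_U].
  have h01 : 0 <= (2^-1 : R) <= 1 by apply/andP; split; lra.
  (* At the midpoint the segment estimate yields c t^2 / 8 times the form of B at w, which is below
     the bound wanted. *)
  have := segment_U (Ud _ yd) (move_U _ _ yd td) h01.
  have -> : (1 - 2^-1 : R) *: y + 2^-1 *: (y + t *: w) = y + (t / 2) *: w.
    by apply/rowP => k; rewrite !mxE; field.
  rewrite addrAC subrr add0r linearZ/= qf_scale /e.
  have -> : affine a b (y + (t / 2) *: w) = (affine a b y + affine a b (y + t *: w)) / 2.
    have -> : y + (t / 2) *: w = (1 - 2^-1 : R) *: y + 2^-1 *: (y + t *: w).
      by apply/rowP => k; rewrite !mxE; field.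
    by rewrite affine_conv; field.
  move=> H2; rewrite (_ : _ - _ - _ = u (y + (t / 2) *: w) - ((1 - 2^-1) * u y + 2^-1 * u (y + t *: w))); last by field.
  apply: le_trans H2 _.
  have : 0 <= c * qf B w^T * t ^+ 2 by rewrite mulr_ge0// sqr_ge0.
  by rewrite mulrCA (mulrA c); lra.
move=> /(_ H1 H2); apply: filterS => x Hx xd.
have := Hx xd; congr (`|_| <= _); apply: eq_bigr => i _; rewrite /W' patchE mem_set//.
exact: Ud.
Qed.

(** The sets with delta = 1/(n+1) exhaust the open simplex and the faces are null, so all d edge
    derivatives are at most L almost everywhere. Their squares sum to at most d L^2, and
    [sqn_le_congr] converts this into a gradient bound. *)
Lemma element_gradient : {ae mu, forall x, simplex v x ->
  sqn (\col_i (W i x - a ord0 i)) <= spectral_norm B *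
    (\tr (spreadmx v B) ^+ d.-1 / \det (spreadmx v B) * (d%:R * L ^+ 2))}.
Proof.
have E : {ae mu, forall x n j, isimplex v n.+1%:R^-1 x ->
    `|\sum_i (v (lift ord0 j) - v ord0) ord0 i * (W i x - a ord0 i)| <= L}.
  apply: ae_foralln => n; apply: filter_forall => j.
  by apply: element_edge_bound; rewrite invr_gt0.
have I := ae_isimplex nd.
apply: filterS2 E I => x Ex Ix /Ix Ux.
have [n nx] : exists n, isimplex v n.+1%:R^-1 x.
  have : \forall n \near \oo, forall k, n.+1%:R^-1 < bary v x k.
    by apply: filter_forall => k; exact: (near_infty_natSinv_lt (PosNum (Ux k))).
  by move=> [n _ Hn]; exists n => k; apply: Hn => /=.
apply: le_trans (sqn_le_congr _ spdB nd) _.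
rewrite ler_wpM2l ?spectral_norm_ge0//; first by case: spdB.
rewrite ler_wpM2l//.
  rewrite mulr_ge0 ?invr_ge0 ?(ltW (spd_det_gt0 (spd_congr spdB nd)))// exprn_ge0//.
  exact: psd_tr_ge0 (spd_psd (spd_congr spdB nd)).
have -> : d%:R * L ^+ 2 = \sum_(i < d) L ^+ 2 by rewrite sumr_const card_ord mulr_natl.
apply: ler_sum => j _; rewrite -[leLHS]real_normK ?num_real//.
have L0 : 0 <= L by rewrite mulr_ge0// mulr_ge0.
rewrite ler_pXn2r ?nnegrE//; have := Ex n j nx; congr (`|_| <= _).
by rewrite mxE; apply: eq_bigr => i _; rewrite !mxE.
Qed.

End element.

(** * The nodal interpolant *)

Section interpolant.
Context {R : realType} {d : nat}.
Variables (Omega : set 'rV[R]_d) (T : mesh R d) (u : 'rV[R]_d -> R).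
Hypothesis meshT : mesh_of Omega T.

Let nd K : nondeg_simplex (@vtx _ _ T K). Proof. by case: meshT. Qed.

Lemma nodal_affine v (g : 'I_d.+1 -> R) : nondeg_simplex v ->
  exists a b, forall k, affine a b (v k) = g k :> R.
Proof.
move=> ndv; have /choice[a /choice[b H]] := @bary_linear R d v.
exists (\sum_k g k *: a k), (\sum_k g k * b k) => j.
have -> : affine (\sum_k g k *: a k) (\sum_k g k * b k) (v j) = \sum_k g k * bary v (v j) k.
  under [RHS]eq_bigr do rewrite H mulrDr; rewrite big_split/=; congr (_ + _).
  under [RHS]eq_bigr do rewrite mulr_sumr; rewrite exchange_big/=.
  by apply: eq_bigr => i _; rewrite summxE mulr_suml; apply: eq_bigr => k _; rewrite mxE mulrA.
rewrite (bigD1 j)//= bary_vtx// eqxx mulr1 big1 ?addr0// => k /negPf kj.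
by rewrite bary_vtx// kj mulr0.
Qed.

(** [nodal_interp] is a choice, so existence is what gives it its meaning. A point in two elements
    is, by conformity, a convex combination of common vertices, where the two affine pieces agree;
    hence they agree at the point. *)
Lemma nodal_interp_exists : exists w, P1_space Omega T w /\
  forall (K : 'I_(nelt T)) i, w (vtx K i) = u (vtx K i).
Proof.
have [_ cover _ conform] := meshT.
have /choice[a /choice[b H]] : forall K : 'I_(nelt T), exists a b, forall k,
    affine a b (vtx K k) = u (vtx K k).
  by move=> K; exact: nodal_affine (fun k => u (vtx K k)) (nd K).
have agree K L x : elem K x -> elem L x -> affine (a K) (b K) x = affine (a L) (b L) x.
  move=> Kx Lx; have : (elem K `&` elem L) x by [].
  rewrite conform => -[n [c [p [cp c1 ->]]]].
  rewrite !affine_comb//; apply: eq_bigr => l _; have [_ [[k _ kp] [k' _ kp']]] := cp l.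
  by rewrite -[in LHS]kp -[in RHS]kp' !H kp kp'.
pose w x := if [pick K : 'I_(nelt T) | `[< elem K x >]] is Some K then affine (a K) (b K) x else 0.
have wE K x : elem K x -> w x = affine (a K) (b K) x.
  move=> Kx; rewrite /w; case: pickP => [L /asboolP Lx|/(_ K)/asboolP//].
  exact: agree.
exists w; split; last first.
  by move=> K i; rewrite (wE K) ?H//; exact: simplex_vtx.
split; last first.
  move=> K; exists (a K)^T, (b K) => x Kx; rewrite (wE K)// /affine; congr (_ + _).
  by rewrite mxE; apply: eq_bigr => i _; rewrite mxE mulrC.
apply/subspace_continuousP => x Ox P HP.
(* Elements are closed, so those missing x also miss a neighbourhood of it; on those containing x
   the function is affine. There are finitely many. *)
have near_K (K : 'I_(nelt T)) : \forall y \near x, elem K y -> P (w y).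
  have [Kx|Kx] := pselect (elem K x).
    have : \forall y \near x, P (affine (a K) (b K) y).
      by apply: (@continuous_linear R d (a K) (b K) x P); rewrite -/(affine _ _ _) -wE.
    by apply: filterS => y Py Ky; rewrite (wE K).
  have : \forall y \near x, (~` elem K) y.
    by apply: open_nbhs_nbhs; split => //; apply: closed_openC; exact: closed_simplex.
  by apply: filterS => y nKy /nKy.
suff : \forall y \near x, closure Omega y -> P (w y) by [].
have HK : \forall y \near x, forall K : 'I_(nelt T), elem K y -> P (w y).
  exact: (@filter_forall _ _ (fun (K : 'I_(nelt T)) y => elem K y -> P (w y)) (nbhs x)).
by apply: filterS HK => y Hy; rewrite -cover => -[K _ Ky]; exact: Hy Ky.
Qed.

Lemma nodal_interp_affine (K : 'I_(nelt T)) : exists a b,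
  (forall x, elem K x -> nodal_interp Omega T u x = affine a b x) /\
  forall k, affine a b (vtx K k) = u (vtx K k).
Proof.
have [w0 Hw0] := nodal_interp_exists.
have [[_ /(_ K)[a [b H]]] Hu] : P1_space Omega T (nodal_interp Omega T u) /\
    forall (K : 'I_(nelt T)) i, nodal_interp Omega T u (vtx K i) = u (vtx K i).
  by rewrite /nodal_interp; case: xgetP => [w _ //|/(_ w0)].
have E x : elem K x -> nodal_interp Omega T u x = affine a^T b x.
  move=> /H ->; rewrite /affine; congr (_ + _).
  by rewrite mxE; apply: eq_bigr => i _; rewrite mxE mulrC.
exists a^T, b; split => // k; rewrite -E ?Hu//; exact: simplex_vtx.
Qed.

End interpolant.

(** * Sobolev derivatives tested by tensor products *)

Section sobolev_to_box.
Context {R : realType} {d : nat}.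
Let mu := @lebesgue_rV R d.
Variable Omega : set 'rV[R]_d.
Hypothesis oOmega : open Omega.
Hypothesis muOmega : (mu Omega < +oo)%E.

Let mOmega : measurable Omega. Proof. exact: open_measurable_rV. Qed.

(** |f| <= 1 + f^2, and the domain has finite measure. *)
Lemma inL2_integrable f : inL2 Omega f -> mu.-integrable setT (EFin \o (f \_ Omega)).
Proof.
move=> [mf f2]; rewrite -restrict_EFin; apply/(integrable_mkcond _ mOmega).
apply/integrableP; split; first exact/measurable_EFinP.
apply: (@le_lt_trans _ _ (\int[mu]_(x in Omega) (1 + (f x ^+ 2)%:E))%E).
  apply: ge0_le_integral => //.
  - by apply: measurableT_comp => //; exact/measurable_EFinP.
  - by apply: emeasurable_funD => //; apply/measurable_EFinP; exact: measurable_funX.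
  move=> x _; rewrite -EFinD lee_fin; have [H|H] := leP 0 (f x).
    by rewrite ger0_norm//; have := sqr_ge0 (f x - 1); lra.
  by rewrite ltr0_norm//; have := sqr_ge0 (f x + 1); lra.
rewrite ge0_integralD//=; last 2 first.
- by move=> x _; rewrite lee_fin sqr_ge0.
- by apply/measurable_EFinP; exact: measurable_funX.
by rewrite integral_cst// mul1e lte_add_pinfty.
Qed.

Lemma weak_partial_box i v w : is_weak_partial Omega i v w ->
  weak_box Omega i (v \_ Omega) (w \_ Omega).
Proof.
move=> [_ H] a b F sF bO; have := H _ (test_prodf sF bO).
rewrite (partial_prodfE _ sF) [in LHS]Rintegral_mkcond [in RHS]Rintegral_mkcond => E.
transitivity (\int[mu]_x ((fun x => v x * prodf (upd F i (derive1 (F i))) x) \_ Omega) x).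
  by apply: eq_Rintegral => x _; rewrite /patch; case: ifP => //; rewrite mul0r.
rewrite E; congr (- _); apply: eq_Rintegral => x _.
by rewrite /patch; case: ifP => //; rewrite mul0r.
Qed.

Lemma test_function_partial i (phi : 'rV[R]_d -> R) : test_function Omega phi ->
  test_function Omega (partial i phi).
Proof.
move=> [sphi [K [cK KO] phi0]]; split.
  by move=> s; have := sphi (rcons s i); rewrite foldr_rcons.
exists K => // x Kx; rewrite /partial.
have cl : closed K by exact: compact_closed.
rewrite -(@derive_cst R 'rV[R]_d R 0 x (delta_mx ord0 i)).
apply: near_eq_derive.
have : \forall y \near x, (~` K) y.
  by apply: open_nbhs_nbhs; split => //; exact: closed_openC.
by apply: filterS => y /phi0.
Qed.

Variable u : 'rV[R]_d -> R.
Hypothesis su : sobolev 2 Omega u.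

Lemma weak_partialP i : is_weak_partial Omega i u (weak_partial Omega i u).
Proof. by case: su => _ /(_ i)[w Hw _]; exact: xgetPex (ex_intro _ w Hw). Qed.

(** [sobolev] provides a second derivative of some weak derivative w, not of the chosen one. Both
    have the same pairing with the i-th partial of a test function, which is a test function itself,
    so h serves for either. *)
Lemma weak_hessianP i j : is_weak_partial Omega i (weak_partial Omega j u)
  (weak_partial Omega i (weak_partial Omega j u)).
Proof.
case: su => _ /(_ j)[w [_ Hw] [_ /(_ i)[h [h2 Hh] _]]].
apply: (@xgetPex _ (cst 0) (is_weak_partial Omega i (weak_partial Omega j u))); exists h.
split => // phi tphi; rewrite -Hh//; have tp := test_function_partial i tphi.
have [_ /(_ _ tp) E1] := weak_partialP j; have E2 := Hw _ tp.
by apply: oppr_inj; rewrite -E1 -E2.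
Qed.

Lemma upd_comm F i j : i != j ->
  upd (upd F i (derive1 (F i))) j (derive1 (upd F i (derive1 (F i)) j)) =
  upd (upd F j (derive1 (F j))) i (derive1 (upd F j (derive1 (F j)) i)) :> ('I_d -> R -> R).
Proof.
move=> ij; apply/funext => k; rewrite /upd eq_sym (negPf ij) (eq_sym j i) (negPf ij).
by case: (eqVneq k j) => [->|//]; rewrite eq_sym (negPf ij).
Qed.

(** The entries are chosen separately, so symmetry holds only almost everywhere. It reduces to the
    order of differentiation in a tensor product, which is immaterial by [upd_comm]. It is needed
    for |H| to dominate both H and -H. *)
Lemma weak_hessian_sym : {ae mu, forall x, Omega x ->
  (weak_hessian Omega u x)^T = weak_hessian Omega u x}.
Proof.
have iG i := inL2_integrable (weak_partialP i).1.
have iH i j := inL2_integrable (weak_hessianP i j).1.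
have E i j : {ae mu, forall x, Omega x ->
    weak_partial Omega i (weak_partial Omega j u) x = weak_partial Omega j (weak_partial Omega i u) x}.
  have [->|ij] := eqVneq i j; first exact: aeW.
  pose h x := (weak_partial Omega i (weak_partial Omega j u) \_ Omega) x -
              (weak_partial Omega j (weak_partial Omega i u) \_ Omega) x.
  have ih : mu.-integrable setT (EFin \o h).
    by have := integrableB measurableT (iH i j) (iH j i); congr (mu.-integrable _ _).
  have H0 a b F : smc_box a b F -> box a b `<=` Omega -> \int[mu]_x (h x * prodf F x) = 0.
    move=> sF bO; under eq_Rintegral do rewrite mulrBl.
    rewrite RintegralB//; [|exact: integrable_mul_prodf sF _..].
    have E1 := weak_partial_box (weak_hessianP i j) sF bO.
    have E2 := weak_partial_box (weak_hessianP j i) sF bO.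
    have E3 := weak_partial_box (weak_partialP j) (smc_box_upd i sF) bO.
    have E4 := weak_partial_box (weak_partialP i) (smc_box_upd j sF) bO.
    apply/eqP; rewrite subr_eq0; apply/eqP.
    apply: oppr_inj; apply: etrans (esym E1) (etrans _ E2).
    apply: oppr_inj; apply: etrans (esym E3) (etrans _ E4).
    by rewrite upd_comm.
  apply: filterS (fundamental_lemma oOmega ih H0) => x Hx Ox.
  have xO : x \in Omega by rewrite inE.
  by have := subr0_eq (Hx Ox); rewrite /patch xO.
have EE : {ae mu, forall x i j, Omega x ->
    weak_partial Omega i (weak_partial Omega j u) x = weak_partial Omega j (weak_partial Omega i u) x}.
  by apply: filter_forall => i; apply: filter_forall => j; exact: E.
by apply: filterS EE => x Hx Ox; apply/matrixP => i j; rewrite !mxE Hx.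
Qed.

End sobolev_to_box.

(** * Summation over the mesh *)

Section lp.
Context {R : realType} {d : nat}.
Let mu := @lebesgue_rV R d.

Lemma Lp_normE (Omega : set 'rV[R]_d) (p : R) f : 0 < p -> (forall x, 0 <= f x) ->
  Lp_norm Omega p f = ((\int[mu]_(x in Omega) (f x `^ p)%:E) `^ p^-1)%E.
Proof.
move=> p0 f0; rewrite /Lp_norm unlock /Lnorm/=; congr (_ `^ _)%E.
rewrite [RHS]integral_mkcond; apply: eq_integral => x _.
rewrite !patchE; case: ifPn => _; first by rewrite abse_EFin ger0_norm// poweR_EFin.
by rewrite abse0 poweR_EFin powR0 ?gt_eqF.
Qed.

End lp.

Section mesh_measure.
Context {R : realType} {d : nat}.
Let mu := @lebesgue_rV R d.
Variables (Omega : set 'rV[R]_d) (T : mesh R d).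
Hypothesis polyOmega : polyhedral_domain Omega.
Hypothesis meshT : mesh_of Omega T.

Lemma elem_nondeg K : nondeg_simplex (@vtx _ _ T K). Proof. by case: meshT. Qed.

Lemma measurable_elem (K : 'I_(nelt T)) : measurable (elem K).
Proof. by apply: measurable_simplex; exact: elem_nondeg. Qed.

Lemma vol_elem (K : 'I_(nelt T)) : mu (elem K) = (vol K)%:E.
Proof. by rewrite /vol fineK// ge0_fin_numE//; exact: simplex_finite (elem_nondeg K). Qed.

Lemma vol_ge0 (K : 'I_(nelt T)) : 0 <= vol K.
Proof. by rewrite fine_ge0. Qed.

Lemma domain_elem x : Omega x -> exists K : 'I_(nelt T), elem K x.
Proof.
have [_ cover _ _] := meshT.
by move=> /subset_closure; rewrite -cover => -[K _ Kx]; exists K.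
Qed.

Lemma elem_sub_closure (K : 'I_(nelt T)) : elem K `<=` closure Omega.
Proof. by have [_ cover _ _] := meshT; rewrite -cover => x Kx; exists K. Qed.

Lemma isimplex_elem (K : 'I_(nelt T)) x : isimplex (vtx K) 0 x -> elem K x.
Proof. by apply: isimplex_sub => //; exact: elem_nondeg. Qed.

(** An open subset of the closure of Omega lies in the interior of that closure, which is Omega for
    a polyhedral domain. *)
Lemma isimplex_sub_domain (K : 'I_(nelt T)) : isimplex (vtx K) 0 `<=` Omega.
Proof.
have [_ _ _ <- _] := polyOmega.
rewrite -open_subsetE; last exact: open_isimplex.
by move=> x Ux; apply: (@elem_sub_closure K); exact: isimplex_elem.
Qed.

(** Overlaps of elements can only enlarge the sum of indicators, so covering suffices for an upper
    bound. *)
Lemma integral_elem_bound (Omega' : set 'rV[R]_d) (g : 'rV[R]_d -> R) (gam : 'I_(nelt T) -> R) :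
  measurable Omega' -> Omega' `<=` \bigcup_(K : 'I_(nelt T)) elem K ->
  measurable_fun Omega' g -> (forall x, 0 <= g x) -> (forall K, 0 <= gam K) ->
  (forall K : 'I_(nelt T), {ae mu, forall x, elem K x -> g x <= gam K}) ->
  (\int[mu]_(x in Omega') (g x)%:E <= (\sum_K vol K * gam K)%:E)%E.
Proof.
move=> mO Ocov mg g0 gam0 Hg.
pose F (K : 'I_(nelt T)) x := ((gam K * \1_(elem K) x)%:E : \bar R).
have mF K : measurable_fun setT (F K).
  apply/measurable_EFinP; apply: measurable_funM => //.
  exact: measurable_indic (measurable_elem K).
have F0 K x : (0 <= F K x)%E by rewrite lee_fin mulr_ge0// indicE.
apply: (@le_trans _ _ (\int[mu]_(x in Omega') (\sum_K F K x))%E).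
  apply: ae_ge0_le_integral => //.
  - by move=> x _; rewrite lee_fin.
  - exact/measurable_EFinP.
  - by move=> x _; apply: sume_ge0.
  - by apply: emeasurable_sum => K; exact: measurable_funTS.
  have HK : {ae mu, forall x (K : 'I_(nelt T)), elem K x -> g x <= gam K}.
    exact: (@filter_forall _ _ (fun (K : 'I_(nelt T)) x => elem K x -> g x <= gam K)).
  apply: filterS HK => x Hx /Ocov[K _ Kx].
  rewrite (bigD1 K)//= /F indicE mem_set// mulr1.
  rewrite -[leLHS]adde0; apply: leeD; first by rewrite lee_fin Hx.
  by apply: sume_ge0 => L _; exact: F0.
apply: (@le_trans _ _ (\int[mu]_x (\sum_K F K x))%E).
  apply: ge0_subset_integral => //.
  - by apply: emeasurable_sum => K; exact: mF.
  - by move=> x _; apply: sume_ge0.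
rewrite ge0_integral_sum//.
rewrite -sumEFin; apply: lee_sum => K _; rewrite /F.
under eq_integral do rewrite EFinM.
rewrite ge0_integralZl//; last 2 first.
- by apply/measurable_EFinP; exact: measurable_indic (measurable_elem K).
- by rewrite lee_fin.
rewrite integral_indic//; last exact: measurable_elem.
by rewrite setIT [vol K * _]mulrC EFinM -vol_elem.
Qed.

Lemma domain_finite : (mu Omega < +oo)%E.
Proof.
have oO : open Omega by case: polyOmega.
have mO : measurable Omega by exact: open_measurable_rV.
have -> : mu Omega = (\int[mu]_(x in Omega) 1%:E)%E.
  by rewrite integral_cst// mul1e.
apply: le_lt_trans (ltry (\sum_(K : 'I_(nelt T)) vol K * 1)).
apply: (@integral_elem_bound Omega (cst 1) (fun=> 1)) => //.
- by move=> x /domain_elem[K Kx]; exists K.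
- by move=> K; apply: aeW.
Qed.

End mesh_measure.

Section gradient_bound.
Context {R : realType} {d : nat}.
Let mu := @lebesgue_rV R d.
Variables (Omega : set 'rV[R]_d) (T : mesh R d) (u : 'rV[R]_d -> R).
Variables (B : 'I_(nelt T) -> 'M[R]_d) (c : 'I_(nelt T) -> R).
Hypothesis polyOmega : polyhedral_domain Omega.
Hypothesis meshT : mesh_of Omega T.
Hypothesis su : sobolev 2 Omega u.
Hypothesis cu : {within closure Omega, continuous u}.
Hypothesis spdB : forall K, spdmx (B K).
Hypothesis c0 : forall K, 0 <= c K.
Hypothesis Hc : forall K, {ae mu, forall x, elem K x ->
  forall z, qf (absmx (weak_hessian Omega u x)) z <= c K * qf (B K) z}.

Let oO : open Omega. Proof. by case: polyOmega. Qed.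

Let mO : measurable Omega. Proof. exact: open_measurable_rV. Qed.

Let muO : (mu Omega < +oo)%E. Proof. exact: domain_finite polyOmega meshT. Qed.

Definition gradient_const (v : 'I_d.+1 -> 'rV[R]_d) (S : 'M[R]_d) (k : R) : R :=
  spectral_norm S * (\tr (spreadmx v S) ^+ d.-1 / \det (spreadmx v S) *
    (d%:R * (2 * (d.+1%:R * (k * \tr (spreadmx v S) * d%:R))) ^+ 2)).

Let patchO f x : Omega x -> (f \_ Omega) x = f x :> R.
Proof. by move=> Ox; rewrite /patch mem_set. Qed.

Let isub K : isimplex (@vtx _ _ T K) 0 `<=` Omega.
Proof. exact: isimplex_sub_domain polyOmega meshT K. Qed.

Let oU K : open (isimplex (@vtx _ _ T K) 0). Proof. exact: open_isimplex. Qed.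

Let mU K : measurable (isimplex (@vtx _ _ T K) 0). Proof. exact: open_measurable_rV. Qed.

Let G i : 'rV[R]_d -> R := (weak_partial Omega i u) \_ Omega.

Let iG i : mu.-integrable setT (EFin \o G i).
Proof. exact: (inL2_integrable oO muO (weak_partialP su i).1). Qed.

Let integrable_sub (A : set 'rV[R]_d) f : measurable A -> mu.-integrable setT (EFin \o f) ->
  mu.-integrable setT (EFin \o (f \_ A)).
Proof.
move=> mA fi; rewrite -restrict_EFin; apply/(integrable_mkcond _ mA).
exact: integrableS fi.
Qed.

Let iu K : mu.-integrable setT (EFin \o (u \_ (isimplex (@vtx _ _ T K) 0))).
Proof.
have iuO : mu.-integrable setT (EFin \o (u \_ Omega)).
  by apply: inL2_integrable => //; case: su.
rewrite (_ : u \_ _ = (u \_ Omega) \_ (isimplex (vtx K) 0)); first exact: integrable_sub.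
apply/funext => x; rewrite /patch.
by case: ifP => // /set_mem/isub Ox; rewrite mem_set.
Qed.

Let uW K i : weak_box (isimplex (@vtx _ _ T K) 0) i (u \_ (isimplex (vtx K) 0)) (G i).
Proof.
apply: (@weak_box_eq _ _ _ i (u \_ Omega) _ (G i)) => //.
  by move=> x Ux; rewrite patchO ?patchE ?mem_set//; exact: isub Ux.
exact: (weak_box_sub (@isub K) (weak_partial_box (weak_partialP su i))).
Qed.

Lemma element_interp_gradient (K : 'I_(nelt T)) : exists a b,
  (forall x, elem K x -> nodal_interp Omega T u x = affine a b x) /\
  {ae mu, forall x, elem K x -> sqn (\col_i (G i x - a ord0 i)) <= gradient_const (vtx K) (B K) (c K)}.
Proof.
have [a [b [Ha Hb]]] := nodal_interp_affine u meshT K; exists a, b; split => //.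
pose H i j : 'rV[R]_d -> R := (weak_partial Omega i (weak_partial Omega j u)) \_ Omega.
have iH i j : mu.-integrable setT (EFin \o H i j).
  exact: (inL2_integrable oO muO (weak_hessianP su i j).1).
have WH i j : weak_box (isimplex (vtx K) 0) i (G j) (H i j).
  exact: (weak_box_sub (@isub K) (weak_partial_box (weak_hessianP su i j))).
have Hq : {ae mu, forall x, isimplex (vtx K) 0 x -> forall z : 'rV[R]_d,
    `|\sum_i \sum_j z ord0 i * z ord0 j * H i j x| <= c K * qf (B K) z^T}.
  have HS := weak_hessian_sym oO muO su.
  apply: filterS2 (Hc K) HS => x Hx Sx Ux z.
  have Ox : Omega x by exact: isub Ux.
  have Kx : elem K x by exact: (isimplex_elem meshT Ux).
  have E : \sum_i \sum_j z ord0 i * z ord0 j * H i j x = qf (weak_hessian Omega u x) z^T.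
    rewrite /qf trmxK mxE exchange_big; apply: eq_bigr => j _.
    rewrite mxE mulr_suml; apply: eq_bigr => i _.
    by rewrite !mxE /H patchO// mulrAC.
  by rewrite E; exact: le_trans (normr_qf_le _ (Sx Ox)) (Hx Kx z^T).
exact: (@element_gradient R d (vtx K) (closure Omega) u G H (B K) (c K) a b
  (elem_nondeg meshT K) (@elem_sub_closure _ _ _ _ meshT K) cu (iu K) iG iH (@uW K) WH (spdB K) (c0 K) Hq Hb).
Qed.

Let D := fun x => u x - nodal_interp Omega T u x.

(** If the difference has a weak derivative on Omega, it agrees on the open simplex with G - a by
    local uniqueness; if it has none, [weak_partial] is 0. The inequality covers both cases, so no
    matching across faces is required. *)
Lemma weak_partial_interp (K : 'I_(nelt T)) a b i :
  (forall x, elem K x -> nodal_interp Omega T u x = affine a b x) ->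
  {ae mu, forall x, elem K x -> weak_partial Omega i D x ^+ 2 <= (G i x - a ord0 i) ^+ 2}.
Proof.
move=> Ha; pose w := weak_partial Omega i D.
have [wP|wP] := pselect (is_weak_partial Omega i D w); last first.
  have -> : weak_partial Omega i D = cst 0.
    move: wP; rewrite /w /weak_partial; case: xgetP => [w' _ //|//].
  by apply: aeW => x _; rewrite expr0n/= sqr_ge0.
pose U := isimplex (@vtx _ _ T K) 0.
have UK x : U x -> elem K x.
  by move=> Ux; exact: (isimplex_elem meshT Ux).
have iw := inL2_integrable oO muO wP.1.
have W1 := weak_box_sub (@isub K) (weak_partial_box wP).
have W2 : weak_box U i (D \_ Omega) (fun x => G i x - (cst (a ord0 i) \_ U) x).
  apply: (@weak_box_eq _ _ _ i (fun x => (u \_ U) x - (affine a b \_ U) x) _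
    (fun x => G i x - (cst (a ord0 i) \_ U) x)) => //.
    by move=> x Ux; rewrite patchO ?patchE ?mem_set ?/D ?Ha//; [exact: UK|exact: isub Ux].
  exact: (weak_box_sub_affine a b (elem_nondeg meshT K) (@iu K) (iG i) (@uW K i)).
have iGa : mu.-integrable setT (EFin \o (fun x => G i x - (cst (a ord0 i) \_ U) x)).
  have := integrableB measurableT (iG i) (integrable_cst_isimplex (elem_nondeg meshT K) (a ord0 i)).
  by congr (mu.-integrable _ _).
have AE := ae_weak_unique (@oU K) iw iGa W1 W2.
have I := ae_isimplex (elem_nondeg meshT K).
apply: filterS2 AE I => x Ex Ix /Ix Ux.
have := Ex Ux; rewrite patchO; last exact: isub Ux.
by rewrite patchE mem_set// -/w => ->.
Qed.

Lemma measurable_weak_partial i (v : 'rV[R]_d -> R) : measurable_fun Omega (weak_partial Omega i v).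
Proof. by rewrite /weak_partial; case: xgetP => [w -> [[]]//|_]; exact: measurable_cst. Qed.

Lemma gradient_const_ge0 K : 0 <= gradient_const (@vtx _ _ T K) (B K) (c K).
Proof.
have sS := spd_congr (spdB K) (elem_nondeg meshT K).
rewrite mulr_ge0 ?spectral_norm_ge0//; first by case: (spdB K).
rewrite mulr_ge0//; last by rewrite mulr_ge0// sqr_ge0.
rewrite mulr_ge0 ?invr_ge0 ?(ltW (spd_det_gt0 sS))// exprn_ge0//.
exact: psd_tr_ge0 (spd_psd sS).
Qed.

Lemma H1_seminorm_interp_le :
  (H1_seminorm Omega (u \- nodal_interp Omega T u)%R <=
   (Num.sqrt (\sum_K vol K * gradient_const (vtx K) (B K) (c K)))%:E)%E.
Proof.
rewrite /H1_seminorm Lp_normE//; last by move=> x; exact: sqrtr_ge0.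
have -> : (\int[mu]_(x in Omega) (enorm (weak_grad Omega (u \- nodal_interp Omega T u) x) `^ 2)%:E =
    \int[mu]_(x in Omega) (sqn (weak_grad Omega D x))%:E)%E.
  apply: eq_integral => x _; rewrite powR_mulrn ?sqrtr_ge0// enorm_sqr//.
have H : (\int[mu]_(x in Omega) (sqn (weak_grad Omega D x))%:E <=
    (\sum_K vol K * gradient_const (vtx K) (B K) (c K))%:E)%E.
  apply: (integral_elem_bound meshT) => //.
  - by move=> x /(domain_elem meshT)[K Kx]; exists K.
  - apply: (eq_measurable_fun (fun x => \sum_i weak_partial Omega i D x ^+ 2)).
      by move=> x _; apply: eq_bigr => i _; rewrite mxE.
    by apply: measurable_sum => i; apply: measurable_funX; exact: measurable_weak_partial.
  - by move=> x; exact: sqn_ge0.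
  - exact: gradient_const_ge0.
  move=> K; have [a [b [Ha Hb]]] := element_interp_gradient K.
  have HD : {ae mu, forall x i, elem K x -> weak_partial Omega i D x ^+ 2 <= (G i x - a ord0 i) ^+ 2}.
    apply: (@filter_forall _ _ (fun i x => elem K x -> weak_partial Omega i D x ^+ 2 <= (G i x - a ord0 i) ^+ 2)).
    by move=> i; exact: weak_partial_interp Ha.
  apply: filterS2 Hb HD => x Hbx HDx Kx; apply: le_trans (Hbx Kx).
  by apply: ler_sum => i _; rewrite !mxE; exact: HDx.
have s0 : 0 <= \sum_K vol K * gradient_const (vtx K) (B K) (c K).
  by apply: sumr_ge0 => K _; rewrite mulr_ge0 ?vol_ge0 ?gradient_const_ge0.
rewrite -powR12_sqrt// -poweR_EFin.
apply: gt0_ler_poweR => //; rewrite ?in_itv/= ?andbT ?leey ?lee_fin//.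
  by rewrite andbT; apply: integral_ge0 => x _; rewrite lee_fin sqn_ge0.
by rewrite andbT.
Qed.

End gradient_bound.

(* The integral of a nonnegative function is a supremum over the simple functions
   below it, so that monotonicity holds without measurability. *)
Lemma ge0_integral_mono d (T : measurableType d) (R : realType) (m : {measure set T -> \bar R})
    (f g : T -> \bar R) : (forall x, 0 <= f x)%E -> (forall x, f x <= g x)%E ->
  (\int[m]_x f x <= \int[m]_x g x)%E.
Proof.
move=> f0 fg; have g0 x : (0 <= g x)%E by exact: le_trans (f0 x) (fg x).
rewrite !ge0_integralTE//; apply: le_ereal_sup => _ [h hf <-]; exists h => // x.
exact: le_trans (hf x) (fg x).
Qed.

Section integral_lower_bound.
Context {R : realType} {d : nat}.
Let mu := @lebesgue_rV R d.
Variables (Omega : set 'rV[R]_d) (T : mesh R d).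
Hypothesis polyOmega : polyhedral_domain Omega.
Hypothesis meshT : mesh_of Omega T.

(** By conformity x is a convex combination of common vertices. A vertex of K missing from L would
    then have barycentric coordinate 0 at x, yet x is interior to K. *)
Lemma isimplex_common_vertex (K L : 'I_(nelt T)) x : isimplex (vtx K) 0 x -> elem L x ->
  range (vtx K) `<=` range (vtx L).
Proof.
have [nd _ _ conform] := meshT.
move=> Kx Lx _ [k _ <-]; apply: contrapT => kL.
have xK : elem K x by exact: (isimplex_elem meshT Kx).
have : (elem K `&` elem L) x by [].
rewrite conform => -[n [c [p [cp c1 xE]]]].
have := Kx k; rewrite xE bary_sum_comb// big1 ?ltxx// => l _.
have [_ [[j _ pj] pL]] := cp l.
rewrite -pj bary_vtx//; have [jk|_] := eqVneq k j; last by rewrite mulr0.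
by exfalso; apply: kL; rewrite jk pj.
Qed.

Lemma isimplex_disjoint (K L : 'I_(nelt T)) x :
  isimplex (vtx K) 0 x -> isimplex (vtx L) 0 x -> K = L.
Proof.
have [nd _ inj _] := meshT; move=> Kx Lx; apply: inj.
have xK : elem K x by exact: (isimplex_elem meshT Kx).
have xL : elem L x by exact: (isimplex_elem meshT Lx).
by apply/seteqP; split; [exact: isimplex_common_vertex Kx xL|exact: isimplex_common_vertex Lx xK].
Qed.

(** A lower bound needs the elements to be disjoint. The null set Z collects the faces and the
    points where a bound fails; off Z every point of an element is interior to it, so at most one
    summand is nonzero. *)
Lemma integral_elem_lower_bound (f : 'rV[R]_d -> R) (th : 'I_(nelt T) -> R) :
  (forall x, 0 <= f x) -> (forall K, 0 <= th K) ->
  (forall K : 'I_(nelt T), {ae mu, forall x, elem K x -> th K <= f x}) ->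
  ((\sum_K vol K * th K)%:E <= \int[mu]_(x in Omega) (f x)%:E)%E.
Proof.
move=> f0 th0 Hf.
have nd := elem_nondeg meshT.
have : {ae mu, forall x (K : 'I_(nelt T)), elem K x -> th K <= f x /\ isimplex (vtx K) 0 x}.
  apply: (@filter_forall _ _ (fun (K : 'I_(nelt T)) x => elem K x -> th K <= f x /\ isimplex (vtx K) 0 x)) => K.
  by apply: filterS2 (Hf K) (ae_isimplex (nd K)) => x H1 H2 Kx; split; [exact: H1|exact: H2].
move=> [Z [mZ Z0 HZ]].
have nZ x (K : 'I_(nelt T)) : (elem K `\` Z) x -> th K <= f x /\ isimplex (vtx K) 0 x.
  move=> [Kx Zx]; apply: contrapT => H; apply: Zx; apply: HZ => /= HH.
  exact: H (HH K Kx).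
have mA K : measurable (@elem _ _ T K `\` Z).
  by apply: measurableD => //; exact: measurable_elem meshT K.
pose F (K : 'I_(nelt T)) x := ((th K * \1_(elem K `\` Z) x)%:E : \bar R).
have mF K : measurable_fun setT (F K).
  by apply/measurable_EFinP; apply: measurable_funM => //.
have F0 K x : (0 <= F K x)%E by rewrite lee_fin mulr_ge0// indicE.
have -> : ((\sum_K vol K * th K)%:E = \int[mu]_x (\sum_K F K x))%E.
  rewrite ge0_integral_sum//.
  rewrite -sumEFin; apply: eq_bigr => K _; rewrite /F.
  under eq_integral do rewrite EFinM.
  rewrite ge0_integralZl//; last 2 first.
  - by apply/measurable_EFinP; exact: measurable_indic (mA K).
  - by rewrite lee_fin.
  rewrite integral_indic// setIT mulrC EFinM; congr (_ * _)%E.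
  rewrite -(vol_elem meshT) (measureDI _ (measurable_elem meshT K) mZ).
  rewrite (_ : _ (elem K `&` Z) = 0%E) ?adde0//.
  apply/eqP; rewrite -measure_le0 -Z0; apply: le_measure => //; rewrite inE//.
  by apply: measurableI => //; exact: measurable_elem meshT K.
rewrite [leRHS]integral_mkcond.
apply: ge0_integral_mono => x; first by apply: sume_ge0.
have [[K Kx]|nK] := pselect (exists K : 'I_(nelt T), (elem K `\` Z) x); last first.
  rewrite big1; first by rewrite /patch; case: ifP => // _; rewrite lee_fin.
  move=> K _; rewrite /F indicE memNset ?mulr0// => Kx.
  by apply: nK; exists K.
have [H1 H2] := nZ _ _ Kx.
rewrite (bigD1 K)//= big1 ?adde0; last first.
  move=> L LK; rewrite /F indicE memNset ?mulr0// => Lx.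
  have [_ H2'] := nZ _ _ Lx.
  by move/eqP: LK; apply; exact: isimplex_disjoint H2' H2.
rewrite /F indicE mem_set// mulr1 patchE mem_set ?lee_fin//.
exact: isimplex_sub_domain polyOmega meshT K x H2.
Qed.

End integral_lower_bound.

(** * Exponents and the equidistribution argument *)

Section weights.
Context {R : realType} {d : nat}.
Hypothesis d_gt0 : (0 < d)%N.

Let d0 : (d%:R : R) != 0. Proof. by rewrite pnatr_eq0 -lt0n. Qed.

Let d2 : (d.+2%:R : R) != 0. Proof. by rewrite pnatr_eq0. Qed.

Let d2E : (d.+2%:R : R) = d%:R + 2. Proof. by rewrite -addn2 natrD. Qed.

Let powR_root (x a : R) : 0 <= x -> (x `^ (a / d%:R)) ^+ d = x `^ a.
Proof. by move=> x0; rewrite -powR_mulrn ?powR_ge0// -powRrM divfK. Qed.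

(* \det (M_K) ^ (1/2), for b and s the determinant and the norm of alpha I + |R_K|. *)
Definition mesh_weight (b s : R) : R := b `^ (d.+2%:R)^-1 * s `^ (d%:R / d.+2%:R).

Lemma mesh_weight_ge0 b s : 0 <= mesh_weight b s.
Proof. by rewrite mulr_ge0 ?powR_ge0. Qed.

(** The power (d+2)/d is the one that turns rho_K into the elementwise squared error: it makes ||B||
    linear, det(B) of power 1/d, and leaves |K| |K|^(2/d). *)
Lemma mesh_weight_powR V b s : 0 <= V -> 0 <= b -> 0 <= s ->
  (V * mesh_weight b s) `^ (d.+2%:R / d%:R) =
  V * (V `^ (2 / d%:R) * (b `^ d%:R^-1 * s)).
Proof.
move=> V0 b0 s0; rewrite powRM ?mesh_weight_ge0// powRM ?powR_ge0// -!powRrM.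
rewrite mulKf// (_ : d%:R / _ * _ = 1); last by rewrite mulrA divfK// divff.
rewrite powRr1// (_ : d.+2%:R / d%:R = 1 + 2 / d%:R); last by rewrite d2E; field.
have [->|Vn] := eqVneq V 0; last by rewrite powRD ?Vn ?implybT// powRr1// !mulrA.
by rewrite !mul0r powR0 ?mul0r// gt_eqF// addr_gt0// divr_gt0// ltr0n.
Qed.

(** To be read with t = tr(S), b = det(B), delta = det(E)^2, so that delta b = det(S). The powers of
    t combine to t^(d+1); alignment bounds t^d by k^d V^2 b, and V^2 <= C delta cancels the
    determinant. The last factor t is left as k V^(2/d) b^(1/d). *)
Lemma gradient_const_arith (V b s t delta c k C : R) :
  0 <= V -> 0 < b -> 0 <= s -> 0 <= t -> 0 <= k ->
  t <= k * (V `^ (2 / d%:R) * b `^ d%:R^-1) -> 0 < delta -> V ^+ 2 <= C * delta ->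
  V * (s * (t ^+ d.-1 / (delta * b) * (d%:R * (2 * (d.+1%:R * (c * t * d%:R))) ^+ 2))) <=
  4 * d%:R ^+ 3 * d.+1%:R ^+ 2 * k ^+ d.+1 * C * c ^+ 2 * (V * mesh_weight b s) `^ (d.+2%:R / d%:R).
Proof.
move=> V0 b0 s0 t0 k0 tle delta0 Vle.
rewrite mesh_weight_powR ?(ltW b0)//.
set x := V `^ (2 / d%:R) in tle *; set y := b `^ d%:R^-1 in tle *.
have x0 : 0 <= x by exact: powR_ge0.
have y0 : 0 <= y by exact: powR_ge0.
have xd : x ^+ d = V ^+ 2 by rewrite /x powR_root// powR_mulrn.
have yd : y ^+ d = b.
  by rewrite /y -(div1r d%:R) powR_root ?(ltW b0)// powRr1 ?(ltW b0).
have tE : t ^+ d.-1 * t ^+ 2 = t ^+ d.+1 by rewrite -exprD addn2 prednK.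
have td : t ^+ d.+1 <= k ^+ d.+1 * (x * y * (V ^+ 2 * b)).
  have -> : k ^+ d.+1 * (x * y * (V ^+ 2 * b)) = (k * (x * y)) ^+ d.+1.
    by rewrite exprMn [(x * y) ^+ _]exprS exprMn xd yd.
  by rewrite ler_pXn2r ?nnegrE// !mulr_ge0.
pose A := 4 * d%:R ^+ 3 * d.+1%:R ^+ 2 * (V * s * c ^+ 2) : R.
have A0 : 0 <= A.
  by rewrite /A; apply: mulr_ge0; [rewrite !mulr_ge0 ?exprn_ge0|rewrite mulr_ge0 ?sqr_ge0 ?mulr_ge0].
have -> : V * (s * (t ^+ d.-1 / (delta * b) * (d%:R * (2 * (d.+1%:R * (c * t * d%:R))) ^+ 2))) =
    A * (t ^+ d.+1 / (delta * b)).
  by rewrite -tE /A; field; rewrite !gt_eqF.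
have -> : 4 * d%:R ^+ 3 * d.+1%:R ^+ 2 * k ^+ d.+1 * C * c ^+ 2 * (V * (x * (y * s))) =
    A * (k ^+ d.+1 * (x * y * C)).
  by rewrite /A; ring.
rewrite ler_wpM2l// ler_pdivrMr ?mulr_gt0//; apply: le_trans td _.
have Vb : V ^+ 2 * b <= C * delta * b by rewrite ler_wpM2r// ltW.
have -> : k ^+ d.+1 * (x * y * C) * (delta * b) = k ^+ d.+1 * (x * y * (C * delta * b)) by ring.
by rewrite ler_wpM2l ?exprn_ge0// ler_wpM2l// mulr_ge0.
Qed.

(** Every power of rho_K is replaced by the uniform equidistribution bound, so the c_K^2 are summed
    alone and give N Cp^2. With q = (d+2)/d the factors N and N^(-q) leave N^(-2/d), whose root is
    the rate. *)
Lemma equidistribution_sum (T : finType) (N Ceq k Cp : R) (rho c : T -> R) :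
  0 < N -> 0 <= Ceq -> 0 <= k -> 0 <= Cp -> (forall K, 0 <= rho K) ->
  (forall K, rho K <= Ceq * (N^-1 * \sum_L rho L)) ->
  Num.sqrt (N^-1 * \sum_K c K ^+ 2) <= Cp ->
  Num.sqrt (\sum_K k ^+ 2 * c K ^+ 2 * rho K `^ (d.+2%:R / d%:R)) <=
  k * Ceq `^ (d.+2%:R / (2 * d%:R)) * Cp * N `^ (- d%:R^-1) *
    (\sum_K rho K) `^ (d.+2%:R / (2 * d%:R)).
Proof.
move=> N0 Ceq0 k0 Cp0 rho0 rhole cle.
set sigma := \sum_K rho K in rhole *.
have sigma0 : 0 <= sigma by exact: sumr_ge0.
set q := d.+2%:R / d%:R : R.
have q0 : 0 <= q by rewrite divr_ge0.
have -> : d.+2%:R / (2 * d%:R) = q / 2 :> R by rewrite /q; field; rewrite d0.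
have c2 : \sum_K c K ^+ 2 <= N * Cp ^+ 2.
  rewrite -ler_pdivrMl// -[leLHS]sqr_sqrtr.
    by rewrite ler_pXn2r ?nnegrE ?sqrtr_ge0.
  by rewrite mulr_ge0 ?invr_ge0 ?(ltW N0)// sumr_ge0// => K _; exact: sqr_ge0.
have rhoq K : rho K `^ q <= (Ceq * (N^-1 * sigma)) `^ q.
  apply: ge0_ler_powR; rewrite ?nnegrE//.
  by rewrite !mulr_ge0// invr_ge0 ltW.
set m := (Ceq * (N^-1 * sigma)) `^ q in rhoq *.
have m0 : 0 <= m by exact: powR_ge0.
have sumle : \sum_K k ^+ 2 * c K ^+ 2 * rho K `^ q <= k ^+ 2 * (N * Cp ^+ 2) * m.
  apply: (@le_trans _ _ (\sum_K k ^+ 2 * c K ^+ 2 * m)).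
    by apply: ler_sum => K _; rewrite ler_wpM2l// mulr_ge0 ?sqr_ge0.
  by rewrite -mulr_suml -mulr_sumr ler_wpM2r// ler_wpM2l// sqr_ge0.
set X := k * Ceq `^ (q / 2) * Cp * N `^ (- d%:R^-1) * sigma `^ (q / 2).
have X0 : 0 <= X by rewrite /X !mulr_ge0 ?powR_ge0.
have sq (z : R) : (z `^ (q / 2)) ^+ 2 = z `^ q.
  by rewrite -powR_mulrn ?powR_ge0// -powRrM divfK.
have XX : k ^+ 2 * (N * Cp ^+ 2) * m = X ^+ 2.
  rewrite /X !exprMn !sq /m !powRM ?mulr_ge0 ?invr_ge0 ?(ltW N0)//.
  have -> : N^-1 `^ q = N `^ (- q) by rewrite -powR_inv1 ?(ltW N0)// -powRrM mulN1r.
  have -> : (N `^ (- d%:R^-1)) ^+ 2 = N * N `^ (- q).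
    have -> : N * N `^ (- q) = N `^ (1 - q).
      by rewrite powRD ?powRr1 ?(ltW N0)// (gt_eqF N0) implybT.
    rewrite -powR_mulrn ?powR_ge0// -powRrM.
    by congr (_ `^ _); rewrite /q d2E; field.
  ring.
rewrite -[leRHS]ger0_norm// -sqrtr_sqr; apply: ler_wsqrtr; rewrite -XX; exact: sumle.
Qed.

End weights.

Section elements.
Context {R : realType} {d : nat}.
Hypothesis d_gt0 : (0 < d)%N.

Lemma spd_norm_gt0 (B : 'M[R]_d) : spdmx B -> 0 < spectral_norm B.
Proof.
move=> sB; pose i := Ordinal d_gt0; pose e : 'cV[R]_d := delta_mx i ord0.
have e0 : e != 0.
  by apply/eqP => /matrixP/(_ i ord0)/eqP; rewrite !mxE !eqxx oner_eq0.
have := sB.2 e e0; have := qf_le_spectral_norm (spd_psd sB) e => H1 H2.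
have := lt_le_trans H2 H1; rewrite pmulr_lgt0// sqn_gt0//.
Qed.

(** A scalar g in front of B contributes g^d to the determinant. In the square root the exponent of
    det(B) becomes 1/2 - d / (2 (d+2)) = 1/(d+2). *)
Lemma metric_det (alpha : R) (A : 'M[R]_d) : 0 < alpha ->
  let B := reg_abs alpha A in
  \det (metric_tensor alpha A) `^ 2^-1 = mesh_weight (d := d) (\det B) (spectral_norm B) /\
  \det (metric_tensor alpha A) `^ d%:R^-1 =
    (\det B `^ (- (d.+2%:R)^-1) * spectral_norm B `^ (2 / d.+2%:R)) * \det B `^ d%:R^-1.
Proof.
move=> a0 B; have sB : spdmx B by exact: reg_abs_spd.
have b0 := spd_det_gt0 sB; have s0 := spd_norm_gt0 sB.
rewrite /metric_tensor -/B detZ; set b := \det B in b0 *; set s := spectral_norm B in s0 *.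
have g0 : 0 <= b `^ (- (d.+2%:R)^-1) * s `^ (2 / d.+2%:R) by rewrite mulr_ge0 ?powR_ge0.
have d0 : d%:R != 0 :> R by rewrite pnatr_eq0 -lt0n.
have d2 : d.+2%:R != 0 :> R by rewrite pnatr_eq0.
have d2E : d.+2%:R = d%:R + 2 :> R by rewrite -addn2 natrD.
split; rewrite powRM ?exprn_ge0 ?(ltW b0)// -powR_mulrn// -powRrM; last first.
  by rewrite divff// powRr1.
rewrite powRM ?powR_ge0// -!powRrM /mesh_weight mulrAC -powRD; last first.
  by rewrite (gt_eqF b0) implybT.
congr (_ `^ _ * _ `^ _); last by field.
by rewrite d2E; field; rewrite -d2E.
Qed.

(** The scalar factor of the metric tensor cancels from both sides of the alignment condition. The
    edge matrix is the Jacobian times that of the reference simplex, whose columns supply the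
    constant. *)
Lemma aligned_trace (alpha Cali : R) (A : 'M[R]_d) (Khat v : 'I_d.+1 -> 'rV[R]_d) (V : R) :
  0 < alpha -> nondeg_simplex Khat ->
  d%:R^-1 * \tr ((jacobian_mx Khat v)^T *m metric_tensor alpha A *m jacobian_mx Khat v) <=
    Cali * V `^ (2 / d%:R) * \det (metric_tensor alpha A) `^ d%:R^-1 ->
  \tr (spreadmx v (reg_abs alpha A)) <=
    (d%:R * \sum_j sqn (col j (edge_mx Khat))) * Cali *
      (V `^ (2 / d%:R) * \det (reg_abs alpha A) `^ d%:R^-1).
Proof.
move=> a0 Khat_nd; have [_ ->] := metric_det A a0; set B := reg_abs alpha A.
have sB : spdmx B by exact: reg_abs_spd.
have b0 := spd_det_gt0 sB; have s0 := spd_norm_gt0 sB.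
rewrite /metric_tensor -/B; set g := _ * spectral_norm B `^ _.
have g0 : 0 < g by rewrite mulr_gt0 ?powR_gt0.
set J := jacobian_mx Khat v => H.
have JE : edge_mx v = J *m edge_mx Khat by rewrite /J /jacobian_mx mulmxKV.
clearbody J; have Jpsd : psdmx (J^T *m B *m J).
  split; first by rewrite !trmx_mul trmxK sB.1 mulmxA.
  by move=> x; have := spd_ge0 (J *m x) sB; rewrite -qf_conj.
have H' : \tr (J^T *m B *m J) <= d%:R * Cali * (V `^ (2 / d%:R) * \det B `^ d%:R^-1).
  have d0 : 0 < d%:R :> R by rewrite ltr0n.
  move: H; rewrite -scalemxAr -scalemxAl linearZ/= ler_pdivrMl//.
  have -> : d%:R * (Cali * V `^ (2 / d%:R) * (g * \det B `^ d%:R^-1)) =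
    g * (d%:R * Cali * (V `^ (2 / d%:R) * \det B `^ d%:R^-1)) by ring.
  by rewrite ler_pM2l.
rewrite /spreadmx JE trmx_mul.
have -> : (edge_mx Khat)^T *m J^T *m B *m (J *m edge_mx Khat) =
    (edge_mx Khat)^T *m (J^T *m B *m J) *m edge_mx Khat by rewrite !mulmxA.
apply: le_trans (tr_congr_le _ Jpsd) _.
rewrite [leRHS](_ : _ = d%:R * Cali * (V `^ (2 / d%:R) * \det B `^ d%:R^-1) *
   \sum_j sqn (col j (edge_mx Khat))); last by ring.
by rewrite ler_wpM2r// sumr_ge0// => j _; exact: sqn_ge0.
Qed.

(** C is gained twice, once from the d-th root of the determinant and once from the norm, hence the
    2 in its exponent. Raising to the power (d+2)/(2d) at the end leaves exactly one C. *)
Lemma recovery_lower (alpha C : R) (A H : 'M[R]_d) : 0 < alpha -> 0 < C ->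
  eig_ge C (invmx (reg_abs alpha A) *m reg_abs alpha H) ->
  C `^ (2 * (d%:R / d.+2%:R)) *
    mesh_weight (d := d) (\det (reg_abs alpha A)) (spectral_norm (reg_abs alpha A)) <=
  spectral_norm (\det (reg_abs alpha H) `^ d%:R^-1 *: reg_abs alpha H) `^ (d%:R / d.+2%:R).
Proof.
move=> a0 C0 ev; have sA := reg_abs_spd A a0; have sH := reg_abs_spd H a0.
set B := reg_abs alpha A in ev sA *; set X := reg_abs alpha H in ev sH *.
have bA := spd_det_gt0 sA; have bX := spd_det_gt0 sH.
have qfle := eig_ge_qf sA sH.1 ev.
have detle := det_ge sA sH.1 (ltW C0) qfle.
have d0 : d%:R != 0 :> R by rewrite pnatr_eq0 -lt0n.
have d2 : d.+2%:R != 0 :> R by rewrite pnatr_eq0.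
have detd : C * \det B `^ d%:R^-1 <= \det X `^ d%:R^-1.
  have -> : C * \det B `^ d%:R^-1 = (C ^+ d * \det B) `^ d%:R^-1.
    by rewrite powRM ?exprn_ge0 ?(ltW C0) ?(ltW bA)// -powR_mulrn ?(ltW C0)// -powRrM divff// powRr1// ltW.
  apply: ge0_ler_powR; rewrite ?nnegrE ?invr_ge0 ?ler0n ?(ltW bX)//.
  by rewrite mulr_ge0 ?exprn_ge0 ?(ltW C0) ?(ltW bA).
have Xpsd : psdmx (\det X `^ d%:R^-1 *: X).
  split; first by rewrite linearZ/= sH.1.
  by move=> x; rewrite -/(qf _ x) qfZ mulr_ge0 ?powR_ge0// spd_ge0.
have k0 : 0 < C * \det B `^ d%:R^-1 * C by rewrite !mulr_gt0 ?powR_gt0.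
have normle : C * \det B `^ d%:R^-1 * C * spectral_norm B <= spectral_norm (\det X `^ d%:R^-1 *: X).
  apply: (spectral_norm_mono Xpsd (spd_psd sA) k0) => x; rewrite qfZ.
  have q0 := spd_ge0 x sA; rewrite -(mulrA (C * _)).
  by apply: ler_pM => //; rewrite mulr_ge0 ?powR_ge0 ?(ltW C0).
have s0 := ltW (spd_norm_gt0 sA).
have E : C `^ (2 * (d%:R / d.+2%:R)) * mesh_weight (d := d) (\det B) (spectral_norm B) =
    (C * \det B `^ d%:R^-1 * C * spectral_norm B) `^ (d%:R / d.+2%:R).
  have C2 : 0 <= C ^+ 2 := sqr_ge0 _.
  have b0 : 0 <= \det B `^ d%:R^-1 := powR_ge0 _ _.
  rewrite (mulrAC C) -expr2 powRM ?(mulr_ge0 C2)// powRM//.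
  rewrite -powR_mulrn ?(ltW C0)// -!powRrM /mesh_weight mulrA.
  by congr (_ * _ `^ _ * _); rewrite mulrA mulVf// mul1r.
rewrite E; apply: ge0_ler_powR => //; rewrite ?nnegrE ?divr_ge0//.
- by rewrite mulr_ge0// ltW.
- by apply: spectral_norm_ge0; case: Xpsd.
Qed.

End elements.

Lemma eig_le_weaken (R : realType) (d : nat) (c c' : R) (X : 'M[R]_d) :
  c <= c' -> eig_le c X -> eig_le c' X.
Proof. by move=> cc' H a /H /le_trans; apply. Qed.

Lemma eig_ge_weaken (R : realType) (d : nat) (c c' : R) (X : 'M[R]_d) :
  c' <= c -> eig_ge c X -> eig_ge c' X.
Proof. by move=> cc' H a /H; exact: le_trans. Qed.

(** * Assembly of the error bound *)

Lemma interpolation_bound (R : realType) (d : nat) (d_gt0 : (0 < d)%N)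
    (Khat : 'I_d.+1 -> 'rV[R]_d) : nondeg_simplex Khat ->
  exists2 C : R, 0 < C &
  forall (Omega : set 'rV[R]_d) (T : mesh R d) (u : 'rV[R]_d -> R),
  polyhedral_domain Omega -> mesh_of Omega T -> sobolev 2 Omega u ->
  {within closure Omega, continuous u} ->
  forall CRm CRp Ceq Cali : R, 0 < CRm -> 0 < CRp -> 1 <= Ceq -> 1 <= Cali ->
  forall (alpha : R) (RK : 'I_(nelt T) -> 'M[R]_d) (CRmK CRpK : 'I_(nelt T) -> R),
  let H := weak_hessian Omega u in
  let N : R := (nelt T)%:R in
  0 < alpha ->
  (forall K, {ae lebesgue_rV d, forall x, elem K x ->
     eig_ge (CRmK K) (invmx (reg_abs alpha (RK K)) *m reg_abs alpha (H x))}) ->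
  (forall K, {ae lebesgue_rV d, forall x, elem K x ->
     eig_le (CRpK K) (invmx (reg_abs alpha (RK K)) *m absmx (H x))}) ->
  (forall K, CRm <= CRmK K) ->
  Num.sqrt (N^-1 * \sum_K CRpK K ^+ 2) <= CRp ->
  quasi_M_uniform Khat (fun K => metric_tensor alpha (RK K)) Ceq Cali ->
  (H1_seminorm Omega (u \- nodal_interp Omega T u)%R <=
   (C * Cali `^ (d.+1%:R / 2) * Ceq `^ (d.+2%:R / (2 * d%:R)) * (CRp / CRm)
      * N `^ (- d%:R^-1))%:E
   * Lp_norm Omega (d%:R / d.+2%:R)
       (fun x => spectral_norm
          (\det (reg_abs alpha (H x)) `^ d%:R^-1 *: reg_abs alpha (H x)))
     `^ (2^-1))%E.
Proof.
move=> Khat_nd; have [Cv Cv0 HCv] := @parallelepiped_volume R d 1 ler01.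
pose kappa : R := d%:R * \sum_j sqn (col j (edge_mx Khat)).
have kappa0 : 0 <= kappa by rewrite mulr_ge0// sumr_ge0// => j _; exact: sqn_ge0.
(* The factor 4 d^3 (d+1)^2 comes from d L^2, the power of kappa from tr(S)^(d+1) and alignment, and
   Cv^2 from the volume bound. *)
pose C0 : R := 4 * d%:R ^+ 3 * d.+1%:R ^+ 2 * kappa ^+ d.+1 * Cv ^+ 2.
have C00 : 0 <= C0.
  by rewrite /C0 mulr_ge0 ?sqr_ge0// mulr_ge0 ?exprn_ge0// mulr_ge0 ?exprn_ge0// mulr_ge0 ?exprn_ge0.
exists (Num.sqrt C0 + 1); first by rewrite ltr_wpDl ?sqrtr_ge0.
move=> Omega T u polyO meshT su cu CRm CRp Ceq Cali CRm0 CRp0 Ceq1 Cali1 alpha RK CRmK CRpK H N a0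
  Hm Hp Cm Cp qu.
have Ceq0 : 0 <= Ceq by exact: le_trans ler01 Ceq1.
have Cali0 : 0 <= Cali by exact: le_trans ler01 Cali1.
pose B K := reg_abs alpha (RK K).
have sB K : spdmx (B K) by exact: reg_abs_spd.
pose W K := mesh_weight (d := d) (\det (B K)) (spectral_norm (B K)).
pose rho K := vol K * W K.
have rho0 K : 0 <= rho K by rewrite mulr_ge0 ?vol_ge0 ?mesh_weight_ge0.
pose sigma := \sum_K rho K.
have sigma0 : 0 <= sigma by exact: sumr_ge0.
have N0 : 0 < N.
  have [_ _ [x Ox] _ _] := polyO; have [K _] := domain_elem meshT Ox.
  by rewrite ltr0n (leq_ltn_trans _ (ltn_ord K)).
have rhole K : rho K <= Ceq * (N^-1 * sigma).
  have := (qu K).1; rewrite (metric_det d_gt0 (RK K) a0).1.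
  under eq_bigr do rewrite (metric_det d_gt0 (RK _) a0).1.
  exact.
(* The constants [CRpK K] carry no sign. Absolute values make them nonnegative, weaken the upper
   hypothesis and leave the squares unchanged. *)
have upper : (H1_seminorm Omega (u \- nodal_interp Omega T u)%R <=
   (Num.sqrt (\sum_K vol K * gradient_const (vtx K) (B K) `|CRpK K|))%:E)%E.
  apply: H1_seminorm_interp_le => // K; apply: filterS (Hp K) => x Hx Kx z.
  apply: eig_le_qf => //; first by case: (absmx_psd (weak_hessian Omega u x)).
  exact: eig_le_weaken (ler_norm _) (Hx Kx).
pose k := Num.sqrt C0 * Cali `^ (d.+1%:R / 2).
have k0 : 0 <= k by rewrite mulr_ge0 ?sqrtr_ge0 ?powR_ge0.
have kE : k ^+ 2 = C0 * Cali ^+ d.+1.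
  by rewrite exprMn sqr_sqrtr// -[X in _ * X]powR_mulrn ?powR_ge0// -powRrM divfK// powR_mulrn.
have elemle K : vol K * gradient_const (vtx K) (B K) `|CRpK K| <=
    k ^+ 2 * CRpK K ^+ 2 * rho K `^ (d.+2%:R / d%:R).
  have nd := elem_nondeg meshT K; have sS := spd_congr (sB K) nd.
  have dE : \det (spreadmx (vtx K) (B K)) = \det (edge_mx (vtx K)) ^+ 2 * \det (B K).
    by rewrite /spreadmx !det_mulmx det_tr mulrAC -expr2.
  have E0 : \det (edge_mx (vtx K)) != 0 by rewrite -unitfE -unitmxE.
  have E2 : 0 < \det (edge_mx (vtx K)) ^+ 2 by rewrite lt_def sqr_ge0 expf_neq0.
  have V2 : vol K ^+ 2 <= Cv ^+ 2 * \det (edge_mx (vtx K)) ^+ 2.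
    have := HCv (vtx K ord0) (edge_mx (vtx K))^T _ (measurable_simplex nd).
    rewrite det_tr => /(_ E0 (simplex_sub_parallelepiped nd)).
    rewrite -/(elem K) (vol_elem meshT) lee_fin => Vle.
    rewrite -(real_normK (num_real (\det _))) -exprMn ler_pXn2r ?nnegrE ?vol_ge0//.
    by rewrite mulr_ge0 ?(ltW Cv0).
  have t0 := psd_tr_ge0 (spd_psd sS).
  have tle := aligned_trace d_gt0 a0 Khat_nd (qu K).2.
  rewrite /gradient_const dE.
  apply: le_trans (gradient_const_arith d_gt0 `|CRpK K| (vol_ge0 K) (spd_det_gt0 (sB K))
    (ltW (spd_norm_gt0 d_gt0 (sB K))) t0 (mulr_ge0 kappa0 Cali0) tle E2 V2) _.
  rewrite le_eqVlt kE real_normK ?num_real// /C0 (exprMn d.+1 kappa Cali); apply/orP; left; apply/eqP.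
  by rewrite -/(W K) -/(rho K); ring.
have main : Num.sqrt (\sum_K vol K * gradient_const (vtx K) (B K) `|CRpK K|) <=
    (Num.sqrt C0 + 1) * Cali `^ (d.+1%:R / 2) * Ceq `^ (d.+2%:R / (2 * d%:R)) * CRp *
      N `^ (- d%:R^-1) * sigma `^ (d.+2%:R / (2 * d%:R)).
  apply: (@le_trans _ _ (Num.sqrt (\sum_K k ^+ 2 * CRpK K ^+ 2 * rho K `^ (d.+2%:R / d%:R)))).
    by apply: ler_wsqrtr; apply: ler_sum => K _; exact: elemle.
  apply: le_trans (equidistribution_sum d_gt0 N0 Ceq0 k0 (ltW CRp0) rho0 rhole Cp) _.
  do 4 (rewrite ler_wpM2r ?powR_ge0 ?(ltW CRp0)//).
  by rewrite ler_wpM2r ?powR_ge0// lerDl.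
pose p : R := d%:R / d.+2%:R.
have dr : 0 < d%:R :> R by rewrite ltr0n.
have p0 : 0 < p by rewrite divr_gt0.
pose fn x := spectral_norm (\det (reg_abs alpha (H x)) `^ d%:R^-1 *: reg_abs alpha (H x)).
have fn0 x : 0 <= fn x.
  by apply: spectral_norm_ge0; rewrite linearZ/= (reg_abs_spd (H x) a0).1.
(* The root of the quasi-norm is the integral to the power 1/(2p) = (d+2)/(2d). This is the exponent
   of sigma in the upper estimate, so the two bounds fit together. *)
have lower : ((CRm * sigma `^ (d.+2%:R / (2 * d%:R)))%:E <= (Lp_norm Omega p fn `^ 2^-1))%E.
  rewrite Lp_normE// -poweRrM.
  have -> : CRm * sigma `^ (d.+2%:R / (2 * d%:R)) = (\sum_K vol K * (CRm `^ (2 * p) * W K)) `^ (p^-1 * 2^-1).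
    have -> : \sum_K vol K * (CRm `^ (2 * p) * W K) = CRm `^ (2 * p) * sigma.
      by rewrite mulr_sumr; apply: eq_bigr => K _; rewrite mulrCA.
    rewrite powRM ?powR_ge0// -powRrM (_ : 2 * p * _ = 1).
      rewrite powRr1 ?(ltW CRm0)//; congr (_ * _ `^ _).
      by rewrite /p invf_div invfM mulrA [RHS]mulrAC.
    by rewrite (mulrC p^-1) -invfM divff// mulf_neq0 // gt_eqF.
  rewrite -poweR_EFin; apply: gt0_ler_poweR.
  - by rewrite mulr_ge0// invr_ge0 ltW.
  - rewrite in_itv/= leey andbT lee_fin; apply: sumr_ge0 => K _.
    by rewrite !mulr_ge0 ?powR_ge0 ?vol_ge0 ?mesh_weight_ge0.
  - by rewrite in_itv/= leey andbT; apply: integral_ge0 => x _; rewrite lee_fin powR_ge0.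
  apply: (integral_elem_lower_bound polyO meshT) => //.
  - by move=> x; exact: powR_ge0.
  - by move=> K; rewrite mulr_ge0 ?powR_ge0 ?mesh_weight_ge0.
  move=> K; apply: filterS (Hm K) => x Hx Kx.
  apply: recovery_lower => //; exact: eig_ge_weaken (Cm K) (Hx Kx).
apply: le_trans upper _; apply: (le_trans (y := ((Num.sqrt C0 + 1) * Cali `^ (d.+1%:R / 2) *
    Ceq `^ (d.+2%:R / (2 * d%:R)) * (CRp / CRm) * N `^ (- d%:R^-1))%:E *
    (CRm * sigma `^ (d.+2%:R / (2 * d%:R)))%:E)%E); last first.
  apply: lee_wpmul2l lower.
  by rewrite lee_fin !mulr_ge0 ?powR_ge0 ?invr_ge0 ?addr_ge0 ?sqrtr_ge0// ltW.
rewrite -EFinM lee_fin; apply: le_trans main _.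
rewrite le_eqVlt; apply/orP; left; apply/eqP.
by field; rewrite gt_eqF.
Qed.

Theorem theorem3p1 (R : realType) (d : nat) (d_gt0 : (0 < d)%N)
    (Khat : 'I_d.+1 -> 'rV[R]_d) (Khat_nondeg : nondeg_simplex Khat)
    (Khat_vol : lebesgue_rV d (simplex Khat) = 1%E) (Ccea : R) :
  exists2 C : R, 0 < C &
  forall (Omega : set 'rV[R]_d) (L : operator R d)
    (I : Type) (Th : I -> mesh R d),
  polyhedral_domain Omega -> elliptic Omega L ->
  (forall h, mesh_of Omega (Th h)) ->
  cea_estimate Omega L Th Ccea ->
  forall f g u : 'rV[R]_d -> R,
  inL2 Omega f -> is_solution Omega L f g u -> sobolev 2 Omega u ->
  forall CRm CRp Ceq Cali : R, 0 < CRm -> 0 < CRp -> 1 <= Ceq -> 1 <= Cali ->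
  forall (h : I) (uh : 'rV[R]_d -> R), is_fem_solution Omega L f g (Th h) uh ->
  forall (alpha : R) (Rec : 'rV[R]_d -> 'M[R]_d)
    (RK : 'I_(nelt (Th h)) -> 'M[R]_d) (CRmK CRpK : 'I_(nelt (Th h)) -> R),
  let H := weak_hessian Omega u in
  let N : R := (nelt (Th h))%:R in
  0 < alpha ->
  (forall x, closure Omega x -> (Rec x)^T = Rec x) ->
  (forall K, is_average (elem K) Rec (RK K)) ->
  (forall K, {ae lebesgue_rV d, forall x, elem K x ->
     eig_ge (CRmK K) (invmx (reg_abs alpha (RK K)) *m reg_abs alpha (H x))}) ->
  (forall K, {ae lebesgue_rV d, forall x, elem K x ->
     eig_le (CRpK K) (invmx (reg_abs alpha (RK K)) *m absmx (H x))}) ->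
  (forall K, CRm <= CRmK K) ->
  Num.sqrt (N^-1 * \sum_K CRpK K ^+ 2) <= CRp ->
  quasi_M_uniform Khat (fun K => metric_tensor alpha (RK K)) Ceq Cali ->
  (H1_seminorm Omega (u \- uh)%R <=
   (C * Cali `^ (d.+1%:R / 2) * Ceq `^ (d.+2%:R / (2 * d%:R)) * (CRp / CRm)
      * N `^ (- d%:R^-1))%:E
   * Lp_norm Omega (d%:R / d.+2%:R)
       (fun x => spectral_norm
          (\det (reg_abs alpha (H x)) `^ d%:R^-1 *: reg_abs alpha (H x)))
     `^ (2^-1))%E.
Proof.
have [C C0 HC] := interpolation_bound d_gt0 Khat_nondeg.
(* Céa's constant comes without a sign; the maximum with 1 keeps the final constant positive. *)
pose m := Num.max Ccea 1.
have m0 : 0 < m by rewrite lt_max ltr01 orbT.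
exists (m * C); first exact: mulr_gt0.
move=> Omega L I Th polyO _ meshT cea f g u f2 sol su CRm CRp Ceq Cali CRm0 CRp0 Ceq1 Cali1 h uh fem
  alpha Rec RK CRmK CRpK H N a0 _ _ Hm Hp Cm Cp qu.
(* Continuity up to the boundary is part of [is_solution]; it supplies the limits at the faces
   without any Sobolev embedding. *)
have [_ cu _ _] := sol.
apply: le_trans (cea f g u f2 sol h uh fem) _.
apply: (@le_trans _ _ (m%:E * H1_seminorm Omega (u \- nodal_interp Omega (Th h) u)%R)%E).
  by apply: lee_wpmul2r; [exact: Lnorm_ge0|rewrite lee_fin le_max lexx].
have := HC Omega (Th h) u polyO (meshT h) su cu CRm CRp Ceq Cali CRm0 CRp0 Ceq1 Cali1
  alpha RK CRmK CRpK a0 Hm Hp Cm Cp qu.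
move=> /(lee_wpmul2l (ltW m0 : (0 <= m%:E)%E)) /le_trans; apply.
by rewrite muleA -EFinM !mulrA.
Qed.
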